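(* For each $n\ge 1$ let $X_n=\big(x_{jk}^{(n)}\big)_{1\le j,k\le n}$ be a random $n\times n$ quaternion self-dual Hermitian matrix, where $x_{jk}^{(n)}=a^{(n)}_{jk}+b^{(n)}_{jk}i_1+c^{(n)}_{jk}i_2+d^{(n)}_{jk}i_3$ with real random variables $a^{(n)}_{jk},b^{(n)}_{jk},c^{(n)}_{jk},d^{(n)}_{jk}$ (all matrices $X_n$, $n\ge1$, being defined on a common probability space), and put $W_n=\frac{1}{\sqrt n}X_n$. Suppose that for each $n$ the quaternion entries $x_{jk}^{(n)}$, $1\le j\le k\le n$, on and above the diagonal are independent, and that: (i) $\mathrm{E}\,x^{(n)}_{jk}=0$ for all $1\le j\le k\le n$; (ii) there is a constant $M$ (independent of $n$ and $j$) such that $\mathrm{E}\|x^{(n)}_{jj}\|^2<M$ for all $1\le j\le n$, and $\mathrm{E}\|x^{(n)}_{jk}\|^2=1$ for all $1\le j<k\le n$; (iii) for every constant $\eta>0$, $$\lim_{n\to\infty}\frac{1}{n^2}\sum_{j,k=1}^n \mathrm{E}\Big[\|x_{jk}^{(n)}\|^2\, I\big(\|x_{jk}^{(n)}\|\ge \eta\sqrt n\big)\Big]=0.$$ Then, almost surely, as $n\to\infty$ the empirical spectral distribution $F^{W_n}$ of $W_n$ converges weakly to the semicircular law, i.e. to the probability distribution with density $f(x)=\frac{1}{2\pi}\sqrt{4-x^2}$ for $x\in[-2,2]$ (and $0$ otherwise).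
   Context: Quaternions: $x=a+bi_1+ci_2+di_3$ with $a,b,c,d$ real, where $i_1,i_2,i_3$ is the standard quaternion basis. The conjugate is $\bar x=a-bi_1-ci_2-di_3$ and the norm is $\|x\|=\sqrt{a^2+b^2+c^2+d^2}$. The expectation of a random quaternion is taken componentwise. No independence is assumed among the four components of a single entry, nor between matrices for different $n$. A quaternion matrix $X=(x_{jk})$ is self-dual Hermitian if $x_{kj}=\overline{x_{jk}}$ for all $j,k$; in particular the diagonal entries are real ($x_{jj}=a_{jj}$). Complex representation: a quaternion $x=a+bi_1+ci_2+di_3$ is identified with the $2\times 2$ complex matrix $\begin{pmatrix}\lambda&\omega\\-\bar\omega&\bar\lambda\end{pmatrix}$, where $\lambda=a+bi$, $\omega=c+di$ and $i=\sqrt{-1}$. Replacing each entry by its $2\times2$ block, an $n\times n$ quaternion self-dual Hermitian matrix $W_n$ becomes a $2n\times 2n$ complex Hermitian matrix $W_n^R$, all of whose eigenvalues have even multiplicity. The eigenvalues of $W_n$ are the $n$ real numbers $s_1,\dots,s_n$ obtained by taking one eigenvalue from each of the $n$ pairs of equal eigenvalues of $W_n^R$. The empirical spectral distribution (ESD) of $W_n$ is $F^{W_n}(x)=\frac1n\sum_{i=1}^n I(s_i\le x)$, where $I(\cdot)$ is the indicator function; equivalently it is the ESD $\frac{1}{2n}\#\{\text{eigenvalues of }W_n^R\text{ (with multiplicity)}\le x\}$ of $W_n^R$. *)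

(* Defs.v *)
From mathcomp Require Import all_boot all_order all_algebra.
From mathcomp Require Import complex.
From mathcomp Require Import all_classical all_reals all_analysis.

Set Implicit Arguments.
Unset Strict Implicit.
Unset Printing Implicit Defensive.

Import Order.TTheory GRing.Theory Num.Theory numFieldNormedType.Exports.

Local Open Scope classical_set_scope.
Local Open Scope ring_scope.

(* (a, b, c, d) stands for a + b i_1 + c i_2 + d i_3. The measurable structure
   is the product one, i.e. the Borel sigma-algebra of R^4. *)
Definition quat (R : realType) : Type := (R * R * R * R)%type.

Section Quaternions.
Variable R : realType.
Implicit Type x : quat R.

Definition q0 x : R := x.1.1.1.
Definition q1 x : R := x.1.1.2.
Definition q2 x : R := x.1.2.
Definition q3 x : R := x.2.

Definition qconj x : quat R := (q0 x, - q1 x, - q2 x, - q3 x).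

Definition qnorm x : R :=
  Num.sqrt (q0 x ^+ 2 + q1 x ^+ 2 + q2 x ^+ 2 + q3 x ^+ 2).

Definition qscale (r : R) x : quat R := (r * q0 x, r * q1 x, r * q2 x, r * q3 x).

Definition self_dual_hermitian n (X : 'M[quat R]_n) : Prop :=
  forall j k, X k j = qconj (X j k).

Definition complex_block x : 'M[complex R]_2 :=
  let lambda := Complex (q0 x) (q1 x) in
  let omega := Complex (q2 x) (q3 x) in
  block_mx (lambda%:M : 'M[complex R]_1) (omega%:M : 'M[complex R]_1)
           ((- conjc omega)%:M : 'M[complex R]_1) ((conjc lambda)%:M : 'M[complex R]_1).

Definition complex_rep n (W : 'M[quat R]_n) : 'M[complex R]_(\sum_(i < n) 2) :=
  \mxblock_(j < n, k < n) complex_block (W j k).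

(* The eigenvalues of a complex matrix, listed with their multiplicities as
   roots of the characteristic polynomial (in an unspecified order). *)
Definition complex_eigenvalues m (A : 'M[complex R]_m) : seq (complex R) :=
  sval (closed_field_poly_normal (char_poly A)).

(* For W self-dual Hermitian, the eigenvalues of complex_rep W are real and of
   even multiplicity, so that in the sorted list t_0 <= t_1 <= ... of length 2n
   the pairs of equal eigenvalues are (t_(2i), t_(2i+1)) for i < n. *)
Definition qeigenvalue n (W : 'M[quat R]_n) (i : 'I_n) : R :=
  nth 0 (sort <=%R (map (@complex.Re R) (complex_eigenvalues (complex_rep W))))
    (2 * i).

Definition esd n (W : 'M[quat R]_n) (x : R) : R :=
  n%:R^-1 * \sum_(i < n) (qeigenvalue W i <= x)%R%:R.

Definition semicircle_pdf (x : R) : R :=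
  if (- 2 <= x <= 2)%R then (2 * pi)^-1 * Num.sqrt (4 - x ^+ 2) else 0.

Definition semicircle_cdf (x : R) : R :=
  (\int[@lebesgue_measure R]_(t in `]-oo, x]) semicircle_pdf t)%R.

(* Weak convergence of probability distributions on R, in terms of their
   distribution functions. *)
Definition weak_cvg (F : nat -> R -> R) (G : R -> R) : Prop :=
  forall x : R, {for x, continuous G} -> F n x @[n --> \oo] --> G x.

End Quaternions.

(* Mutual independence of the random elements Y i, for i in the finite set A. *)
Definition mutually_independent (d d' : measure_display) (T : measurableType d)
    (S : measurableType d') (R : realType) (P : probability T R)
    (I : finType) (A : {set I}) (Y : I -> T -> S) : Prop :=
  forall (J : {set I}) (B : I -> set S), J \subset A ->
    (forall i, measurable (B i)) ->
    P (\bigcap_(i in [set` J]) (Y i @^-1` B i)) =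
    (\prod_(i in J) P (Y i @^-1` B i))%E.

(* Main.v *)
(* The proof is by Stieltjes transforms. The resolvent G(z) of the 2n x 2n
   Hermitian matrix W has scalar diagonal 2 x 2 blocks, by the symplectic
   symmetry of quaternionic matrices. Removing the entries (j, k) and (k, j),
   which are independent of the rest, and expanding the resolvent to second
   order turns the identity tr(W G) = 2n + z tr G into the equation
   m^2 + z m + 1 = o(1) for the mean m of the normalized trace of G; Lindeberg's
   condition controls the remainder, without truncation of the entries.
   Changing one row of W changes tr G by O(1 / Im z), so a Hoeffding-type bound
   shows that the fourth central moment of the normalized trace is O(n^-2), whence
   almost sure convergence at countably many points z. The imaginary part of
   the Stieltjes transform is a Poisson smoothing of the spectral distribution;
   comparing it with the semicircle density on rational u + i / (p + 1) gives the
   convergence of the distribution functions. *)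

Require Import Defs.
From mathcomp Require Import all_boot all_order all_algebra.
From mathcomp Require Import complex.
From mathcomp Require Import all_classical all_reals all_analysis.
From mathcomp Require Import measurable_realfun ring lra zify.
Import Order.TTheory GRing.Theory Num.Theory numFieldNormedType.Exports.

Set Implicit Arguments.
Unset Strict Implicit.
Unset Printing Implicit Defensive.

Local Open Scope classical_set_scope.
Local Open Scope ring_scope.

(** Independence holds only between whole quaternion entries, so no estimate may use the joint law
    of the four components of an entry. The scalar diagonal blocks [g_j], [g_k] make this possible:
    their second-order term is tr (w g_k w^* g_j), and w w^* is the squared [qnorm] times the
    identity, so it sees the entry only through its norm. The other second-order terms do see the
    joint law, but they carry off-diagonal blocks of G, whose squared Frobenius norms add up to O(n)
    over all n^2 pairs.

    Nothing relates matrices of different sizes, so almost sure convergence needs a summable bound.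
    A variance of order 1/n is not summable, which is why the concentration goes up to the fourth
    moment.

    Around its root s in the upper half plane, m^2 + z m + 1 factors with a second factor of
    imaginary part at least Im z. An approximate solution with nonnegative imaginary part is
    therefore close to s for every z, not only for large Im z. The Stieltjes transform of the
    semicircle law is never computed: it is enough that Im s is within [error_bound] of pi times the
    density. *)

(** * Product sigma-algebras and independence *)

Section boxes.
Context (I : finType) (d : measure_display) (S : measurableType d).
Implicit Types (A : {set I}) (e : I -> S).

Definition boxes A : set (set (I -> S)) :=
  [set B | exists2 b : I -> set S, (forall i, measurable (b i)) &
    B = [set e | forall i, i \in A -> b i (e i)]].

(** All these spaces share the carrier [I -> S] and differ only in the sigma-algebra. One function
    of all coordinates can thus be tested for measurability against any block of coordinates without
    changing its type. *)
Definition box_space A := g_sigma_algebraType (boxes A).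

Lemma boxes_setT A : boxes A setT.
Proof. by exists (fun=> setT) => //; apply/seteqP; split. Qed.

Lemma boxes_setI A : setI_closed (boxes A).
Proof.
move=> _ _ [b mb ->] [c mc ->]; exists (fun i => b i `&` c i).
  by move=> i; exact: measurableI.
apply/seteqP; split => [e [eb ec] i iA|e ebc]; first by split; [exact: eb|exact: ec].
by split => i /ebc[].
Qed.

Lemma measurable_coord A i : i \in A ->
  measurable_fun setT (fun e : box_space A => e i).
Proof.
move=> iA _ /= Y mY; rewrite setTI; apply: sub_sigma_algebra.
exists (fun j => if j == i then Y else setT); first by move=> j; case: ifP.
apply/seteqP; split => e /=; first by move=> Yei j _; case: eqP => // ->.
by move=> /(_ i iA); rewrite eqxx.
Qed.

Lemma measurable_box_space d' (T : measurableType d') A (Y : T -> box_space A) :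
  (forall i, i \in A -> measurable_fun setT (fun w => Y w i)) ->
  measurable_fun setT Y.
Proof.
move=> mY; apply: (@measurability _ _ T (box_space A) setT Y (boxes A)) => //.
move=> _ [_ [b mb ->] <-]; rewrite setTI.
rewrite (_ : _ @^-1` _ = \bigcap_(i in [set` A]) ((fun w => Y w i) @^-1` b i)); last first.
  by apply/seteqP; split => w /= h i iA; exact: h.
apply: fin_bigcap_measurable => // i iA.
by rewrite -[X in measurable X]setTI; exact: mY.
Qed.

Definition splice A e e' : I -> S := fun i => if i \in A then e i else e' i.

Lemma measurable_splice (A B : {set I}) : [disjoint A & B]%B ->
  measurable_fun setT
    (fun p : box_space A * box_space B => splice A p.1 p.2 : box_space (A :|: B)).
Proof.
move=> dAB; apply: measurable_box_space => i; rewrite inE /splice => /orP[iA|iB].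
  by rewrite iA; apply: (measurableT_comp (measurable_coord iA)).
rewrite (disjointFl dAB iB).
exact: (measurableT_comp (measurable_coord iB)).
Qed.

End boxes.

Section decoupling.
Local Open Scope ereal_scope.
Context d d1 d2 (T : measurableType d) (E1 : measurableType d1)
  (E2 : measurableType d2) (R : realType) (P : probability T R).
Context (U : T -> E1) (V : T -> E2).
Hypotheses (mU : measurable_fun setT U) (mV : measurable_fun setT V).

(** The law of (U, V) agrees with the product of the two laws on rectangles, hence everywhere, and
    Tonelli separates the variables. The second sample point [w'] serves as an independent copy on
    the same space. *)
Lemma indep_ge0_integral :
  (forall A B, measurable A -> measurable B ->
    P (U @^-1` A `&` V @^-1` B) = P (U @^-1` A) * P (V @^-1` B)) ->
  forall f : E1 * E2 -> \bar R, measurable_fun setT f -> (forall x, 0 <= f x) ->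
  \int[P]_w f (U w, V w) = \int[P]_w' \int[P]_w f (U w, V w').
Proof.
move=> indep f mf f0.
have mUV : measurable_fun setT (fun w => (U w, V w)) by exact: measurable_fun_pair.
pose U' : {mfun T >-> E1} := mfun_Sub (mem_set mU : U \in mfun).
pose V' : {mfun T >-> E2} := mfun_Sub (mem_set mV : V \in mfun).
pose W' : {mfun T >-> (E1 * E2)%type} := mfun_Sub (mem_set mUV : _ \in mfun).
pose PU := distribution P U'.
pose PV := distribution P V'.
transitivity (\int[pushforward P W']_z f z).
  by rewrite ge0_integral_pushforward.
transitivity (\int[PU \x PV]_z f z).
  apply: eq_measure_integral => A mA _; apply/esym.
  by apply: product_measure_unique => // B C mB mC; exact: indep.
rewrite fubini_tonelli1// (fubini_tonelli f)//.
rewrite ge0_integral_pushforward//=; last 2 first.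
- exact: (measurable_fun_fubini_tonelli_G f).
- by move=> y _; exact: integral_ge0.
apply: eq_integral => w _ /=; rewrite ge0_integral_pushforward//=.
by apply: measurableT_comp => //; exact: measurable_fun_pair.
Qed.

End decoupling.

Section independent_blocks.
Local Open Scope ereal_scope.
Context d d' (T : measurableType d) (S : measurableType d') (R : realType).
Context (P : probability T R) (I : finType) (A : {set I}) (Y : I -> T -> S).
Hypothesis mY : forall i, i \in A -> measurable_fun setT (Y i).
Hypothesis indepY : mutually_independent P A Y.

Definition process (B : {set I}) : T -> box_space S B := fun w i => Y i w.

Lemma measurable_process (B : {set I}) : B \subset A ->
  measurable_fun setT (process B).
Proof.
by move=> /fintype.subsetP BA; apply: measurable_box_space => i iB; exact/mY/BA.
Qed.

Lemma process_boxE (B : {set I}) (b : I -> set S) :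
  process B @^-1` [set e | forall i, i \in B -> b i (e i)] =
  \bigcap_(i in [set` B]) (Y i @^-1` b i).
Proof. by apply/seteqP; split => w /= h i iB; exact: h. Qed.

Lemma indep_boxes (B C : {set I}) X Z : [disjoint B & C]%B ->
  B \subset A -> C \subset A -> boxes B X -> boxes C Z ->
  P (process B @^-1` X `&` process C @^-1` Z) =
  P (process B @^-1` X) * P (process C @^-1` Z).
Proof.
move=> dBC BA CA [b mb ->] [c mc ->].
(* [g] merges the two families of sides, so that a box over [B] and a box over [C] meet in a box
   over the union. *)
pose g i := if i \in B then b i else c i.
have mg i : measurable (g i) by rewrite /g; case: ifP.
rewrite !process_boxE !indepY//.
have -> : \bigcap_(i in [set` B]) Y i @^-1` b i `&`
    \bigcap_(i in [set` C]) Y i @^-1` c i =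
    \bigcap_(i in [set` B :|: C]) Y i @^-1` g i.
  apply/seteqP; split => [w [hb hc] i /=|w h].
    rewrite inE /g => /orP[iB|iC]; first by rewrite iB; exact: hb.
    by rewrite (disjointFl dBC iC); exact: hc.
  split => i /= iBC.
    by have := h i; rewrite /= inE iBC /g iBC; exact.
  by have := h i; rewrite /= inE iBC orbT /g (disjointFl dBC iBC); exact.
rewrite indepY//; last by rewrite finset.subUset BA.
rewrite (eq_bigl (predU (mem B) (mem C))); last by move=> i; rewrite !inE.
rewrite bigU//=; congr (_ * _); apply: eq_bigr => i iB; rewrite /g ?iB//.
by rewrite (disjointFl dBC iB).
Qed.

Lemma indep_blocks (B C : {set I}) : [disjoint B & C]%B ->
  B \subset A -> C \subset A ->
  forall X Z, measurable X -> measurable Z ->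
  P (process B @^-1` X `&` process C @^-1` Z) =
  P (process B @^-1` X) * P (process C @^-1` Z).
Proof.
move=> dBC BA CA.
have pre_meas (D : {set I}) X : D \subset A -> measurable X ->
    measurable (process D @^-1` X).
  by move=> DA mX; rewrite -[X in measurable X]setTI; exact: measurable_process.
(* Dynkin's argument, one coordinate of the product at a time. *)
have key (D : {set I}) (H : set T) :
    D \subset A -> measurable H ->
    (forall X, boxes D X -> P (process D @^-1` X `&` H) = P (process D @^-1` X) * P H) ->
    forall X, measurable X -> P (process D @^-1` X `&` H) = P (process D @^-1` X) * P H.
  move=> DA mH hbox X mX.
  have mD := measurable_process DA.
  pose push (m : {measure set T -> \bar R}) : {measure set (box_space S D) -> \bar R} :=
    measure_function_pushforward__canonical__measure_function_Measure m mD.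
  pose m1 := push (mrestr P mH).
  have PH0 : (0 <= fine (P H))%R by exact: fine_ge0.
  pose m2 : {measure set (box_space S D) -> \bar R} := mscale (NngNum PH0) (push P).
  have PHE : (fine (P H))%:E = P H by rewrite fineK// fin_num_measure.
  have m2E Z : m2 Z = P (process D @^-1` Z) * P H.
    by rewrite /m2 /= /mscale /= PHE muleC.
  rewrite -m2E; change (m1 X = m2 X).
  apply: (@measure_unique _ R (box_space S D) (boxes D) (fun=> setT) _ _ _ _ m1 m2) => //.
  - exact: boxes_setI.
  - by move=> _; exact: boxes_setT.
  - by rewrite bigcup_const.
  - by move=> Z bZ; rewrite m2E -hbox.
  - move=> _; rewrite /m1 /= /pushforward /mrestr/=.
    rewrite preimage_setT setTI; apply: le_lt_trans (ltry 1); exact: probability_le1.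
move=> X Z mX mZ.
apply: (key _ _ _ _) => //; first exact: pre_meas.
move=> {mX}X bX; rewrite setIC muleC.
apply: (key _ _ _ _) => //; first by apply: pre_meas => //; exact: sub_sigma_algebra.
by move=> {mZ}Z bZ; rewrite setIC muleC; exact: indep_boxes.
Qed.

End independent_blocks.

(** * Expectations of real random variables *)

Section real_expectation.
Context d (T : measurableType d) (R : realType) (P : probability T R).
Implicit Types f g : T -> R.

Definition L1 f := P.-integrable setT (EFin \o f).
Definition Ex f : R := (\int[P]_w f w)%R.

Lemma L1_measurable f : L1 f -> measurable_fun setT f.
Proof. by move=> /measurable_int /measurable_EFinP. Qed.

Lemma L1_EFin f : L1 f -> (\int[P]_w (f w)%:E)%E = (Ex f)%:E.
Proof. by move=> /integrable_fin_num h; rewrite /Ex /Rintegral fineK// h. Qed.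

Lemma L1_bounded K f : measurable_fun setT f -> (forall w, `|f w| <= K) -> L1 f.
Proof.
move=> mf fK; apply: (@le_integrable _ _ _ P setT measurableT _ (EFin \o cst K)).
- exact/measurable_EFinP.
- by move=> w _ /=; rewrite lee_fin (le_trans (fK w))// ler_norm.
- by apply: finite_measure_integrable_cst.
Qed.

Lemma L1_cst c : L1 (cst c).
Proof. exact: finite_measure_integrable_cst. Qed.

Lemma L1D f g : L1 f -> L1 g -> L1 (fun w => f w + g w).
Proof. by move=> lf lg; exact: (integrableD _ lf lg). Qed.

Lemma L1N f : L1 f -> L1 (fun w => - f w).
Proof. by move=> lf; exact: (integrableN lf). Qed.

Lemma L1B f g : L1 f -> L1 g -> L1 (fun w => f w - g w).
Proof. by move=> lf lg; apply: L1D => //; exact: L1N. Qed.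

Lemma L1Z c f : L1 f -> L1 (fun w => c * f w).
Proof. by move=> lf; exact: (integrableZl _ c lf). Qed.

Lemma L1_le f g : measurable_fun setT f -> (forall w, `|f w| <= g w) -> L1 g -> L1 f.
Proof.
move=> mf fg lg; apply: (@le_integrable _ _ _ P setT measurableT _ (EFin \o g)) => //.
- exact/measurable_EFinP.
- by move=> w _ /=; rewrite lee_fin (le_trans (fg w))// ler_norm.
Qed.

Lemma L1M K f g : L1 f -> measurable_fun setT g -> (forall w, `|g w| <= K) ->
  L1 (fun w => f w * g w).
Proof.
move=> lf mg gK; apply: (@L1_le _ (fun w => K * `|f w|)).
- by apply: measurable_funM => //; exact: L1_measurable.
- by move=> w; rewrite normrM mulrC ler_wpM2r.
- by apply: L1Z; exact: (integrable_abse lf).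
Qed.

Lemma L1_cutoff (f g : T -> R) (c : R) : L1 f -> measurable_fun setT g ->
  L1 (fun w => f w * (c <= g w)%R%:R).
Proof.
move=> lf mg; apply: (@L1M 1) => //.
  have -> : (fun w => (c <= g w)%R%:R : R) = (fun w => if c <= g w then 1 else 0).
    by apply/funext => w; case: ifP.
  by apply: measurable_fun_ifT => //; exact: measurable_fun_ler.
by move=> w; case: (c <= _); rewrite ?normr1 ?normr0.
Qed.

Lemma L1_norm f : L1 f -> L1 (fun w => `|f w|).
Proof. by move=> lf; exact: (integrable_abse lf). Qed.

Lemma L1_sum (I : Type) (s : seq I) (Q : pred I) (F : I -> T -> R) :
  (forall i, Q i -> L1 (F i)) -> L1 (fun w => \sum_(i <- s | Q i) F i w).
Proof.
move=> LF; elim: s => [|i s IH].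
  have -> : (fun w : T => \sum_(i <- [::] | Q i) F i w) = cst 0.
    by apply/funext => w; rewrite big_nil.
  exact: L1_cst.
have -> : (fun w : T => \sum_(j <- i :: s | Q j) F j w) =
    fun w => (if Q i then F i w else 0) + \sum_(j <- s | Q j) F j w.
  by apply/funext => w; rewrite big_cons; case: ifP; rewrite ?add0r.
by case Qi : (Q i); apply: L1D => //; [exact: LF|exact: L1_cst].
Qed.

Lemma Ex_cst c : Ex (cst c) = c.
Proof. by rewrite /Ex Rintegral_cst// [X in fine X]probability_setT mulr1. Qed.

Lemma ExD f g : L1 f -> L1 g -> Ex (fun w => f w + g w) = Ex f + Ex g.
Proof. by move=> lf lg; rewrite /Ex RintegralD. Qed.

Lemma ExB f g : L1 f -> L1 g -> Ex (fun w => f w - g w) = Ex f - Ex g.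
Proof. by move=> lf lg; rewrite /Ex RintegralB. Qed.

Lemma ExZ c f : L1 f -> Ex (fun w => c * f w) = c * Ex f.
Proof. by move=> lf; rewrite /Ex RintegralZl. Qed.

Lemma Ex_sum (I : Type) (s : seq I) (Q : pred I) (F : I -> T -> R) :
  (forall i, Q i -> L1 (F i)) ->
  Ex (fun w => \sum_(i <- s | Q i) F i w) = \sum_(i <- s | Q i) Ex (F i).
Proof.
move=> LF; elim: s => [|i s IH].
  rewrite big_nil -[RHS](Ex_cst 0); congr Ex.
  by apply/funext => w; rewrite big_nil.
rewrite big_cons; case: ifP => Qi; rewrite -?IH -?ExD; [|exact: LF|exact: L1_sum|];
  by congr Ex; apply/funext => w; rewrite big_cons Qi.
Qed.

Lemma Ex_le f g : L1 f -> L1 g -> (forall w, f w <= g w) -> Ex f <= Ex g.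
Proof. by move=> lf lg fg; apply: le_Rintegral. Qed.

Lemma Ex_ge0 f : (forall w, 0 <= f w) -> 0 <= Ex f.
Proof. by move=> f0; apply: Rintegral_ge0. Qed.

Lemma Ex_norm f : L1 f -> `|Ex f| <= Ex (fun w => `|f w|).
Proof. by move=> lf; apply: le_normr_Rintegral. Qed.

Lemma Ex_norm_le f K : L1 f -> (forall w, `|f w| <= K) -> `|Ex f| <= K.
Proof.
move=> lf fK; apply: (le_trans (Ex_norm lf)); rewrite -[leRHS]Ex_cst.
by apply: Ex_le => //; [exact: L1_norm|exact: L1_cst].
Qed.

End real_expectation.

Section indep_expectation.
Context d d1 d2 (T : measurableType d) (E1 : measurableType d1)
  (E2 : measurableType d2) (R : realType) (P : probability T R).
Context (U : T -> E1) (V : T -> E2).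
Hypotheses (mU : measurable_fun setT U) (mV : measurable_fun setT V).
Hypothesis indep : forall A B, measurable A -> measurable B ->
  P (U @^-1` A `&` V @^-1` B) = (P (U @^-1` A) * P (V @^-1` B))%E.
Variables (f : E1 * E2 -> R) (K : R).
Hypotheses (mf : measurable_fun setT f) (f0 : forall x, 0 <= f x <= K).

Let bnd x : `|f x| <= K.
Proof. by have /andP[fx0 fxK] := f0 x; rewrite ger0_norm. Qed.

Lemma measurable_section1 v : measurable_fun setT (fun w => f (U w, v)).
Proof. by apply: measurableT_comp => //; exact: measurable_fun_pair. Qed.

Lemma L1_section1 v : L1 P (fun w => f (U w, v)).
Proof. by apply: (@L1_bounded _ _ _ _ K) => //; exact: measurable_section1. Qed.

Lemma measurable_Ex_section : measurable_fun setT (fun v => Ex P (fun w => f (U w, v))).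
Proof.
apply/measurable_EFinP; rewrite (_ : _ \o _ = fun v => (\int[P]_w (f (U w, v))%:E)%E).
  apply: (measurable_fun_fubini_tonelli_G (fun x : T * E2 => (f (U x.1, x.2))%:E)).
    apply/measurable_EFinP; apply: measurableT_comp => //.
    by apply: measurable_fun_pair => //; exact: measurableT_comp.
  by move=> x /=; rewrite lee_fin; case/andP: (f0 (U x.1, x.2)).
by apply/funext => v /=; rewrite L1_EFin//; exact: L1_section1.
Qed.

Lemma Ex_section_bnd v : 0 <= Ex P (fun w => f (U w, v)) <= K.
Proof.
rewrite Ex_ge0/=; last by move=> w; case/andP: (f0 (U w, v)).
apply: le_trans (ler_norm _) _; apply: Ex_norm_le => //; exact: L1_section1.
Qed.

Lemma indep_Ex : Ex P (fun w => f (U w, V w)) =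
  Ex P (fun w' => Ex P (fun w => f (U w, V w'))).
Proof.
apply: EFin_inj; rewrite -!L1_EFin; first last.
- apply: (@L1_bounded _ _ _ _ K) => //; apply: measurableT_comp => //.
  exact: measurable_fun_pair.
- apply: (@L1_bounded _ _ _ _ K).
    by apply: (measurableT_comp measurable_Ex_section).
  by move=> w; have /andP[? ?] := Ex_section_bnd (V w); rewrite ger0_norm.
rewrite (indep_ge0_integral mU mV indep (f := fun x => (f x)%:E)).
- by apply: eq_integral => w _; rewrite L1_EFin//; exact: L1_section1.
- exact/measurable_EFinP.
- by move=> x; rewrite lee_fin; case/andP: (f0 x).
Qed.

End indep_expectation.

(** * Elementary inequalities for the exponential *)

Section exp_bounds.
Context {R : realType}.
Implicit Types x : R.

(** Both signs start from e^x - 1 - x <= x (e^x - 1), which is (1 - x) e^x <= 1 in disguise. Applied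
    to a centred variable, whose linear term integrates to zero, it is a form of Hoeffding's lemma
    with a crude constant. *)
Lemma expR_le_quadratic x c : `|x| <= c -> expR x <= 1 + x + c ^+ 2 * expR c.
Proof.
move=> xc; have c0 : 0 <= c by rewrite (le_trans _ xc).
have h1 : expR x - 1 <= x * expR x.
  have := expR_ge1Dx (- x); rewrite expRN => h.
  have ex0 := expR_gt0 x.
  have : (1 - x) * expR x <= 1.
    by rewrite -ler_pdivlMr// mul1r.
  lra.
have ec : 1 <= expR c by have := expR_ge1Dx c; lra.
suff : expR x - 1 - x <= c ^+ 2 * expR c by lra.
have c2 : c * c <= c ^+ 2 * expR c.
  by rewrite expr2 ler_peMr// mulr_ge0.
have [x0|x0] := leP 0 x.
  rewrite ger0_norm// in xc.
  have : x * (expR x - 1) <= c * (c * expR c).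
    apply: ler_pM => //; first by have := expR_ge1Dx x; lra.
    apply: le_trans h1 _; apply: ler_pM => //.
    by rewrite ler_expR.
  by rewrite expr2 -mulrA; lra.
rewrite ltr0_norm// in xc.
have h2 := expR_ge1Dx x.
have h3 : expR x <= 1 by rewrite -expR0 ler_expR ltW.
have : (- x) * (1 - expR x) <= c * c.
  by apply: ler_pM; lra.
lra.
Qed.

(** The constant is 4^4: for x >= 0, raise x / 4 <= e^(x / 4) to the fourth power. *)
Lemma pow4_le_expR x : x ^+ 4 <= 256 * (expR x + expR (- x)).
Proof.
wlog x0 : x / 0 <= x.
  move=> h; have [/h//|x0] := leP 0 x.
  have := h (- x); rewrite oppr_ge0 (ltW x0) opprK addrC => /(_ isT).
  by rewrite exprNn -signr_odd/= expr0 mul1r.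
have h : x ^+ 4 <= 256 * expR x.
  have -> : expR x = expR (x / 4) ^+ 4 by rewrite -expRM_natl; congr expR; lra.
  have h : x / 4 <= expR (x / 4) by have := expR_ge1Dx (x / 4); lra.
  have : (x / 4) ^+ 4 <= expR (x / 4) ^+ 4.
    by apply: lerXn2r => //; rewrite nnegrE ?divr_ge0// ltW// expR_gt0.
  rewrite exprMn; lra.
have := expR_gt0 (- x); lra.
Qed.

End exp_bounds.

(** * Bounded differences *)

Lemma splice_id (I : finType) d (S : measurableType d) (B : {set I}) (e : I -> S) :
  splice B e e = e.
Proof. by apply/funext => i; rewrite /splice; case: ifP. Qed.

Section bounded_differences.
Context d d' (T : measurableType d) (S : measurableType d') (R : realType).
Context (P : probability T R) (I : finType) (A : {set I}) (Y : I -> T -> S).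
Hypothesis mY : forall i, i \in A -> measurable_fun setT (Y i).
Hypothesis indepY : mutually_independent P A Y.
Implicit Types (B C : {set I}) (e : I -> S).

Let Z w : I -> S := fun i => Y i w.

(** When the coordinates in [B] are independent of the others, this is the conditional expectation
    of [f] given the coordinates outside [B], obtained by resampling [B]. It is defined at every
    point, so bounds and oscillations of [f] pass to it pointwise. *)
Definition average B (f : (I -> S) -> R) e : R := Ex P (fun w => f (splice B (Z w) e)).

Section one_block.
Variables (B C : {set I}) (f : (I -> S) -> R) (K : R).
Hypotheses (dBC : [disjoint B & C]%B) (BA : B \subset A) (CA : C \subset A).
Hypothesis mf : measurable_fun setT (f : box_space S (B :|: C) -> R).
Hypothesis f0 : forall e, 0 <= f e <= K.

Let F (p : box_space S B * box_space S C) : R := f (splice B p.1 p.2).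

Let mF : measurable_fun setT F.
Proof. exact: (measurableT_comp mf (measurable_splice dBC)). Qed.

Let F0 p : 0 <= F p <= K. Proof. exact: f0. Qed.

Let indBC := indep_blocks mY indepY dBC BA CA.
Let mB := measurable_process mY BA.
Let mC := measurable_process mY CA.

Lemma measurable_average : measurable_fun setT (average B f : box_space S C -> R).
Proof. exact: (measurable_Ex_section P mB mF F0). Qed.

Lemma average_bnd e : 0 <= average B f e <= K.
Proof. exact: (Ex_section_bnd P mB mF F0). Qed.

Lemma L1_average_section (e : I -> S) : L1 P (fun w => f (splice B (Z w) e)).
Proof. exact: (L1_section1 P mB mF F0). Qed.

Lemma Ex_average : Ex P (fun w => f (Z w)) = Ex P (fun w => average B f (Z w)).
Proof.
rewrite -[RHS](indep_Ex mB mC indBC mF F0); congr Ex; apply/funext => w.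
by rewrite /F /= splice_id.
Qed.

(** With the coordinates outside [B] frozen, [f] differs from its average by at most [c], and the
    difference has mean zero. Integrating [expR_le_quadratic] over [B] alone therefore costs one
    factor 1 + c^2 e^c. *)
Lemma Ex_expR_average c :
  (forall e e', (forall i, i \notin B -> e i = e' i) -> `|f e - f e'| <= c) ->
  Ex P (fun w => expR (f (Z w))) <=
  (1 + c ^+ 2 * expR c) * Ex P (fun w => expR (average B f (Z w))).
Proof.
move=> fc.
have exp_bnd (x : R) : 0 <= x <= K -> 0 <= expR x <= expR K.
  by move=> /andP[_ xK]; rewrite ler_expR xK (ltW (expR_gt0 _)).
have exp_norm (x : R) : 0 <= x <= K -> `|expR x| <= expR K.
  by move=> /exp_bnd/andP[? ?]; rewrite ger0_norm.
have mexpF : measurable_fun setT (expR \o F) by exact: measurableT_comp.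
have -> : Ex P (fun w => expR (f (Z w))) =
    Ex P (fun w' => Ex P (fun w => expR (f (splice B (Z w) (Z w'))))).
  rewrite -[RHS](indep_Ex mB mC indBC mexpF (K := expR K)); last first.
    by move=> x; exact: exp_bnd.
  by congr Ex; apply/funext => w; rewrite /F /= splice_id.
have mavg : measurable_fun setT (fun w => average B f (Z w)).
  exact: (measurableT_comp measurable_average mC).
rewrite -ExZ; last first.
  apply: (@L1_bounded _ _ _ _ (expR K)); first exact: measurableT_comp.
  by move=> w; apply: exp_norm; exact: average_bnd.
have bnd2 e : L1 P (fun w => expR (f (splice B (Z w) e))).
  apply: (@L1_bounded _ _ _ _ (expR K)).
    apply: measurableT_comp => //; apply: (@L1_measurable _ _ _ P); exact: L1_average_section.
  by move=> w; exact: exp_norm.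
have inner e : Ex P (fun w => expR (f (splice B (Z w) e))) <=
    (1 + c ^+ 2 * expR c) * expR (average B f e).
  set g := average B f e.
  have gc w : `|f (splice B (Z w) e) - g| <= c.
    have -> : f (splice B (Z w) e) - g =
        Ex P (fun w' => f (splice B (Z w) e) - f (splice B (Z w') e)).
      by rewrite ExB ?Ex_cst//; [exact: L1_cst|exact: L1_average_section].
    apply: Ex_norm_le.
      by apply: L1B; [exact: L1_cst|exact: L1_average_section].
    by move=> w'; apply: fc => i iB; rewrite /splice (negbTE iB).
  have lf := L1_average_section e.
  (* [h] is e^g times the quadratic bound at f - g, hence affine in [f]; the mean of [f] over [B] is
     [g], so its linear part cancels. *)
  pose h w := expR g * (1 + c ^+ 2 * expR c - g) + expR g * f (splice B (Z w) e).
  apply: (@le_trans _ _ (Ex P h)).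
    apply: Ex_le => //.
      by apply: L1D; [exact: L1_cst|exact: L1Z].
    move=> w; have := expR_le_quadratic (gc w).
    rewrite -(ler_pM2l (expR_gt0 g)) -expRD addrC subrK => /le_trans; apply.
    by rewrite /h -mulrDr; apply: ler_wpM2l; [exact: ltW (expR_gt0 _)|lra].
  rewrite /h ExD ?Ex_cst ?ExZ//; [|exact: L1_cst|exact: L1Z].
  by rewrite -/(average B f e) -/g; lra.
have mG : measurable_fun setT (fun w' => Ex P (fun w => expR (f (splice B (Z w) (Z w'))))).
  apply: (measurableT_comp (measurable_Ex_section P mB mexpF (K := expR K) _) mC).
  by move=> x; exact: exp_bnd.
apply: Ex_le.
- apply: (@L1_bounded _ _ _ _ (expR K)) => // w'.
  by apply: Ex_norm_le => // w; exact: exp_norm.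
- apply: L1Z; apply: (@L1_bounded _ _ _ _ (expR K)); first exact: measurableT_comp.
  by move=> w; apply: exp_norm; exact: average_bnd.
- by move=> w; exact: inner.
Qed.

End one_block.

Section martingale.
Variables (rho : I -> nat) (K c : R).
Hypothesis c0 : 0 <= c.

Let upto m : {set I} := [set i in A | (rho i < m)%N]%SET.

(** The martingale method: the groups of coordinates with equal [rho] are averaged out one at a
    time, from the last to the first, and each costs one factor. Groups rather than single
    coordinates matter: the matrix has about n^2 / 2 free entries but only n rows, and a whole row
    moves the normalized trace by O(1 / n). *)
Lemma expR_bounded_differences_ge0 m (f : (I -> S) -> R) :
  measurable_fun setT (f : box_space S (upto m) -> R) ->
  (forall e, 0 <= f e <= K) ->
  (forall e e', (forall i, i \in upto m -> e i = e' i) -> f e = f e') ->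
  (forall r e e', (forall i, rho i != r -> e i = e' i) -> `|f e - f e'| <= c) ->
  Ex P (fun w => expR (f (Z w))) <=
  (1 + c ^+ 2 * expR c) ^+ m * expR (Ex P (fun w => f (Z w))).
Proof.
elim: m f => [|m IH] f mf f0 fdep fc.
  have fcst e : f e = f point by apply: fdep => i; rewrite inE ltn0 andbF.
  rewrite expr0 mul1r (_ : (fun w => expR (f (Z w))) = cst (expR (f point))); last first.
    by apply/funext => w; rewrite fcst.
  rewrite (_ : (fun w => f (Z w)) = cst (f point)); last first.
    by apply/funext => w; rewrite fcst.
  by rewrite !Ex_cst.
pose B : {set I} := [set i in A | rho i == m]%SET.
have uptoS : upto m.+1 = B :|: upto m.
  by apply/setP => i; rewrite !inE ltnS leq_eqVlt -andb_orr.
have dB : [disjoint B & upto m]%B.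
  rewrite -setI_eq0; apply/eqP/setP => i; rewrite !inE.
  by case: (i \in A) => //=; case: ltngtP.
have BA : B \subset A by apply/fintype.subsetP => i; rewrite inE => /andP[].
have uA : upto m \subset A by apply/fintype.subsetP => i; rewrite inE => /andP[].
rewrite uptoS in mf fdep.
have lsec := L1_average_section dB BA mf f0.
have fB e e' : (forall i, i \notin B -> e i = e' i) -> `|f e - f e'| <= c.
  move=> ee'; pose e2 i := if i \in A then e' i else e i.
  rewrite (fdep e' e2) => [|i]; last first.
    by rewrite /e2 !inE => /orP[]/andP[->].
  apply: (fc m) => i im; rewrite /e2; case: ifP => // iA; apply: ee'.
  by rewrite inE (negbTE im) andbF.
apply: (le_trans (Ex_expR_average dB BA uA mf f0 fB)).
rewrite (exprS _ m) -[leRHS]mulrA; apply: ler_wpM2l.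
  by rewrite addr_ge0// mulr_ge0// ?sqr_ge0// ltW// expR_gt0.
rewrite (Ex_average dB BA uA mf f0); apply: IH.
- exact: measurable_average.
- exact: average_bnd dB BA mf f0.
- move=> e e' ee'; congr Ex; apply/funext => w; apply: fdep => i.
  by rewrite inE /splice; case: ifP => //= _; exact: ee'.
- move=> r e e' ee'.
  rewrite /average -ExB//; apply: Ex_norm_le; first exact: L1B.
  by move=> w; apply: (fc r) => i ir; rewrite /splice; case: ifP => // _; exact: ee'.
Qed.

End martingale.

Section moments.
Variables (n : nat) (rho : I -> nat) (K c : R) (f : (I -> S) -> R).
Hypotheses (n0 : (0 < n)%N) (c0 : 0 <= c).
Hypothesis rho_n : forall i, i \in A -> (rho i < n)%N.
Hypothesis mf : measurable_fun setT (f : box_space S A -> R).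
Hypothesis fK : forall e, `|f e| <= K.
Hypothesis fdep : forall e e', (forall i, i \in A -> e i = e' i) -> f e = f e'.
Hypothesis fc : forall r e e', (forall i, rho i != r -> e i = e' i) ->
  `|f e - f e'| <= c / n%:R.

Let n0' : 0 < n%:R :> R. Proof. by rewrite ltr0n. Qed.

Lemma L1_process : L1 P (fun w => f (Z w)).
Proof.
apply: (@L1_bounded _ _ _ _ K) => //.
exact: (measurableT_comp mf (measurable_process mY (subxx _))).
Qed.

(** At this scale each of the n groups moves s f by at most c / sqrt n, so the product of the
    factors is at most (1 + c^2 e^c / n)^n, which is bounded uniformly in n. *)
Lemma expR_bounded_differences (s : R) : `|s| = Num.sqrt n%:R ->
  Ex P (fun w => expR (s * (f (Z w) - Ex P (fun w => f (Z w))))) <=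
  expR (c ^+ 2 * expR c).
Proof.
move=> sn; set m := Ex P (fun w => f (Z w)).
(* The shift by [b] puts s f in [0, 2 b], as the nonnegative version requires; its exponential
   appears on both sides and is divided out. *)
pose b := Num.sqrt n%:R * K.
pose g e := s * f e + b.
have sf e : `|s * f e| <= b by rewrite normrM sn ler_wpM2l// sqrtr_ge0.
have AE : A = [set i in A | (rho i < n)%N]%SET.
  apply/setP => i; rewrite inE; case iA : (i \in A) => //=.
  by rewrite rho_n.
pose c' := c / Num.sqrt n%:R.
have sn0 : 0 < Num.sqrt n%:R :> R by rewrite sqrtr_gt0.
have c'0 : 0 <= c' by rewrite divr_ge0// ltW.
have c'c : c' <= c.
  rewrite ler_pdivrMr// ler_peMr// -[leLHS]sqrtr1 ler_sqrt ?ler1n//.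
have H : Ex P (fun w => expR (g (Z w))) <=
    (1 + c' ^+ 2 * expR c') ^+ n * expR (Ex P (fun w => g (Z w))).
  apply: (@expR_bounded_differences_ge0 rho (b + b) c').
  - rewrite -AE; apply: measurable_funD => //; exact: measurable_funM.
  - by move=> e; have := sf e; rewrite ler_norml /g => /andP[? ?]; apply/andP; split; lra.
  - by move=> e e' ee'; rewrite /g (@fdep e e')// => i iA; apply: ee'; rewrite -AE.
  - move=> r e e' ee'; rewrite /g opprD addrACA subrr addr0 -mulrBr normrM sn.
    apply: le_trans (_ : Num.sqrt n%:R * (c / n%:R) <= _).
      by apply: ler_wpM2l; [exact: ltW|exact: (fc ee')].
    have en : n%:R = Num.sqrt n%:R ^+ 2 :> R by rewrite sqr_sqrtr// ler0n.
    rewrite /c' [X in c / X]en; move: sn0; move: (Num.sqrt _) => t t0.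
    by have -> : t * (c / t ^+ 2) = c / t by field; rewrite gt_eqF.
have lf := L1_process.
have Eg : Ex P (fun w => g (Z w)) = s * m + b.
  rewrite /g ExD; [|exact: L1Z|exact: L1_cst].
  by rewrite (ExZ s)// (Ex_cst P b).
have Eexp : Ex P (fun w => expR (g (Z w))) =
    expR (s * m + b) * Ex P (fun w => expR (s * (f (Z w) - m))).
  rewrite -ExZ.
    by congr Ex; apply/funext => w; rewrite -expRD; congr expR; rewrite /g; ring.
  apply: (@L1_bounded _ _ _ _ (expR (Num.sqrt n%:R * (K + K)))).
    apply: measurableT_comp => //; apply: (@L1_measurable _ _ _ P); apply: L1Z.
    by apply: L1B => //; exact: L1_cst.
  move=> w; rewrite ger0_norm ?(ltW (expR_gt0 _))// ler_expR.
  apply: le_trans (ler_norm _) _; rewrite normrM sn ler_wpM2l ?sqrtr_ge0//.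
  apply: le_trans (ler_normB _ _) _; apply: lerD => //.
  exact: Ex_norm_le.
move: H; rewrite Eg Eexp mulrC ler_pM2r ?expR_gt0// => /le_trans; apply.
have -> : expR (c ^+ 2 * expR c) = expR (c ^+ 2 * expR c / n%:R) ^+ n.
  by rewrite -expRM_natl; congr expR; rewrite mulrCA divff ?mulr1// gt_eqF.
apply: lerXn2r; rewrite ?nnegrE.
- by rewrite addr_ge0// mulr_ge0// ?sqr_ge0// ltW// expR_gt0.
- exact: ltW (expR_gt0 _).
apply: le_trans (expR_ge1Dx _); rewrite lerD2l.
rewrite /c' expr_div_n sqr_sqrtr ?ler0n// mulrAC ler_wpM2r ?invr_ge0 ?ler0n//.
by rewrite ler_wpM2l ?sqr_ge0// ler_expR.
Qed.

(* From the exponential moments at s = sqrt n and s = - sqrt n. *)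
Lemma fourth_moment_bounded_differences :
  Ex P (fun w => (f (Z w) - Ex P (fun w => f (Z w))) ^+ 4) <=
  512 * expR (c ^+ 2 * expR c) / n%:R ^+ 2.
Proof.
set m := Ex P (fun w => f (Z w)); have lf := L1_process.
have sn : `|Num.sqrt n%:R : R| = Num.sqrt n%:R by rewrite ger0_norm// sqrtr_ge0.
have Nsn : `|- Num.sqrt n%:R : R| = Num.sqrt n%:R by rewrite normrN.
have := lerD (expR_bounded_differences sn) (expR_bounded_differences Nsn).
rewrite -/m -mulr2n.
have bnd w : `|f (Z w) - m| <= K + K.
  by apply: le_trans (ler_normB _ _) _; apply: lerD => //; exact: Ex_norm_le.
have lfm : L1 P (fun w => f (Z w) - m) by apply: L1B => //; exact: L1_cst.
have lexp (s : R) : L1 P (fun w => expR (s * (f (Z w) - m))).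
  apply: (@L1_bounded _ _ _ _ (expR (`|s| * (K + K)))).
    by apply: measurableT_comp => //; apply: (@L1_measurable _ _ _ P); exact: L1Z.
  move=> w; rewrite ger0_norm ?(ltW (expR_gt0 _))// ler_expR.
  by apply: le_trans (ler_norm _) _; rewrite normrM ler_wpM2l.
rewrite -ExD// => H.
rewrite ler_pdivlMr ?exprn_gt0//.
have l4 : L1 P (fun w => (f (Z w) - m) ^+ 4).
  apply: (@L1_bounded _ _ _ _ ((K + K) ^+ 4)).
    by apply: measurable_funX; exact: (@L1_measurable _ _ _ P).
  by move=> w; rewrite normrX lerXn2r// nnegrE// (le_trans _ (bnd w)).
rewrite mulrC -ExZ//.
apply: le_trans (_ : Ex P (fun w => 256 * (expR (Num.sqrt n%:R * (f (Z w) - m)) +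
    expR (- Num.sqrt n%:R * (f (Z w) - m)))) <= _).
  apply: Ex_le.
  - exact: L1Z.
  - by apply: L1Z; exact: L1D.
  - move=> w; have := pow4_le_expR (Num.sqrt n%:R * (f (Z w) - m)).
    rewrite mulNr exprMn (_ : 4 = 2 * 2)%N// exprM sqr_sqrtr ?ler0n//.
by rewrite ExZ; [lra|exact: L1D].
Qed.

End moments.
End bounded_differences.

(** * Resolvents of Hermitian matrices *)

Local Open Scope sesquilinear_scope.
Local Open Scope complex_scope.

Section resolvent.
Variable R : realType.
Local Notation C := R[i].
Implicit Types (u v : R).

Definition resolvent N (A : 'M[C]_N) (z : C) : 'M[C]_N := invmx (A - z%:M).

Definition spectrum N (A : 'M[C]_N) (i : 'I_N) : R := complex.Re (spectral_diag A 0 i).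

Section one_matrix.
Variables (N : nat) (A : 'M[C]_N) (u v : R).
Hypotheses (hA : A ^t* = A) (v0 : 0 < v).
Let z : C := u +i* v.
Let Q := spectralmx A.
Let w i : C := ((spectrum A i)%:C - z)^-1.

Lemma hermsymm : A \is hermsymmx.
Proof. by apply/is_hermitianmxP; rewrite expr0 scale1r hA. Qed.

Lemma unitaryQ : Q \is unitarymx.
Proof. exact: spectral_unitarymx. Qed.

Lemma mulQtQ : Q^t* *m Q = 1%:M.
Proof. by rewrite -(invmx_unitary unitaryQ) mulVmx// unitarymx_unit// unitaryQ. Qed.

Lemma mulQQt : Q *m Q^t* = 1%:M.
Proof. exact/unitarymxP/unitaryQ. Qed.

Lemma spectrumE i : (spectrum A i)%:C = spectral_diag A 0 i.
Proof.
apply: RRe_real; have /mxOverP := hermitian_spectral_diag_real hermsymm; exact.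
Qed.

Lemma spectral_decomposition :
  A = Q^t* *m diag_mx (\row_i (spectrum A i)%:C) *m Q.
Proof.
have -> : (\row_i (spectrum A i)%:C) = spectral_diag A.
  by apply/rowP => i; rewrite mxE spectrumE.
rewrite -(invmx_unitary unitaryQ).
exact/orthomx_spectralP/hermitian_normalmx/hermsymm.
Qed.

Lemma spectrum_sub_neq0 i : (spectrum A i)%:C - z != 0.
Proof. by rewrite eq_complex /= sub0r oppr_eq0 (gt_eqF v0) andbF. Qed.

Lemma mulmx_sub_spectral :
  (A - z%:M) *m (Q^t* *m diag_mx (\row_i w i) *m Q) = 1%:M.
Proof.
have -> : A - z%:M = Q^t* *m diag_mx (\row_i ((spectrum A i)%:C - z)) *m Q.
  have -> : diag_mx (\row_i ((spectrum A i)%:C - z)) =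
      diag_mx (\row_i (spectrum A i)%:C) - z%:M.
    apply/matrixP => i j; rewrite !mxE; case: eqP => [->|_].
      by rewrite !mulr1n.
    by rewrite !mulr0n subr0.
  rewrite mulmxBr mulmxBl -spectral_decomposition; congr (_ - _).
  by rewrite mul_mx_scalar -scalemxAl mulQtQ scalemx1.
rewrite !mulmxA -(mulmxA _ Q) mulQQt mulmx1.
rewrite -[X in X *m Q]mulmxA mulmx_diag.
set D := diag_mx _; have -> : D = 1%:M.
  by apply/matrixP => i j; rewrite !mxE divff// spectrum_sub_neq0.
by rewrite mulmx1 mulQtQ.
Qed.

Lemma resolvent_unit : A - z%:M \in unitmx.
Proof. by have [] := mulmx1_unit mulmx_sub_spectral. Qed.

Lemma resolvent_spectral :
  resolvent A z = Q^t* *m diag_mx (\row_i w i) *m Q.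
Proof. by rewrite -[LHS]mulmx1 -mulmx_sub_spectral mulKmx// resolvent_unit. Qed.

Lemma normc_ge_Im (x : C) : `|complex.Im x|%:C <= `|x|.
Proof.
by rewrite normc_def lecR -sqrtr_sqr ler_wsqrtr// lerDr sqr_ge0.
Qed.

Lemma norm_w_le i : `|w i| <= v^-1%:C.
Proof.
have h : v%:C <= `|(spectrum A i)%:C - z|.
  apply: le_trans (normc_ge_Im _); rewrite lecR /= sub0r normrN ger0_norm//.
  exact: ltW.
rewrite normfV fmorphV lef_pV2 ?posrE//.
  by rewrite (lt_le_trans _ h)// ltcR.
by rewrite ltcR.
Qed.

Lemma mxtrace_resolvent : \tr (resolvent A z) = \sum_i w i.
Proof.
rewrite resolvent_spectral -mulmxA mxtrace_mulC -mulmxA mulQQt mulmx1.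
by apply: eq_bigr => i _; rewrite !mxE eqxx mulr1n.
Qed.

(** The sum is a diagonal entry of G G^* = Q^* |w|^2 Q, an average of the |w_j|^2 with weights from
    a unit vector. A whole row obeys the bound that holds for a single entry, so most blocks of G
    are small. *)
Lemma row_resolvent_sqr_le i :
  \sum_j `|resolvent A z i j| ^+ 2 <= (v^-1 ^+ 2)%:C.
Proof.
have sqrE m n (M : 'M[C]_(m, n)) k : \sum_j `|M k j| ^+ 2 = (M *m M^t*) k k.
  by rewrite mxE; apply: eq_bigr => j _; rewrite !mxE sqr_normc.
have GG : resolvent A z *m (resolvent A z)^t* =
    (Q^t* *m diag_mx (\row_i w i)) *m (Q^t* *m diag_mx (\row_i w i))^t*.
  rewrite resolvent_spectral; set B := Q^t* *m _.
  by rewrite trmx_mul map_mxM mulmxA -(mulmxA B) mulQQt mulmx1.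
rewrite sqrE GG -sqrE.
apply: (@le_trans _ _ (\sum_j (v^-1 ^+ 2)%:C * `|(Q^t*) i j| ^+ 2)).
  apply: ler_sum => j _; rewrite mul_mx_diag !mxE normrM exprMn mulrC.
  apply: ler_wpM2r; first by rewrite exprn_ge0.
  by rewrite rmorphXn/= ler_pXn2r ?nnegrE ?norm_w_le ?normr_ge0 ?ler0c ?invr_ge0 ?(ltW v0).
by rewrite -mulr_sumr sqrE trmxCK mulQtQ mxE eqxx mulr1.
Qed.

Lemma resolvent_entry_le i j : `|resolvent A z i j| <= v^-1%:C.
Proof.
have v'0 : 0 <= v^-1%:C by rewrite ler0c invr_ge0 ltW.
have : `|resolvent A z i j| ^+ 2 <= (v^-1 ^+ 2)%:C.
  apply: le_trans (row_resolvent_sqr_le i).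
  by rewrite (bigD1 j)//= lerDl sumr_ge0// => k _; exact: exprn_ge0.
by rewrite rmorphXn/= ler_pXn2r.
Qed.

Lemma form_resolvent_le (q : 'rV[C]_N) : q *m q^t* = 1%:M ->
  `|(q *m resolvent A z *m q^t*) 0 0| <= v^-1%:C.
Proof.
move=> q1; set p := q *m Q^t*.
have pp : p *m p^t* = 1%:M.
  by rewrite /p trmx_mul map_mxM trmxCK mulmxA -(mulmxA q) mulQtQ mulmx1.
have -> : q *m resolvent A z *m q^t* = p *m diag_mx (\row_i w i) *m p^t*.
  by rewrite resolvent_spectral /p trmx_mul map_mxM trmxCK !mulmxA.
rewrite mul_mx_diag mxE.
apply: le_trans (ler_norm_sum _ _ _) _.
apply: (@le_trans _ _ (\sum_j v^-1%:C * (p 0 j * (p 0 j)^*))).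
  apply: ler_sum => j _; rewrite !mxE normrM normrM norm_conjC -sqr_normc.
  by rewrite mulrAC -expr2 mulrC ler_wpM2r ?exprn_ge0 ?norm_w_le.
rewrite -mulr_sumr (_ : \sum_j _ = (p *m p^t*) 0 0); last first.
  by rewrite mxE; apply: eq_bigr => j _; rewrite !mxE.
by rewrite pp mxE eqxx mulr1.
Qed.

End one_matrix.
Lemma resolvent_sub N (A B : 'M[C]_N) z : A - z%:M \in unitmx ->
  B - z%:M \in unitmx ->
  resolvent A z - resolvent B z = resolvent A z *m (B - A) *m resolvent B z.
Proof.
move=> uA uB; have -> : B - A = (B - z%:M) - (A - z%:M) by rewrite opprB addrA subrK.
by rewrite mulmxBr mulmxBl /resolvent mulVmx// mul1mx mulmxK.
Qed.

(* A trace is the sum of the diagonal in any orthonormal basis; only the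
   [\rank M] vectors of an orthonormal basis of the row space contribute. *)
Lemma mxtrace_rank_le N (M : 'M[C]_N) (c : C) :
  (forall q : 'rV_N, q *m q^t* = 1%:M -> `|(q *m M *m q^t*) 0 0| <= c) ->
  `|\tr M| <= (\rank M)%:R * c.
Proof.
move=> Mc; pose r := \rank M.
have [V VU MV] : exists2 V : 'M[C]_(r, N), V \is unitarymx & (M <= V)%MS.
  exists (schmidt (row_base M)); first by rewrite schmidt_unitarymx// rank_leq_col.
  by apply: submx_trans (schmidt_sub _); rewrite eq_row_base.
have ME : M = M *m V^t* *m V.
  case/submxP: MV => D ->; rewrite -!mulmxA (mulmxA V).
  by rewrite (unitarymxP VU) mul1mx.
rewrite [X in \tr X]ME mxtrace_mulC mulmxA -/r.
apply: le_trans (ler_norm_sum _ _ _) _.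
rewrite mulr_natl -[r in leRHS]card_ord -sumr_const; apply: ler_sum => i _.
have -> : (V *m M *m V^t*) i i = (row i V *m M *m (row i V)^t*) 0 0.
  by rewrite -!row_mul !mxE; apply: eq_bigr => j _; rewrite !mxE.
apply: Mc; apply/matrixP => a b; rewrite !ord1.
have /unitarymxP/matrixP/(_ i i) := VU; rewrite !mxE !eqxx => <-.
by apply: eq_bigr => j _; rewrite !mxE.
Qed.

(** By the resolvent identity the difference has rank at most that of A - B, and its quadratic form
    on unit vectors is at most 2 / v. The size of A - B does not enter, so entries without any bound
    are allowed. *)
Lemma mxtrace_resolvent_sub N (A B : 'M[C]_N) u v : 0 < v ->
  A ^t* = A -> B ^t* = B ->
  `|\tr (resolvent A (u +i* v)) - \tr (resolvent B (u +i* v))| <=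
  ((\rank (A - B))%:R * (2 / v))%:C.
Proof.
move=> v0 hA hB; set G := resolvent A _; set H := resolvent B _.
rewrite -raddfB /=.
have v'0 : 0 <= (2 / v)%:C by rewrite ler0c divr_ge0// ltW.
apply: le_trans (mxtrace_rank_le (c := (2 / v)%:C) _) _.
  move=> q q1; rewrite mulmxBr mulmxBl mxE [X in _ + X]mxE.
  apply: le_trans (ler_normB _ _) _.
  rewrite (_ : 2 / v = v^-1 + v^-1); last by rewrite mulrC mulr_natr mulr2n.
  by rewrite rmorphD lerD// form_resolvent_le.
rewrite [leRHS]rmorphM rmorph_nat; apply: ler_wpM2r => //; rewrite ler_nat.
rewrite /G /H resolvent_sub ?(resolvent_unit _ _ v0)//.
apply: leq_trans (mxrankM_maxl _ _) _; apply: leq_trans (mxrankM_maxr _ _) _.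
by rewrite -opprB mxrank_opp.
Qed.

End resolvent.

(** * Norms and 2 x 2 blocks *)

(* The norm [`|x|] on R[i] takes its values in R[i]; [nm] is the R-valued one. *)
Notation nm := Normc.normc.

Section normc.
Variable R : realType.
Local Notation C := R[i].
Implicit Types x y : C.

Lemma normE x : `|x| = (nm x)%:C. Proof. by []. Qed.

Lemma nm_ge0 x : 0 <= nm x.
Proof. by have := normr_ge0 x; rewrite normE ler0c. Qed.

Lemma nmM x y : nm (x * y) = nm x * nm y.
Proof. exact: Normc.normcM. Qed.

Lemma nmD x y : nm (x + y) <= nm x + nm y.
Proof. by have := ler_normD x y; rewrite !normE -rmorphD lecR. Qed.

Lemma nmN x : nm (- x) = nm x.
Proof. by have := normrN x; rewrite !normE => -[]. Qed.

Lemma nmB x y : nm (x - y) <= nm x + nm y.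
Proof. by rewrite -(nmN y); exact: nmD. Qed.

Lemma nmBC x y : nm (x - y) = nm (y - x).
Proof. by rewrite -nmN opprB. Qed.

Lemma nm_sum (I : Type) (s : seq I) (Q : pred I) (F : I -> C) :
  nm (\sum_(i <- s | Q i) F i) <= \sum_(i <- s | Q i) nm (F i).
Proof.
elim/big_ind2: _ => [|a b c d|//]; first by rewrite Normc.normc0.
by move=> h1 h2; apply: le_trans (nmD _ _) _; exact: lerD.
Qed.

Lemma nm_real (r : R) : nm r%:C = `|r|.
Proof. by rewrite /= expr0n addr0 sqrtr_sqr. Qed.

Lemma nmV x : nm x^-1 = (nm x)^-1.
Proof. exact: Normc.normcV. Qed.

Lemma nm_nat n : nm (n%:R : C) = n%:R.
Proof. by rewrite -[n%:R in LHS](rmorph_nat (real_complex R)) nm_real ger0_norm ?ler0n. Qed.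

Lemma nm_Re x : `|complex.Re x| <= nm x.
Proof. by have := normc_ge_Re x; rewrite normE lecR. Qed.

Lemma nm_Im x : `|complex.Im x| <= nm x.
Proof. by have := normc_ge_Im x; rewrite normE lecR. Qed.

Lemma nm_sqr x : nm x ^+ 2 = complex.Re x ^+ 2 + complex.Im x ^+ 2.
Proof. by case: x => a b; rewrite /= sqr_sqrtr// addr_ge0 ?sqr_ge0. Qed.

Lemma nm_le_ReIm x : nm x <= `|complex.Re x| + `|complex.Im x|.
Proof.
rewrite -(@ler_pXn2r _ 2)// ?nnegrE ?addr_ge0 ?nm_ge0// nm_sqr sqrrD.
rewrite !real_normK ?num_real// lerD2r lerDl.
by rewrite mulrn_wge0// mulr_ge0.
Qed.

Lemma nm_lec x (r : R) : (`|x| <= r%:C) = (nm x <= r).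
Proof. by rewrite normE lecR. Qed.

End normc.

Section small_matrices.
Variable R : realType.
Local Notation C := R[i].

Definition mxbnd m n (A : 'M[C]_(m, n)) (a : R) := forall i j, nm (A i j) <= a.

Lemma mxbnd_mul m n p (A : 'M[C]_(m, n)) (B : 'M[C]_(n, p)) a b :
  mxbnd A a -> mxbnd B b -> mxbnd (A *m B) (n%:R * (a * b)).
Proof.
move=> hA hB i j; rewrite mxE; apply: le_trans (nm_sum _ _ _) _.
rewrite mulr_natl -[n in leRHS]card_ord -sumr_const.
by apply: ler_sum => k _; rewrite nmM ler_pM ?nm_ge0.
Qed.

Lemma mxbnd_tr n (A : 'M[C]_n) a : mxbnd A a -> nm (\tr A) <= n%:R * a.
Proof.
move=> hA; apply: le_trans (nm_sum _ _ _) _.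
rewrite mulr_natl -[n in leRHS]card_ord -sumr_const.
by apply: ler_sum => k _.
Qed.

Lemma mxbnd_add m n (A B : 'M[C]_(m, n)) a b :
  mxbnd A a -> mxbnd B b -> mxbnd (A + B) (a + b).
Proof.
by move=> hA hB i j; rewrite mxE; apply: le_trans (nmD _ _) _; exact: lerD.
Qed.

Lemma mxbnd_tr4 (A B D E : 'M[C]_2) a b d e :
  mxbnd A a -> mxbnd B b -> mxbnd D d -> mxbnd E e ->
  nm (\tr (A *m B *m D *m E)) <= 16 * (a * b * d * e).
Proof.
move=> hA hB hD hE.
have := mxbnd_tr (mxbnd_mul (mxbnd_mul (mxbnd_mul hA hB) hD) hE).
by move=> /le_trans; apply; lra.
Qed.

Definition fro2 m n (A : 'M[C]_(m, n)) : R := \sum_i \sum_j nm (A i j) ^+ 2.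

Lemma fro2_ge0 m n (A : 'M[C]_(m, n)) : 0 <= fro2 A.
Proof. by apply: sumr_ge0 => i _; apply: sumr_ge0 => j _; exact: sqr_ge0. Qed.

(** Cauchy-Schwarz bounds tr (Y Y) by the squared Frobenius norm of Y = w X. It serves the terms
    with off-diagonal blocks X of the resolvent, whose Frobenius norms are summable over the
    pairs. *)
Lemma mxtrace_sqr_le (w X : 'M[C]_2) a : mxbnd w a ->
  nm (\tr (w *m X *m w *m X)) <= 4 * a ^+ 2 * fro2 X.
Proof.
move=> hw; set Y := w *m X.
have Yab i j : nm (Y i j) ^+ 2 <= 2 * a ^+ 2 * (nm (X 0 j) ^+ 2 + nm (X 1 j) ^+ 2).
  have a0 : 0 <= a := le_trans (nm_ge0 _) (hw 0 0).
  have : nm (Y i j) <= a * (nm (X 0 j) + nm (X 1 j)).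
    rewrite mxE !big_ord_recl big_ord0 addr0; apply: le_trans (nmD _ _) _.
    rewrite !nmM mulrDr (_ : lift ord0 ord0 = 1); last exact/val_inj.
    by apply: lerD; apply: ler_wpM2r; rewrite ?nm_ge0.
  have := nm_ge0 (Y i j); move: (nm (Y i j)) (nm (X 0 j)) (nm (X 1 j)) => y p q.
  move=> y0 yle; apply: (@le_trans _ _ ((a * (p + q)) ^+ 2)).
    by rewrite lerXn2r// nnegrE (le_trans y0).
  by have := sqr_ge0 (a * (p - q)); nra.
have -> : w *m X *m w *m X = Y *m Y by rewrite /Y mulmxA.
have : nm (\tr (Y *m Y)) <= \sum_i \sum_j nm (Y i j) ^+ 2.
  rewrite /mxtrace; under eq_bigr do rewrite mxE.
  apply: le_trans (nm_sum _ _ _) _.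
  apply: (@le_trans _ _ (\sum_(i < 2) \sum_(j < 2) 2^-1 * (nm (Y i j) ^+ 2 + nm (Y j i) ^+ 2))).
    apply: ler_sum => i _; apply: le_trans (nm_sum _ _ _) _; apply: ler_sum => j _.
    by rewrite nmM; have := sqr_ge0 (nm (Y i j) - nm (Y j i)); nra.
  under eq_bigr do under eq_bigr do rewrite mulrDr.
  under eq_bigr do rewrite big_split/=.
  rewrite big_split/= [X in _ + X]exchange_big/= -!big_split/=.
  apply: ler_sum => i _; rewrite -big_split/=; apply: ler_sum => j _; lra.
move=> /le_trans; apply.
apply: (@le_trans _ _ (\sum_(i < 2) \sum_(j < 2) 2 * a ^+ 2 * (nm (X 0 j) ^+ 2 + nm (X 1 j) ^+ 2))).
  by apply: ler_sum => i _; apply: ler_sum.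
rewrite /fro2 !big_ord_recl !big_ord0 (_ : lift ord0 ord0 = 1); last exact/val_inj.
lra.
Qed.

End small_matrices.

Section blocks.
Variable R : realType.
Local Notation C := R[i].
Variable n : nat.
Local Notation N := (\sum_(i < n) 2)%N.
Implicit Types (A B : 'M[C]_N).

Definition blk A (j k : 'I_n) : 'M[C]_2 := submxblock A j k.

Lemma blkP A B : (forall j k, blk A j k = blk B j k) -> A = B.
Proof. by move=> h; apply/mxblockP => j k; exact: h. Qed.

Lemma blkM A B j k : blk (A *m B) j k = \sum_l blk A j l *m blk B l k.
Proof.
by rewrite -{1}(submxblockK A) -{1}(submxblockK B) mul_mxblock /blk mxblockK.
Qed.

Lemma blkB A B j k : blk (A - B) j k = blk A j k - blk B j k.
Proof. exact: submxblockB. Qed.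

Lemma mxtrace_blk A : \tr A = \sum_j \tr (blk A j j).
Proof. by rewrite -{1}(submxblockK A) mxtrace_mxblock. Qed.

Lemma blkT A j k : blk A^T j k = (blk A k j)^T.
Proof. by rewrite /blk tr_submxblock. Qed.

Lemma mxbnd_blk A a j k : mxbnd A a -> mxbnd (blk A j k) a.
Proof. by move=> h a' b; rewrite !mxE. Qed.

Lemma fro2_blk A : fro2 A = \sum_j \sum_k fro2 (blk A j k).
Proof.
have E (B : 'M[C]_N) : (fro2 B)%:C = \tr (B *m B^t*).
  rewrite /fro2 rmorph_sum; apply: eq_bigr => i _; rewrite mxE rmorph_sum.
  by apply: eq_bigr => j _; rewrite !mxE -sqr_normc -rmorphXn.
have E2 (B : 'M[C]_2) : (fro2 B)%:C = \tr (B *m B^t*).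
  rewrite /fro2 rmorph_sum; apply: eq_bigr => i _; rewrite mxE rmorph_sum.
  by apply: eq_bigr => j _; rewrite !mxE -sqr_normc -rmorphXn.
apply: complexI; rewrite E mxtrace_blk rmorph_sum; apply: eq_bigr => j _.
rewrite blkM raddf_sum rmorph_sum; apply: eq_bigr => k _; rewrite [RHS]E2.
congr (\tr (_ *m _)); apply/matrixP => a b; by rewrite !mxE.
Qed.

Section two_blocks.
Variables (D : 'M[C]_N) (j k : 'I_n) (w w' : 'M[C]_2).
Hypothesis jk : j != k.
Hypothesis Djk : blk D j k = w.
Hypothesis Dkj : blk D k j = w'.
Hypothesis D0 : forall a b, (a, b) != (j, k) -> (a, b) != (k, j) -> blk D a b = 0.

Lemma blk_two_mul A a b : blk (D *m A) a b =
  (if a == j then w *m blk A k b else 0) + (if a == k then w' *m blk A j b else 0).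
Proof.
rewrite blkM; have [->|aj] := eqVneq a j.
  rewrite (negbTE jk) addr0 (bigD1 k)//= big1 ?addr0 ?Djk// => l lk.
  by rewrite D0 ?mul0mx// xpair_eqE ?eqxx//= negb_and ?jk.
have [->|ak] := eqVneq a k.
  rewrite add0r (bigD1 j)//= big1 ?addr0 ?Dkj// => l lk.
  by rewrite D0 ?mul0mx// xpair_eqE ?eqxx//= negb_and ?lk ?orbT// eq_sym jk.
by rewrite addr0 big1// => l _; rewrite D0 ?mul0mx// xpair_eqE negb_and ?aj ?ak.
Qed.

Lemma mxtrace_two_mul A : \tr (D *m A) = \tr (w *m blk A k j) + \tr (w' *m blk A j k).
Proof.
rewrite mxtrace_blk; under eq_bigr do rewrite blk_two_mul mxtraceD.
rewrite big_split/=; congr (_ + _).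
  by rewrite (bigD1 j)//= eqxx big1 ?addr0// => l /negbTE->; rewrite mxtrace0.
by rewrite (bigD1 k)//= eqxx big1 ?addr0// => l /negbTE->; rewrite mxtrace0.
Qed.

Lemma blk_mul_two_mul A B a b : blk (A *m (D *m B)) a b =
  blk A a j *m w *m blk B k b + blk A a k *m w' *m blk B j b.
Proof.
rewrite blkM; under eq_bigr do rewrite blk_two_mul mulmxDr.
rewrite big_split/=; congr (_ + _).
  by rewrite (bigD1 j)//= eqxx big1 ?addr0 ?mulmxA// => l /negbTE->; rewrite mulmx0.
by rewrite (bigD1 k)//= eqxx big1 ?addr0 ?mulmxA// => l /negbTE->; rewrite mulmx0.
Qed.

(** Of the four terms, the two in the middle pair diagonal blocks and give the main term; the first
    and the last involve only off-diagonal blocks and are errors. *)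
Lemma mxtrace_two_mul_two_mul A B : \tr (D *m A *m (D *m B)) =
  \tr (w *m blk A k j *m w *m blk B k j) + \tr (w *m blk A k k *m w' *m blk B j j) +
  (\tr (w' *m blk A j j *m w *m blk B k k) + \tr (w' *m blk A j k *m w' *m blk B j k)).
Proof.
by rewrite -mulmxA mxtrace_two_mul !blk_mul_two_mul !mulmxDr !mxtraceD !mulmxA.
Qed.

End two_blocks.

(** Block row [r], and what remains of block column [r], each factor through dimension 2, since one
    quaternionic line is two complex lines. *)
Lemma rank_row_col (D : 'M[C]_N) (r : 'I_n) :
  (forall a b, a != r -> b != r -> blk D a b = 0) -> (\rank D <= 4)%N.
Proof.
move=> D0.
pose E : 'M[C]_(N, 2) := \mxcol_i ((if i == r then 1%:M else 0) : 'M[C]_(2, 2)).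
pose U : 'M[C]_(2, N) := \mxrow_b blk D r b.
pose V : 'M[C]_(N, 2) := \mxcol_a ((if a == r then 0 else blk D a r) : 'M[C]_(2, 2)).
have -> : D = E *m U + V *m E^T.
  rewrite /E /U /V tr_mxcol !mul_mxcol_mxrow -mxblockD -{1}(submxblockK D).
  apply: eq_mxblock => a b; rewrite -/(blk D a b).
  have [->|ar] := eqVneq a r; first by rewrite mul1mx mul0mx addr0.
  rewrite mul0mx add0r; have [->|br] := eqVneq b r; first by rewrite trmx1 mulmx1.
  by rewrite trmx0 mulmx0; exact: D0.
apply: leq_trans (mxrank_add _ _) _; apply: (@leq_add _ _ 2 2).
  by apply: leq_trans (mxrankM_maxr _ _) _; exact: rank_leq_row.
by apply: leq_trans (mxrankM_maxl _ _) _; exact: rank_leq_col.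
Qed.

End blocks.

(** * Quaternionic blocks *)

Lemma mx2P (T : Type) (A B : 'M[T]_2) : A 0 0 = B 0 0 -> A 0 1 = B 0 1 ->
  A 1 0 = B 1 0 -> A 1 1 = B 1 1 -> A = B.
Proof.
move=> h00 h01 h10 h11; apply/matrixP => i j.
have c2 (l : 'I_2) : l = 0 \/ l = 1.
  by case: l => [[|[|//]] p]; [left|right]; exact/val_inj.
by case: (c2 i) => ->; case: (c2 j) => ->.
Qed.

Lemma big_ord2 (V : nmodType) (F : 'I_2 -> V) : \sum_i F i = F 0 + F 1.
Proof. by rewrite !big_ord_recl big_ord0 addr0; congr (_ + F _); exact/val_inj. Qed.

Section quaternion_blocks.
Variable R : realType.
Local Notation C := R[i].
Implicit Types (x : quat R) (t : R).

Definition qblock x : 'M[C]_2 := \matrix_(i, j)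
  if i == 0 then if j == 0 then q0 x +i* q1 x else q2 x +i* q3 x
  else if j == 0 then - (q2 x -i* q3 x) else q0 x -i* q1 x.

Lemma complex_blockE x : complex_block x = qblock x.
Proof.
have e0 : (0 : 'I_2) = lshift 1 (ord0 : 'I_1) by exact/val_inj.
have e1 : (1 : 'I_2) = rshift 1 (ord0 : 'I_1) by exact/val_inj.
apply: mx2P; rewrite [RHS]mxE /= ?e0 ?e1 /complex_block.
- by rewrite [LHS]block_mxEul mxE eqxx.
- by rewrite [LHS]block_mxEur mxE eqxx.
- by rewrite [LHS]block_mxEdl mxE eqxx.
- by rewrite [LHS]block_mxEdr mxE eqxx.
Qed.

Local Notation cb := qblock.

Lemma qnorm_sqr x : qnorm x ^+ 2 = q0 x ^+ 2 + q1 x ^+ 2 + q2 x ^+ 2 + q3 x ^+ 2.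
Proof. by rewrite sqr_sqrtr// !addr_ge0 ?sqr_ge0. Qed.

Lemma qnorm_ge0 x : 0 <= qnorm x.
Proof. exact: sqrtr_ge0. Qed.

Lemma qconjK x : qconj (qconj x) = x.
Proof. by case: x => [[[a b] c] d]; rewrite /qconj /= /q0 /q1 /q2 /q3 /= !opprK. Qed.

Lemma cb_conj x : cb (qconj x) = (cb x)^t*.
Proof.
by apply: mx2P; rewrite !mxE /=; apply/eqP; rewrite eq_complex /= ?opprK !eqxx.
Qed.

Lemma cb_mul_conj x : cb x *m cb (qconj x) = ((qnorm x ^+ 2)%:C)%:M.
Proof.
rewrite qnorm_sqr; apply: mx2P; rewrite !mxE big_ord2 !mxE /= ?mulr1n ?mulr0n;
  apply/eqP; rewrite eq_complex /=; apply/andP; split; apply/eqP;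
  rewrite /q0 /q1 /q2 /q3 /=; ring.
Qed.

Lemma cb_scale t x : cb (qscale t x) = t%:C *: cb x.
Proof.
apply: mx2P; rewrite !mxE /=; apply/eqP; rewrite eq_complex /=;
  by apply/andP; split; apply/eqP; rewrite /q0 /q1 /q2 /q3 /=; ring.
Qed.

Lemma mxbnd_cb x : mxbnd (cb x) (qnorm x).
Proof.
have sq (y : C) : nm y ^+ 2 <= qnorm x ^+ 2 -> nm y <= qnorm x.
  by move=> h; rewrite -(@ler_pXn2r _ 2)// ?nnegrE ?nm_ge0 ?qnorm_ge0.
have := (sqr_ge0 (q0 x), sqr_ge0 (q1 x), sqr_ge0 (q2 x), sqr_ge0 (q3 x)).
case=> [[[s0 s1] s2] s3] i j; apply: sq; rewrite nm_sqr qnorm_sqr.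
have c2 (l : 'I_2) : l = 0 \/ l = 1.
  by case: l => [[|[|//]] p]; [left|right]; exact/val_inj.
by case: (c2 i) => ->; case: (c2 j) => ->; rewrite mxE /= ?sqrrN; lra.
Qed.

Lemma qnorm_conj x : qnorm (qconj x) = qnorm x.
Proof. by rewrite /qnorm /= !sqrrN. Qed.

Lemma qnorm_scale t x : qnorm (qscale t x) = `|t| * qnorm x.
Proof.
rewrite -sqrtr_sqr -sqrtrM ?sqr_ge0//; congr Num.sqrt.
by rewrite /q0 /q1 /q2 /q3 /=; ring.
Qed.

Definition qcoord (i : 'I_4) x : R := [tuple q0 x; q1 x; q2 x; q3 x]`_i.

Definition qunit (i : 'I_4) : quat R :=
  ((i == 0 :> nat)%:R, (i == 1 :> nat)%:R, (i == 2 :> nat)%:R, (i == 3 :> nat)%:R).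

Lemma cb_coord x : cb x = \sum_(i < 4) (qcoord i x)%:C *: cb (qunit i).
Proof.
apply: mx2P; rewrite summxE !big_ord_recl big_ord0 !mxE /= /qcoord /qunit /=;
  apply/eqP; rewrite eq_complex /=;
  by apply/andP; split; apply/eqP; rewrite /q0 /q1 /q2 /q3 /=; ring.
Qed.

Lemma qunit_norm i : qnorm (qunit i) <= 1.
Proof.
rewrite -(@ler_pXn2r _ 2)// ?nnegrE ?qnorm_ge0// qnorm_sqr expr1n.
rewrite /qunit /q0 /q1 /q2 /q3 /=.
by case: i => [[|[|[|[|//]]]] p] /=; lra.
Qed.

Lemma cb_coord_conj x : cb (qconj x) = \sum_(i < 4) (qcoord i x)%:C *: cb (qconj (qunit i)).
Proof.
apply: mx2P; rewrite summxE !big_ord_recl big_ord0 !mxE /= /qcoord /qunit /=;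
  apply/eqP; rewrite eq_complex /=;
  by apply/andP; split; apply/eqP; rewrite /qconj /q0 /q1 /q2 /q3 /=; ring.
Qed.

Lemma qcoord_le x i : `|qcoord i x| <= qnorm x.
Proof.
rewrite -(@ler_pXn2r _ 2)// ?nnegrE ?qnorm_ge0// real_normK ?num_real// qnorm_sqr.
have := (sqr_ge0 (q0 x), sqr_ge0 (q1 x), sqr_ge0 (q2 x), sqr_ge0 (q3 x)).
case=> [[[s0 s1] s2] s3].
by rewrite /qcoord; case: i => [[|[|[|[|//]]]] p] /=; lra.
Qed.

(** The block of i_2, that is, the matrix J with rows (0, 1) and (-1, 0). *)
Definition symp : 'M[C]_2 := cb (0, 0, 1, 0).

Lemma symp_cb x : (cb x)^T *m symp = symp *m cb (qconj x).
Proof.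
apply: mx2P; rewrite /symp !mxE !big_ord2 !mxE /=;
  apply/eqP; rewrite eq_complex /=;
  by apply/andP; split; apply/eqP; rewrite /q0 /q1 /q2 /q3 /=; ring.
Qed.

(** For 2 x 2 matrices J^-1 A^T J is the adjugate of A. Equality with the adjugate forces equal
    diagonal entries, and off-diagonal entries equal to their opposites. *)
Lemma symp_scalar (A : 'M[C]_2) : A^T *m symp = symp *m A -> A = (A 0 0)%:M.
Proof.
move=> /matrixP h.
have := (h 0 0, h 0 1, h 1 0, h 1 1).
rewrite /symp !mxE !big_ord2 !mxE /= /q0 /q1 /q2 /q3 /= oppr0.
have -> : 0 +i* 0 = 0 :> C by [].
have -> : 1 +i* 0 = 1 :> C by [].
rewrite !(mulr0, mul0r, add0r, addr0, mulr1, mul1r, mulrN1, mulN1r).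
case=> [[[h00 h01] h10] h11].
have two (a : C) : - a = a -> a = 0.
  move=> e; have : a *+ 2 == 0 by rewrite mulr2n -{1}e addNr.
  by rewrite mulrn_eq0 => /eqP.
apply: mx2P; rewrite !mxE /= ?mulr1n ?mulr0n//.
- by apply: two; rewrite -h11.
- by apply: two.
Qed.

End quaternion_blocks.

Section hermitian_model.
Variable R : realType.
Local Notation C := R[i].
Variable n : nat.
Local Notation N := (\sum_(i < n) 2)%N.
Local Notation cb := qblock.
Implicit Types (e : 'I_n * 'I_n -> quat R) (t : R).

(* Only the entries (j, k) of [e] with j <= k are used, and only the real part
   of a diagonal one. *)
Definition qherm e : 'M[quat R]_n := \matrix_(j, k)
  if (j < k)%N then e (j, k) else
  if (k < j)%N then qconj (e (k, j)) else (q0 (e (j, j)), 0, 0, 0).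

Definition wig t e : 'M[C]_N := complex_rep (map_mx (qscale t) (qherm e)).

Lemma qherm_lt e (j k : 'I_n) : (j < k)%N -> qherm e j k = e (j, k).
Proof. by move=> jk; rewrite mxE jk. Qed.

Lemma qherm_conj e j k : qherm e k j = qconj (qherm e j k).
Proof.
rewrite !mxE; case: ltngtP => //= [_|/val_inj ->]; first by rewrite qconjK.
by rewrite /qconj /q0 /q1 /q2 /q3 /= oppr0.
Qed.

Lemma blk_wig t e j k : blk (wig t e) j k = t%:C *: cb (qherm e j k).
Proof. by rewrite /blk /wig /complex_rep mxblockK complex_blockE mxE cb_scale. Qed.

Lemma wig_herm t e : (wig t e)^t* = wig t e.
Proof.
apply: blkP => j k.
have -> : blk ((wig t e)^t* ) j k = (blk (wig t e) k j)^t*.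
  by apply/matrixP => a b; rewrite !mxE.
rewrite !blk_wig (qherm_conj e j k).
have -> : (t%:C *: cb (qconj (qherm e j k)))^t* = t%:C *: (cb (qconj (qherm e j k)))^t*.
  by apply/matrixP => a b; rewrite !mxE rmorphM; congr (_ * _); exact: conjc_real.
by rewrite -cb_conj qconjK.
Qed.

(* Quaternionic blocks satisfy x^T J = J x^bar for the symplectic unit J; hence
   the resolvent satisfies G^T J = J G, and a 2 x 2 block equal to its own
   quaternionic conjugate is scalar. *)
Lemma blk_resolvent_scalar t e u v j : 0 < v ->
  blk (resolvent (wig t e) (u +i* v)) j j =
  (blk (resolvent (wig t e) (u +i* v)) j j 0 0)%:M.
Proof.
move=> v0; set z := u +i* v; set W := wig t e; set G := resolvent W z.
pose J : 'M[C]_N := \mxdiag_(i < n) symp R.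
have mulJ (A : 'M[C]_N) a b : blk (A *m J) a b = blk A a b *m symp R.
  by rewrite -{1}(submxblockK A) mul_mxblock_mxdiag /blk mxblockK.
have Jmul (A : 'M[C]_N) a b : blk (J *m A) a b = symp R *m blk A a b.
  by rewrite -{1}(submxblockK A) mul_mxdiag_mxblock /blk mxblockK.
have WJ : W^T *m J = J *m W.
  apply: blkP => a b; rewrite mulJ Jmul blkT !blk_wig linearZ/= -scalemxAl -scalemxAr.
  by congr (_ *: _); rewrite symp_cb -qherm_conj.
have AJ : (W - z%:M)^T *m J = J *m (W - z%:M).
  by rewrite linearB/= tr_scalar_mx mulmxBl mulmxBr WJ mul_scalar_mx mul_mx_scalar.
have uA : W - z%:M \in unitmx by apply: resolvent_unit => //; exact: wig_herm.
have GJ : G^T *m J = J *m G.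
  (* Insert (W - z) G = 1 on the right, move W - z across J, where it becomes its transpose, and
     cancel it against G^T. *)
  rewrite -[LHS]mulmx1 -(mulmxV uA) -/G !mulmxA -(mulmxA _ J) -AJ.
  rewrite mulmxA -trmx_mul mulmxV// trmx1 mul1mx.
  by [].
by apply: symp_scalar; rewrite -blkT -mulJ -Jmul GJ.
Qed.

End hermitian_model.

(** * The resolvent of a self-dual matrix *)

(** This is where scalar diagonal blocks pay off: with x and y an entry and its conjugate, the trace
    depends on the entry only through s, its squared norm. *)
Lemma mxtrace_scalar_mul4 (F : comNzRingType) (x y : 'M[F]_2) (s g h : F) :
  x *m y = s%:M -> \tr (x *m g%:M *m y *m h%:M) = 2 * s * (g * h).
Proof.
move=> xy; rewrite mul_mx_scalar mxtraceZ mul_mx_scalar -scalemxAl mxtraceZ xy.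
by rewrite mxtrace_scalar -mulr_natl; ring.
Qed.

(** Each of the two bounds on r is used once. With [a] constant and [b] proportional to the size of
    the erased entry, the error is linear in that size. *)
Lemma sqr_perturb (F : realFieldType) (p q r a b : F) :
  0 <= q -> q <= p + r -> 0 <= r -> r <= a -> r <= b ->
  q ^+ 2 <= 2 * p ^+ 2 + 2 * (a * b).
Proof.
move=> q0 qpr r0 ra rb.
have : r * r <= a * b by exact: ler_pM.
have : q ^+ 2 <= (p + r) ^+ 2 by rewrite lerXn2r// nnegrE// (le_trans q0).
have := sqr_ge0 (p - r); nra.
Qed.

Lemma nm_le_sub (R : realType) (x y : R[i]) : nm y <= nm x + nm (x - y).
Proof. by rewrite -[in leLHS](subKr x y); exact: nmB. Qed.

Lemma sum_sum_split (V : nmodType) n (F : 'I_n -> 'I_n -> V) :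
  \sum_j \sum_k F j k =
  \sum_j F j j + \sum_(j < n) \sum_(k < n | (j < k)%N) (F j k + F k j).
Proof.
have -> : \sum_(j < n) \sum_(k < n | (j < k)%N) (F j k + F k j) =
    \sum_(j < n) \sum_(k < n | (j < k)%N) F j k + \sum_(j < n) \sum_(k < n | (k < j)%N) F j k.
  rewrite [X in _ + X](exchange_big_dep predT)//= -big_split/=.
  by apply: eq_bigr => j _; rewrite -big_split.
rewrite -!big_split/=; apply: eq_bigr => j _.
rewrite (bigD1 j)//=; congr (_ + _); rewrite (bigID (fun k : 'I_n => (j < k)%N))/=.
by congr (_ + _); apply: eq_bigl => k; rewrite -val_eqE /=; case: ltngtP.
Qed.

(** * Second-order expansion around the matrix with one pair of conjugate entries erased *)

Section pair_expansion.
Variable R : realType.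
Local Notation C := R[i].
Variable n : nat.
Local Notation N := (\sum_(i < n) 2)%N.
Implicit Types (e : 'I_n * 'I_n -> quat R).
Variables (t u v : R).
Hypothesis v0 : 0 < v.

Definition green e : 'M[C]_N := resolvent (wig t e) (u +i* v).

(* The diagonal blocks of the resolvent are scalar, see [blk_resolvent_scalar]. *)
Definition gam e j : C := blk (green e) j j 0 0.

(** Since [qherm] reads the entry (k, j) off (j, k), erasing one coordinate of [e] removes both
    entries of the matrix, and what is left is a function of the other independent entries. *)
Definition erase (p : 'I_n * 'I_n) e : 'I_n * 'I_n -> quat R :=
  fun q => if q == p then (0, 0, 0, 0) else e q.

Definition pair_trace e j k : C :=
  \tr (blk (wig t e) j k *m blk (green e) k j) +
  \tr (blk (wig t e) k j *m blk (green e) j k).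

(* The coefficient of the [i]-th real coordinate of the entry (j, k) in the first
   order expansion of [pair_trace] around [erase (j, k) e]. *)
Definition psi e j k (i : 'I_4) : C :=
  \tr (qblock (qunit R i) *m blk (green e) k j) +
  \tr (qblock (qconj (qunit R i)) *m blk (green e) j k).

Definition weight e j k : R := `|t| * qnorm (e (j, k)).

Definition fro_pair e j k : R := fro2 (blk (green e) k j) + fro2 (blk (green e) j k).

Lemma green_unit e : wig t e - (u +i* v)%:M \in unitmx.
Proof. by apply: resolvent_unit => //; exact: wig_herm. Qed.

Lemma mxbnd_green e : mxbnd (green e) v^-1.
Proof. by move=> i j; rewrite -nm_lec resolvent_entry_le// wig_herm. Qed.

Lemma mxbnd_blk_green e j k : mxbnd (blk (green e) j k) v^-1.
Proof. by apply: mxbnd_blk; exact: mxbnd_green. Qed.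

Lemma gam_le e j : nm (gam e j) <= v^-1.
Proof. exact: mxbnd_blk_green. Qed.

Lemma blk_green_diag e j : blk (green e) j j = (gam e j)%:M.
Proof. exact: blk_resolvent_scalar. Qed.

Lemma fro_pair_ge0 e j k : 0 <= fro_pair e j k.
Proof. by rewrite addr_ge0 ?fro2_ge0. Qed.

Lemma psi_le e j k i : nm (psi e j k i) <= 8 / v.
Proof.
have h x (X : 'M[C]_2) : qnorm x <= 1 -> mxbnd X v^-1 -> nm (\tr (qblock x *m X)) <= 4 / v.
  move=> x1 hX; have := mxbnd_tr (mxbnd_mul (mxbnd_cb x) hX) => /le_trans; apply.
  have vV : 0 < v^-1 by rewrite invr_gt0.
  nra.
have -> : 8 / v = 4 / v + 4 / v by lra.
apply: le_trans (nmD _ _) _; apply: lerD; apply: h; rewrite ?qnorm_conj ?qunit_norm//;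
  exact: mxbnd_blk_green.
Qed.

Lemma fro2_green e : fro2 (green e) <= N%:R / v ^+ 2.
Proof.
rewrite /fro2 mulr_natl -[N in leRHS]card_ord -sumr_const; apply: ler_sum => i _.
have := row_resolvent_sqr_le u (wig_herm t e) v0 i.
move=> h; rewrite -exprVn -lecR rmorph_sum; apply: le_trans h.
by apply: ler_sum => j _; rewrite rmorphXn.
Qed.

Lemma sum_fro_pair e : \sum_j \sum_k fro2 (blk (green e) j k) <= N%:R / v ^+ 2.
Proof. by rewrite -fro2_blk; exact: fro2_green. Qed.

Section pair.
Variables (e : 'I_n * 'I_n -> quat R) (j k : 'I_n).
Hypothesis jk : (j < k)%N.

Let e' := erase (j, k) e.
Let D := wig t e - wig t e'.
Let w := qblock (qscale t (e (j, k))).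
Let w' := qblock (qconj (qscale t (e (j, k)))).
Let rho := weight e j k.

Let njk : j != k. Proof. by apply: contraTneq jk => ->; rewrite ltnn. Qed.

Lemma qherm_erase a b : (a, b) != (j, k) -> (a, b) != (k, j) ->
  qherm e' a b = qherm e a b.
Proof.
move=> ab1 ab2; rewrite !mxE /e' /erase; case: ltngtP => ab.
- by rewrite (negbTE ab1).
- rewrite ifN// xpair_eqE; apply: contra ab2 => /andP[/eqP -> /eqP ->].
  by rewrite eqxx.
- by rewrite ifN// xpair_eqE; apply/negP => /andP[/eqP -> /eqP]; exact/eqP.
Qed.

Lemma blkD0 a b : (a, b) != (j, k) -> (a, b) != (k, j) -> blk D a b = 0.
Proof. by move=> h1 h2; rewrite blkB !blk_wig qherm_erase// subrr. Qed.

Lemma qblock0 : qblock ((0, 0, 0, 0) : quat R) = 0.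
Proof. by apply: mx2P; rewrite !mxE /= ?oppr0. Qed.

Lemma blkDjk : blk D j k = w.
Proof.
rewrite blkB !blk_wig -scalerBr !qherm_lt// /e' /erase eqxx qblock0 subr0.
by rewrite -cb_scale.
Qed.

Lemma blkDkj : blk D k j = w'.
Proof.
rewrite blkB !blk_wig -scalerBr !(qherm_conj _ j k) !qherm_lt// /e' /erase eqxx.
rewrite [X in _ - X](_ : _ = 0) ?subr0; last first.
  by rewrite /qconj /q0 /q1 /q2 /q3 /= !oppr0 qblock0.
rewrite -cb_scale; congr qblock; rewrite /qscale /qconj /q0 /q1 /q2 /q3 /=.
by rewrite !mulrN.
Qed.

Lemma blk_wig_jk : blk (wig t e) j k = w.
Proof. by rewrite blk_wig qherm_lt// -cb_scale. Qed.

Lemma blk_wig_kj : blk (wig t e) k j = w'.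
Proof.
rewrite blk_wig (qherm_conj _ j k) qherm_lt// -cb_scale; congr qblock.
by rewrite /qscale /qconj /q0 /q1 /q2 /q3 /= !mulrN.
Qed.

Let qw : qnorm (qscale t (e (j, k))) = rho. Proof. exact: qnorm_scale. Qed.

Let mw : mxbnd w rho. Proof. by rewrite -qw; exact: mxbnd_cb. Qed.

Let mw' : mxbnd w' rho. Proof. by rewrite -qw -qnorm_conj; exact: mxbnd_cb. Qed.

Let two_tr := mxtrace_two_mul njk blkDjk blkDkj blkD0.

Lemma pair_traceE : pair_trace e j k = \tr (D *m green e).
Proof. by rewrite two_tr /pair_trace blk_wig_jk blk_wig_kj. Qed.

Lemma green_sub : green e - green e' = - (green e *m D *m green e').
Proof.
by rewrite /green resolvent_sub ?green_unit// /D -mulNmx -mulmxN opprB.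
Qed.

(** The identity G = G' - G D G' is used once, and the remaining G is then split as G' + (G - G').
    The first two terms contain only G', which is independent of the erased entry. *)
Lemma green_expand : \tr (D *m green e) = \tr (D *m green e') -
  \tr (D *m green e' *m (D *m green e')) -
  \tr (D *m (green e - green e') *m (D *m green e')).
Proof.
have h : green e = green e' - green e *m D *m green e'.
  by rewrite -green_sub addrC subrK.
rewrite [in LHS]h mulmxBr linearB/= -addrA -opprD; congr (_ - _).
by rewrite -mxtraceD -mulmxDl -mulmxDr [green e' + _]addrC subrK !mulmxA.
Qed.

(** The first bound comes from the size of the two resolvents, the second from the resolvent
    identity: two block products, each of size at most 4 rho / v^2. The first stays bounded for a
    huge entry, the second is small for a small one. *)
Lemma blk_green_sub_le a b :
  mxbnd (blk (green e - green e') a b) (Num.min (2 / v) (8 * rho / v ^+ 2)).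
Proof.
move=> c d; rewrite le_min; apply/andP; split.
  have -> : 2 / v = v^-1 + v^-1 by lra.
  rewrite blkB mxE; apply: le_trans (nmD _ _) _; apply: lerD; last rewrite mxE nmN.
    exact: mxbnd_blk_green.
  exact: mxbnd_blk_green.
rewrite green_sub -mulmxA /blk submxblockN mxE nmN -/(blk _ a b).
rewrite (blk_mul_two_mul njk blkDjk blkDkj blkD0).
have h (x : 'M[C]_2) p q : mxbnd x rho ->
    mxbnd (blk (green e) a p *m x *m blk (green e') q b) (4 * rho / v ^+ 2).
  move=> hx; have h1 := mxbnd_mul (@mxbnd_blk_green e a p) hx.
  have h2 := mxbnd_mul h1 (@mxbnd_blk_green e' q b).
  by move=> i l; apply: le_trans (h2 i l) _; rewrite -exprVn; lra.
have -> : 8 * rho / v ^+ 2 = 4 * rho / v ^+ 2 + 4 * rho / v ^+ 2 by lra.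
exact: (mxbnd_add (h _ _ _ mw) (h _ _ _ mw')).
Qed.

(** Linear in the four coordinates of the entry, with coefficients that depend on the erased matrix
    only. Centring of each coordinate therefore kills this term in expectation, whatever their joint
    law. *)
Lemma pair_linear : \tr (D *m green e') =
  \sum_i (t * qcoord i (e (j, k)))%:C * psi e' j k i.
Proof.
rewrite two_tr /w /w'.
have -> : qconj (qscale t (e (j, k))) = qscale t (qconj (e (j, k))).
  by rewrite /qscale /qconj /q0 /q1 /q2 /q3 /= !mulrN.
rewrite !cb_scale cb_coord cb_coord_conj -!scalemxAl !linearZ/= !mulmx_suml !linear_sum/=.
rewrite -mulrDr -big_split/= mulr_sumr; apply: eq_bigr => i _.
by rewrite -!scalemxAl !linearZ/= -mulrDr mulrA -rmorphM.
Qed.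

(** The two terms with diagonal blocks contribute 2 rho^2 g_j g_k each; the other two are bounded by
    [mxtrace_sqr_le]. *)
Lemma pair_quadratic : nm (\tr (D *m green e' *m (D *m green e')) -
    (4 * rho ^+ 2)%:C * (gam e' j * gam e' k)) <= 4 * rho ^+ 2 * fro_pair e' j k.
Proof.
rewrite (mxtrace_two_mul_two_mul njk blkDjk blkDkj blkD0) !blk_green_diag.
have ww : w *m w' = (rho ^+ 2)%:C%:M by rewrite /w /w' cb_mul_conj qw.
have w'w : w' *m w = (rho ^+ 2)%:C%:M.
  by have := cb_mul_conj (qconj (qscale t (e (j, k)))); rewrite qconjK qnorm_conj qw.
rewrite (mxtrace_scalar_mul4 _ _ ww) (mxtrace_scalar_mul4 _ _ w'w).
have -> : (4 * rho ^+ 2)%:C = 4 * (rho ^+ 2)%:C by rewrite rmorphM rmorph_nat.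
have collect (a d s g h : C) :
    a + 2 * s * (h * g) + (2 * s * (g * h) + d) - 4 * s * (g * h) = a + d by ring.
rewrite collect.
rewrite mulrDr; apply: le_trans (nmD _ _) _; apply: lerD; exact: mxtrace_sqr_le.
Qed.

Lemma pair_remainder : nm (\tr (D *m (green e - green e') *m (D *m green e'))) <=
  64 / v * (rho ^+ 2 * Num.min (2 / v) (8 * rho / v ^+ 2)).
Proof.
rewrite (mxtrace_two_mul_two_mul njk blkDjk blkDkj blkD0).
set m := Num.min _ _.
have h (x y : 'M[C]_2) a b c d : mxbnd x rho -> mxbnd y rho ->
    nm (\tr (x *m blk (green e - green e') a b *m y *m blk (green e') c d)) <=
    16 * (rho * m * rho * v^-1).
  move=> hx hy; exact: (mxbnd_tr4 hx (@blk_green_sub_le a b) hy (@mxbnd_blk_green e' c d)).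
have -> : 64 / v * (rho ^+ 2 * m) = 16 * (rho * m * rho * v^-1) + 16 * (rho * m * rho * v^-1) +
  (16 * (rho * m * rho * v^-1) + 16 * (rho * m * rho * v^-1)) by rewrite expr2; ring.
apply: le_trans (nmD _ _) _; apply: lerD; apply: le_trans (nmD _ _) _;
  by apply: lerD; apply: h.
Qed.

(* Taking the minimum with the trivial bound 2 / v in the remainder leaves an
   expectation that Lindeberg's condition controls. *)
Lemma pair_expansion : nm (pair_trace e j k -
    \sum_i (t * qcoord i (e (j, k)))%:C * psi e' j k i +
    (4 * rho ^+ 2)%:C * (gam e' j * gam e' k)) <=
  4 * rho ^+ 2 * fro_pair e' j k +
  64 / v * (rho ^+ 2 * Num.min (2 / v) (8 * rho / v ^+ 2)).
Proof.
rewrite pair_traceE green_expand pair_linear.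
set L := \sum_i _; set Q := \tr (D *m green e' *m _); set E := \tr _; set c := _ * (gam _ _ * _).
have -> : L - Q - E - L + c = - (Q - c) - E by ring.
apply: le_trans (nmB _ _) _; rewrite nmN; apply: lerD; [exact: pair_quadratic|exact: pair_remainder].
Qed.

(** The erased matrix changes with the pair. Returning to the full one lets the products over all
    pairs be collected into the square of a single sum. *)
Lemma gam_mul_erase : nm (gam e' j * gam e' k - gam e j * gam e k) <= 16 * rho / v ^+ 3.
Proof.
have d a : nm (gam e' a - gam e a) <= 8 * rho / v ^+ 2.
  rewrite nmBC; have := @blk_green_sub_le a a 0 0; rewrite blkB mxE [X in _ + X]mxE.
  by rewrite le_min => /andP[].
have sub_mul (a b c f : C) : a * b - c * f = (a - c) * b + c * (b - f) by ring.
rewrite sub_mul.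
have -> : 16 * rho / v ^+ 3 = (8 * rho / v ^+ 2) * v^-1 + v^-1 * (8 * rho / v ^+ 2).
  by rewrite -!exprVn; ring.
apply: le_trans (nmD _ _) _; rewrite !nmM; apply: lerD; apply: ler_pM; rewrite ?nm_ge0//;
  exact: gam_le.
Qed.

(** Summability over the pairs is known for the blocks of one fixed resolvent, so the bound is moved
    from the erased matrix back to the full one. *)
Lemma fro_pair_erase : fro_pair e' j k <= 2 * fro_pair e j k + 256 * rho / v ^+ 3.
Proof.
have h a b : fro2 (blk (green e') a b) <= 2 * fro2 (blk (green e) a b) + 128 * rho / v ^+ 3.
  rewrite /fro2 mulr_sumr.
  have -> : 128 * rho / v ^+ 3 = \sum_(i < 2) \sum_(l < 2) 32 * rho / v ^+ 3.
    by rewrite !big_ord2; lra.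
  rewrite -big_split/=; apply: ler_sum => c _; rewrite mulr_sumr -big_split/=.
  apply: ler_sum => l _.
  have := @blk_green_sub_le a b c l; rewrite le_min blkB mxE [X in nm (_ + X)]mxE.
  move=> /andP[h1 h2].
  have := sqr_perturb (nm_ge0 _) (nm_le_sub _ _) (nm_ge0 _) h1 h2.
  have -> : 2 * (2 / v * (8 * rho / v ^+ 2)) = 32 * rho / v ^+ 3 by rewrite -!exprVn; ring.
  exact.
rewrite /fro_pair mulrDr; apply: le_trans (lerD (h k j) (h j k)) _.
rewrite addrACA lerD2l; have double (r s : R) : 128 * r / s + 128 * r / s = 256 * r / s by ring.
by rewrite double.
Qed.

End pair.

Definition diag_trace e j : C := \tr (blk (wig t e) j j *m blk (green e) j j).

Lemma diag_trace_le e j : nm (diag_trace e j) <= 4 / v * weight e j j.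
Proof.
have mw : mxbnd (blk (wig t e) j j) (weight e j j).
  move=> a b; rewrite blk_wig -cb_scale; apply: le_trans (mxbnd_cb _ _ _) _.
  rewrite qnorm_scale mxE !ltnn /weight ler_wpM2l// ler_sqrt.
    by rewrite /q0 /q1 /q2 /q3 /= expr0n !addr0 -!addrA lerDl !addr_ge0 ?sqr_ge0.
  by rewrite !addr_ge0 ?sqr_ge0.
have := mxbnd_tr (mxbnd_mul mw (@mxbnd_blk_green e j j)).
by move=> /le_trans; apply; lra.
Qed.

Lemma mxtrace_wig_green e : \tr (wig t e *m green e) =
  \sum_j diag_trace e j + \sum_(j < n) \sum_(k < n | (j < k)%N) pair_trace e j k.
Proof.
rewrite mxtrace_blk -sum_sum_split; apply: eq_bigr => j _.
by rewrite blkM raddf_sum.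
Qed.

Definition stieltjes e : C := n%:R^-1 * \sum_j gam e j.

Lemma mxtrace_green e : \tr (green e) = 2 * \sum_j gam e j.
Proof.
rewrite mxtrace_blk mulr_sumr; apply: eq_bigr => j _.
by rewrite blk_green_diag mxtrace_scalar mulr_natl.
Qed.

(** An exact identity: tr (W G) = 2n + z tr G divided by 2n, with the square of the sum of the [gam]
    distributed over the diagonal and the pairs. Each bracket is then small in expectation. *)
Lemma stieltjes_equation e : (0 < n)%N ->
  (u +i* v) * stieltjes e + 1 + stieltjes e ^+ 2 = (2 * n%:R)^-1 *
  (\sum_j (diag_trace e j + 2 / n%:R * gam e j ^+ 2) +
   \sum_(j < n) \sum_(k < n | (j < k)%N) (pair_trace e j k + 4 / n%:R * (gam e j * gam e k))).
Proof.
move=> n0; have nn : n%:R != 0 :> C by rewrite pnatr_eq0 -lt0n.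
set g := \sum_j gam e j.
have NE : N%:R = 2 * n%:R :> C by rewrite sum_nat_const card_ord natrM mulrC.
have h : \tr (wig t e *m green e) = (u +i* v) * (2 * g) + 2 * n%:R.
  rewrite -mxtrace_green -[in LHS](subrK (u +i* v)%:M (wig t e)) mulmxDl mxtraceD.
  rewrite /green mulmxV ?green_unit// mxtrace1 mul_scalar_mx linearZ/= addrC.
  by rewrite NE.
have sq : g ^+ 2 = \sum_j gam e j ^+ 2 + 2 * \sum_(j < n) \sum_(k < n | (j < k)%N) gam e j * gam e k.
  rewrite /g expr2 big_distrlr/= sum_sum_split mulr_sumr; congr (_ + _).
  apply: eq_bigr => j _; rewrite mulr_sumr; apply: eq_bigr => k _.
  by rewrite [X in _ + X]mulrC mulr_natl mulr2n.
have -> : \sum_j (diag_trace e j + 2 / n%:R * gam e j ^+ 2) +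
   \sum_(j < n) \sum_(k < n | (j < k)%N) (pair_trace e j k + 4 / n%:R * (gam e j * gam e k)) =
   \tr (wig t e *m green e) + 2 / n%:R * g ^+ 2.
  rewrite mxtrace_wig_green sq big_split/= -mulr_sumr.
  under [X in _ + X = _]eq_bigr do rewrite big_split/= -mulr_sumr.
  rewrite big_split/= -mulr_sumr; set a := \sum_j _; set b := \sum_j _.
  set c := \sum_j _; set d := \sum_j _; field; exact: nn.
rewrite h /stieltjes -/g; field; exact: nn.
Qed.

End pair_expansion.

(** * Measurability and expectation of complex random variables *)

Section ReIm.
Variable R : rcfType.
Implicit Types x y : R[i].
Local Notation Re := complex.Re.
Local Notation Im := complex.Im.

Lemma cReD x y : Re (x + y) = Re x + Re y. Proof. by case: x; case: y. Qed.
Lemma cImD x y : Im (x + y) = Im x + Im y. Proof. by case: x; case: y. Qed.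
Lemma cReN x : Re (- x) = - Re x. Proof. by case: x. Qed.
Lemma cImN x : Im (- x) = - Im x. Proof. by case: x. Qed.
Lemma cReM x y : Re (x * y) = Re x * Re y - Im x * Im y.
Proof. by case: x; case: y. Qed.
Lemma cImM x y : Im (x * y) = Re x * Im y + Im x * Re y.
Proof. by case: x; case: y. Qed.
Lemma cReV x : Re x^-1 = Re x * (Re x ^+ 2 + Im x ^+ 2)^-1.
Proof. by case: x. Qed.
Lemma cImV x : Im x^-1 = - (Im x * (Re x ^+ 2 + Im x ^+ 2)^-1).
Proof. by case: x. Qed.

End ReIm.

Section complex_measurable.
Context d (T : measurableType d) (R : realType).
Local Notation C := R[i].
Implicit Types f g : T -> C.

Definition cmeas f := measurable_fun setT (fun w => complex.Re (f w)) /\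
  measurable_fun setT (fun w => complex.Im (f w)).

Lemma cmeas_cst c : cmeas (cst c).
Proof. by split; exact: measurable_cst. Qed.

Lemma cmeasD f g : cmeas f -> cmeas g -> cmeas (fun w => f w + g w).
Proof.
case=> f1 f2 [g1 g2]; split; under eq_fun do rewrite (cReD, cImD); exact: measurable_funD.
Qed.

Lemma cmeasN f : cmeas f -> cmeas (fun w => - f w).
Proof.
case=> f1 f2; split; under eq_fun do rewrite (cReN, cImN); exact: measurable_funN.
Qed.

Lemma cmeasB f g : cmeas f -> cmeas g -> cmeas (fun w => f w - g w).
Proof. by move=> mf mg; apply: cmeasD => //; exact: cmeasN. Qed.

Lemma cmeasM f g : cmeas f -> cmeas g -> cmeas (fun w => f w * g w).
Proof.
case=> f1 f2 [g1 g2]; split; under eq_fun do rewrite (cReM, cImM).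
- exact: (measurable_funB (measurable_funM f1 g1) (measurable_funM f2 g2)).
- exact: (measurable_funD (measurable_funM f1 g2) (measurable_funM f2 g1)).
Qed.

Lemma cmeas_sum (I : Type) (s : seq I) (Q : pred I) (F : I -> T -> C) :
  (forall i, cmeas (F i)) -> cmeas (fun w => \sum_(i <- s | Q i) F i w).
Proof.
move=> mF; elim: s => [|i s IH].
  have -> : (fun w : T => \sum_(i <- [::] | Q i) F i w) = cst 0.
    by apply/funext => w; rewrite big_nil.
  exact: cmeas_cst.
have -> : (fun w : T => \sum_(j <- i :: s | Q j) F j w) =
    fun w => (if Q i then F i w else 0) + \sum_(j <- s | Q j) F j w.
  by apply/funext => w; rewrite big_cons; case: ifP; rewrite ?add0r.
by case Qi : (Q i); apply: cmeasD => //; exact: cmeas_cst.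
Qed.

Lemma cmeas_prod (I : Type) (s : seq I) (F : I -> T -> C) :
  (forall i, cmeas (F i)) -> cmeas (fun w => \prod_(i <- s) F i w).
Proof.
move=> mF; elim: s => [|i s IH].
  have -> : (fun w : T => \prod_(i <- [::]) F i w) = cst 1.
    by apply/funext => w; rewrite big_nil.
  exact: cmeas_cst.
have -> : (fun w : T => \prod_(j <- i :: s) F j w) =
    fun w => F i w * \prod_(j <- s) F j w.
  by apply/funext => w; rewrite big_cons.
exact: cmeasM.
Qed.

Lemma measurable_invr_gt0 (f : T -> R) : measurable_fun setT f ->
  (forall w, 0 < f w) -> measurable_fun setT (fun w => (f w)^-1).
Proof.
move=> mf f0; have -> : (fun w => (f w)^-1) = (fun w => expR (- ln (f w))).
  by apply/funext => w; rewrite expRN lnK// posrE.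
apply: measurableT_comp => //; apply: measurable_funN.
exact: measurableT_comp.
Qed.

Lemma cmeasV f : cmeas f -> (forall w, f w != 0) -> cmeas (fun w => (f w)^-1).
Proof.
case=> f1 f2 f0.
have mN : measurable_fun setT (fun w => complex.Re (f w) ^+ 2 + complex.Im (f w) ^+ 2).
  by apply: measurable_funD; exact: measurable_funX.
have mV := measurable_invr_gt0 mN.
have {}mV : measurable_fun setT
    (fun w => (complex.Re (f w) ^+ 2 + complex.Im (f w) ^+ 2)^-1).
  apply: mV => w; have := f0 w; case: (f w) => a b; rewrite eq_complex /= negb_and.
  by move=> /orP[]; rewrite -sqrf_eq0 => h;
    [apply: ltr_wpDr|apply: ltr_wpDl]; rewrite ?sqr_ge0// lt0r h sqr_ge0.
split; under eq_fun do rewrite (cReV, cImV).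
- exact: (measurable_funM f1 mV).
- exact: (measurable_funN (measurable_funM f2 mV)).
Qed.

Lemma cmeas_det n (M : T -> 'M[C]_n) : (forall i j, cmeas (fun w => M w i j)) ->
  cmeas (fun w => \det (M w)).
Proof.
move=> mM; apply: cmeas_sum => s; apply: cmeasM; first exact: cmeas_cst.
by apply: cmeas_prod => i; exact: mM.
Qed.

(** Cramer's rule: an entry of the inverse is a quotient of polynomials in the entries. *)
Lemma cmeas_invmx n (M : T -> 'M[C]_n) : (forall i j, cmeas (fun w => M w i j)) ->
  (forall w, M w \in unitmx) -> forall i j, cmeas (fun w => invmx (M w) i j).
Proof.
move=> mM uM i j.
have -> : (fun w => invmx (M w) i j) = fun w => (\det (M w))^-1 * cofactor (M w) j i.
  by apply/funext => w; rewrite /invmx uM !mxE.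
apply: cmeasM.
  by apply: cmeasV => [|w]; [exact: cmeas_det|rewrite -unitfE -unitmxE].
apply: cmeasM; first exact: cmeas_cst.
apply: cmeas_det => a b.
have -> : (fun w => row' j (col' i (M w)) a b) = fun w => M w (lift j a) (lift i b).
  by apply/funext => w; rewrite !mxE.
exact: mM.
Qed.

Lemma measurable_nm_sqr f : cmeas f -> measurable_fun setT (fun w => nm (f w) ^+ 2).
Proof.
case=> f1 f2; have -> : (fun w => nm (f w) ^+ 2) =
  fun w => complex.Re (f w) ^+ 2 + complex.Im (f w) ^+ 2.
  by apply/funext => w; rewrite nm_sqr.
by apply: measurable_funD; exact: measurable_funX.
Qed.

End complex_measurable.

Section green_measurable.
Context d (T : measurableType d) (R : realType).
Variables (n : nat) (t u v : R).
Hypothesis v0 : 0 < v.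
Variable F : T -> 'I_n * 'I_n -> quat R.
Hypothesis mF : forall p : 'I_n * 'I_n, (p.1 <= p.2)%N -> measurable_fun setT (fun w => F w p).

Lemma measurable_q0 : measurable_fun setT (@q0 R).
Proof.
exact: (measurableT_comp measurable_fst (measurableT_comp measurable_fst measurable_fst)).
Qed.

Lemma measurable_q1 : measurable_fun setT (@q1 R).
Proof.
exact: (measurableT_comp measurable_snd (measurableT_comp measurable_fst measurable_fst)).
Qed.

Lemma measurable_q2 : measurable_fun setT (@q2 R).
Proof. exact: (measurableT_comp measurable_snd measurable_fst). Qed.

Lemma measurable_q3 : measurable_fun setT (@q3 R).
Proof. exact: measurable_snd. Qed.

Lemma cmeas_qblock (Q : T -> quat R) : measurable_fun setT Q ->
  forall i j, cmeas (fun w => qblock (Q w) i j).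
Proof.
move=> mQ i j.
have m0 := measurableT_comp measurable_q0 mQ.
have m1 := measurableT_comp measurable_q1 mQ.
have m2 := measurableT_comp measurable_q2 mQ.
have m3 := measurableT_comp measurable_q3 mQ.
have -> : (fun w => qblock (Q w) i j) = fun w =>
    if i == 0 then if j == 0 then q0 (Q w) +i* q1 (Q w) else q2 (Q w) +i* q3 (Q w)
    else if j == 0 then - (q2 (Q w) -i* q3 (Q w)) else q0 (Q w) -i* q1 (Q w).
  by apply/funext => w; rewrite mxE.
case: (i == 0); case: (j == 0); split => //=.
- exact: measurable_funN.
- by under eq_fun do rewrite opprK.
- exact: measurable_funN.
Qed.

Lemma cmeas_blk_wig j k a b : cmeas (fun w => blk (wig t (F w)) j k a b).
Proof.
have -> : (fun w => blk (wig t (F w)) j k a b) =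
    fun w => t%:C * qblock (qherm (F w) j k) a b.
  by apply/funext => w; rewrite blk_wig mxE.
apply: cmeasM; first exact: cmeas_cst.
apply: cmeas_qblock; under eq_fun do rewrite mxE.
have [jk|kj|jk] := ltngtP j k.
- by apply: mF; exact: ltnW.
- have h := mF (p := (k, j)) (ltnW kj).
  do ![apply: measurable_fun_pair]; rewrite /=.
  + exact: (measurableT_comp measurable_q0 h).
  + by apply: measurable_funN; exact: (measurableT_comp measurable_q1 h).
  + by apply: measurable_funN; exact: (measurableT_comp measurable_q2 h).
  + by apply: measurable_funN; exact: (measurableT_comp measurable_q3 h).
- have h := mF (p := (j, j)) (leqnn j).
  do ![apply: measurable_fun_pair]; rewrite //=.
  exact: (measurableT_comp measurable_q0 h).
Qed.

Lemma cmeas_green a b : cmeas (fun w => green t u v (F w) a b).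
Proof.
apply: cmeas_invmx; last by move=> w; exact: green_unit.
move=> i j; have -> : (fun w => (wig t (F w) - (u +i* v)%:M) i j) =
    fun w => wig t (F w) i j - (u +i* v)%:M i j.
  by apply/funext => w; rewrite !mxE.
apply: cmeasB; last exact: cmeas_cst.
have -> : (fun w => wig t (F w) i j) = fun w =>
    blk (wig t (F w)) (tagnat.sig1 i) (tagnat.sig1 j) (tagnat.sig2 i) (tagnat.sig2 j).
  by apply/funext => w; rewrite -{1}(submxblockK (wig t (F w))) mxE.
exact: cmeas_blk_wig.
Qed.

Lemma cmeas_blk_green j k a b : cmeas (fun w => blk (green t u v (F w)) j k a b).
Proof.
have -> : (fun w => blk (green t u v (F w)) j k a b) =
    fun w => green t u v (F w) (tagnat.Rank j a) (tagnat.Rank k b).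
  by apply/funext => w; rewrite mxE.
exact: cmeas_green.
Qed.

Lemma cmeas_gam j : cmeas (fun w => gam t u v (F w) j).
Proof. exact: cmeas_blk_green. Qed.

Lemma cmeas_mxtrace_mul (A B : T -> 'M[R[i]]_2) :
  (forall a b, cmeas (fun w => A w a b)) -> (forall a b, cmeas (fun w => B w a b)) ->
  cmeas (fun w => \tr (A w *m B w)).
Proof.
move=> mA mB; apply: cmeas_sum => a.
have -> : (fun w => (A w *m B w) a a) = fun w => \sum_b A w a b * B w b a.
  by apply/funext => w; rewrite mxE.
by apply: cmeas_sum => b; exact: cmeasM.
Qed.

Lemma cmeas_pair_trace j k : cmeas (fun w => pair_trace t u v (F w) j k).
Proof.
by apply: cmeasD; apply: cmeas_mxtrace_mul => a b;
  [exact: cmeas_blk_wig|exact: cmeas_blk_green|exact: cmeas_blk_wig|exact: cmeas_blk_green].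
Qed.

Lemma cmeas_diag_trace j : cmeas (fun w => diag_trace t u v (F w) j).
Proof.
by apply: cmeas_mxtrace_mul => a b; [exact: cmeas_blk_wig|exact: cmeas_blk_green].
Qed.

Lemma cmeas_psi j k i : cmeas (fun w => psi t u v (F w) j k i).
Proof.
by apply: cmeasD; apply: cmeas_mxtrace_mul => a b;
  [exact: cmeas_cst|exact: cmeas_blk_green|exact: cmeas_cst|exact: cmeas_blk_green].
Qed.

Lemma measurable_fro2 j k : measurable_fun setT (fun w => fro2 (blk (green t u v (F w)) j k)).
Proof.
rewrite /fro2; apply: measurable_sum => a; apply: measurable_sum => b.
exact: measurable_nm_sqr (cmeas_blk_green _ _ _ _).
Qed.

Lemma measurable_fro_pair j k : measurable_fun setT (fun w => fro_pair t u v (F w) j k).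
Proof. by apply: measurable_funD; exact: measurable_fro2. Qed.

Lemma cmeas_stieltjes : cmeas (fun w => stieltjes t u v (F w)).
Proof.
apply: cmeasM; first exact: cmeas_cst.
by apply: cmeas_sum => j; exact: cmeas_gam.
Qed.

End green_measurable.

Section complex_expectation.
Context d (T : measurableType d) (R : realType) (P : probability T R).
Local Notation C := R[i].
Implicit Types f g : T -> C.

Definition cL1 f := L1 P (fun w => complex.Re (f w)) /\ L1 P (fun w => complex.Im (f w)).

Definition cEx f : C :=
  Ex P (fun w => complex.Re (f w)) +i* Ex P (fun w => complex.Im (f w)).

Lemma cL1_le f (g : T -> R) : cmeas f -> (forall w, nm (f w) <= g w) -> L1 P g -> cL1 f.
Proof.
move=> [f1 f2] fg lg; split.
- by apply: L1_le lg => // w; apply: le_trans (fg w); exact: nm_Re.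
- by apply: L1_le lg => // w; apply: le_trans (fg w); exact: nm_Im.
Qed.

Lemma cL1_bounded K f : cmeas f -> (forall w, nm (f w) <= K) -> cL1 f.
Proof. by move=> mf fK; apply: (cL1_le mf fK); exact: L1_cst. Qed.

Lemma cL1_cst c : cL1 (cst c).
Proof. by split; exact: L1_cst. Qed.

Lemma cL1D f g : cL1 f -> cL1 g -> cL1 (fun w => f w + g w).
Proof. by case=> f1 f2 [g1 g2]; split; under eq_fun do rewrite (cReD, cImD); exact: L1D. Qed.

Lemma cL1N f : cL1 f -> cL1 (fun w => - f w).
Proof. by case=> f1 f2; split; under eq_fun do rewrite (cReN, cImN); exact: L1N. Qed.

Lemma cL1B f g : cL1 f -> cL1 g -> cL1 (fun w => f w - g w).
Proof. by move=> lf lg; apply: cL1D => //; exact: cL1N. Qed.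

Lemma cL1Z (c : C) f : cL1 f -> cL1 (fun w => c * f w).
Proof.
case=> f1 f2; split.
- have -> : (fun w => complex.Re (c * f w)) =
      fun w => complex.Re c * complex.Re (f w) - complex.Im c * complex.Im (f w).
    by apply/funext => w; exact: cReM.
  by apply: L1B; exact: L1Z.
- have -> : (fun w => complex.Im (c * f w)) =
      fun w => complex.Re c * complex.Im (f w) + complex.Im c * complex.Re (f w).
    by apply/funext => w; exact: cImM.
  by apply: L1D; exact: L1Z.
Qed.

Lemma cL1_sum (I : Type) (s : seq I) (Q : pred I) (F : I -> T -> C) :
  (forall i, Q i -> cL1 (F i)) -> cL1 (fun w => \sum_(i <- s | Q i) F i w).
Proof.
move=> LF; elim: s => [|i s IH].
  have -> : (fun w : T => \sum_(i <- [::] | Q i) F i w) = cst 0.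
    by apply/funext => w; rewrite big_nil.
  exact: cL1_cst.
have -> : (fun w : T => \sum_(j <- i :: s | Q j) F j w) =
    fun w => (if Q i then F i w else 0) + \sum_(j <- s | Q j) F j w.
  by apply/funext => w; rewrite big_cons; case: ifP; rewrite ?add0r.
by case Qi : (Q i); apply: cL1D => //; [exact: LF|exact: cL1_cst].
Qed.

Lemma cEx_cst c : cEx (cst c) = c.
Proof.
rewrite /cEx (Ex_cst P (complex.Re c)) (Ex_cst P (complex.Im c)).
by case: c.
Qed.

Lemma cExD f g : cL1 f -> cL1 g -> cEx (fun w => f w + g w) = cEx f + cEx g.
Proof.
case=> f1 f2 [g1 g2]; rewrite /cEx; apply/eqP; rewrite eq_complex /=.
by rewrite -ExD// -ExD//; apply/andP; split; apply/eqP; congr Ex; apply/funext => w;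
  rewrite (cReD, cImD).
Qed.

Lemma cExZ (c : C) f : cL1 f -> cEx (fun w => c * f w) = c * cEx f.
Proof.
case=> f1 f2; rewrite /cEx; case: c => a b; apply/eqP; rewrite eq_complex /=.
rewrite -!ExZ// -ExB -?ExD; try exact: L1Z.
by apply/andP; split; apply/eqP; congr Ex; apply/funext => w; [exact: cReM|exact: cImM].
Qed.

Lemma cExN f : cL1 f -> cEx (fun w => - f w) = - cEx f.
Proof.
move=> lf; rewrite -mulN1r -cExZ//; congr cEx; apply/funext => w.
by rewrite mulN1r.
Qed.

Lemma cExB f g : cL1 f -> cL1 g -> cEx (fun w => f w - g w) = cEx f - cEx g.
Proof. by move=> lf lg; rewrite cExD ?cExN//; exact: cL1N. Qed.

Lemma cEx_sum (I : Type) (s : seq I) (Q : pred I) (F : I -> T -> C) :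
  (forall i, Q i -> cL1 (F i)) ->
  cEx (fun w => \sum_(i <- s | Q i) F i w) = \sum_(i <- s | Q i) cEx (F i).
Proof.
move=> LF; elim: s => [|i s IH].
  by rewrite big_nil -[RHS](cEx_cst 0); congr cEx; apply/funext => w; rewrite big_nil.
rewrite big_cons; case: ifP => Qi; rewrite -?IH -?cExD; [|exact: LF|exact: cL1_sum|];
  by congr cEx; apply/funext => w; rewrite big_cons Qi.
Qed.

(** The factor 2 comes from bounding the real and imaginary parts separately. It only affects
    constants. *)
Lemma cEx_le f (g : T -> R) : cL1 f -> (forall w, nm (f w) <= g w) -> L1 P g ->
  nm (cEx f) <= 2 * Ex P g.
Proof.
move=> [f1 f2] fg lg; apply: le_trans (nm_le_ReIm _) _.
rewrite mulr_natl mulr2n /=; apply: lerD; apply: le_trans (Ex_norm _) _ => //;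
  (apply: Ex_le => //; first exact: L1_norm) => w; apply: le_trans (fg w).
- exact: nm_Re.
- exact: nm_Im.
Qed.

End complex_expectation.

(** * Expectation of a product of independent variables *)

Section indep_product.
Context d d1 d2 (T : measurableType d) (E1 : measurableType d1)
  (E2 : measurableType d2) (R : realType) (P : probability T R).
Context (U : T -> E1) (V : T -> E2).
Hypotheses (mU : measurable_fun setT U) (mV : measurable_fun setT V).
Hypothesis indep : forall A B, measurable A -> measurable B ->
  P (U @^-1` A `&` V @^-1` B) = (P (U @^-1` A) * P (V @^-1` B))%E.

Lemma ge0_Ex_indepM (f : E1 -> R) (g : E2 -> R) :
  measurable_fun setT f -> measurable_fun setT g ->
  (forall x, 0 <= f x) -> (forall y, 0 <= g y) ->
  L1 P (fun w => f (U w)) -> L1 P (fun w => g (V w)) ->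
  L1 P (fun w => f (U w) * g (V w)) ->
  Ex P (fun w => f (U w) * g (V w)) = Ex P (fun w => f (U w)) * Ex P (fun w => g (V w)).
Proof.
move=> mf mg f0 g0 lf lg lfg; apply: EFin_inj; rewrite EFinM -!L1_EFin//.
pose h (x : E1 * E2) := (f x.1 * g x.2)%:E.
have mh : measurable_fun setT h.
  apply/measurable_EFinP; apply: measurable_funM; exact: measurableT_comp.
have h0 x : (0 <= h x)%E by rewrite lee_fin mulr_ge0.
rewrite (indep_ge0_integral mU mV indep mh h0) /h /=.
transitivity (\int[P]_w' ((Ex P (fun w => f (U w)))%:E * (g (V w'))%:E))%E.
  apply: eq_integral => w' _; rewrite -(L1_EFin lf).
  under eq_integral do rewrite EFinM.
  apply: ge0_integralZr => //.
  - by apply/measurable_EFinP; exact: (L1_measurable lf).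
  - by move=> w _; exact: f0.
  - by rewrite lee_fin.
rewrite (L1_EFin lf); apply: ge0_integralZl => //.
- by apply/measurable_EFinP; exact: (L1_measurable lg).
- by move=> w _; exact: g0.
- by rewrite lee_fin; apply: Ex_ge0.
Qed.

Lemma Ex_indepM (f : E1 -> R) (g : E2 -> R) K :
  measurable_fun setT f -> measurable_fun setT g ->
  (forall y, `|g y| <= K) -> L1 P (fun w => f (U w)) ->
  Ex P (fun w => f (U w) * g (V w)) = Ex P (fun w => f (U w)) * Ex P (fun w => g (V w)).
Proof.
move=> mf mg gK lf.
have mgV : measurable_fun setT (fun w => g (V w)) by exact: (measurableT_comp mg mV).
have lg : L1 P (fun w => g (V w)) by apply: (@L1_bounded _ _ _ _ K).
have lgK : L1 P (fun w => g (V w) + K) by apply: L1D => //; exact: L1_cst.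
have g'0 y : 0 <= g y + K by have := gK y; rewrite ler_norml => /andP[? _]; lra.
have g'K y : `|g y + K| <= K + K.
  by apply: le_trans (ler_normD _ _) _; rewrite lerD// ger0_norm// (le_trans _ (gK y)).
have mg' : measurable_fun setT (fun y => g y + K) by exact: measurable_funD.
have lM (f1 : E1 -> R) : L1 P (fun w => f1 (U w)) -> L1 P (fun w => f1 (U w) * (g (V w) + K)).
  by move=> lf1; apply: (@L1M _ _ _ _ (K + K)) => //; exact: (measurableT_comp mg' mV).
(* Reduction to nonnegative factors: f = f1 - f2 with f1 = |f| and f2 = |f| - f, and g = (g + K) -
   K. *)
pose f1 x := `|f x|; pose f2 x := `|f x| - f x.
have mf1 : measurable_fun setT f1 by exact: measurableT_comp.
have mf2 : measurable_fun setT f2 by exact: measurable_funB.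
have lf1 : L1 P (fun w => f1 (U w)) by exact: L1_norm.
have lf2 : L1 P (fun w => f2 (U w)) by exact: L1B.
have f10 x : 0 <= f1 x by exact: normr_ge0.
have f20 x : 0 <= f2 x by rewrite subr_ge0 ler_norm.
have e1 := ge0_Ex_indepM mf1 mg' f10 g'0 lf1 lgK (lM _ lf1).
have e2 := ge0_Ex_indepM mf2 mg' f20 g'0 lf2 lgK (lM _ lf2).
have -> : (fun w => f (U w) * g (V w)) =
   (fun w => f1 (U w) * (g (V w) + K) - f2 (U w) * (g (V w) + K) - K * f (U w)).
  by apply/funext => w; rewrite /f1 /f2; ring.
rewrite ExB; [|by apply: L1B; exact: lM|exact: L1Z].
rewrite ExB; [|exact: lM|exact: lM].
have e3 : Ex P (fun w => f2 (U w)) = Ex P (fun w => f1 (U w)) - Ex P (fun w => f (U w)).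
  by rewrite -ExB.
have e4 : Ex P (fun w => g (V w) + K) = Ex P (fun w => g (V w)) + K.
  by rewrite ExD// ?(Ex_cst P K)//; exact: L1_cst.
by rewrite e1 e2 (ExZ _ lf) e3 e4; ring.
Qed.

End indep_product.

(** * The self-consistent equation *)

Section one_size.
Context d (T : measurableType d) (R : realType) (P : probability T R).
Local Notation C := R[i].
Variables (n : nat) (u v : R) (Y : 'I_n * 'I_n -> T -> quat R) (M : R).
Hypotheses (n0 : (0 < n)%N) (v0 : 0 < v).
Let A : {set 'I_n * 'I_n} := [set p : 'I_n * 'I_n | (p.1 <= p.2)%N]%SET.
Hypothesis mY : forall p, measurable_fun setT (Y p).
Hypothesis indepY : mutually_independent P A Y.
Hypothesis L2Y : forall p, p \in A -> L1 P (fun w => qnorm (Y p w) ^+ 2).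
Hypothesis EY0 : forall j k : 'I_n, (j < k)%N -> forall i,
  Ex P (fun w => qcoord i (Y (j, k) w)) = 0.
Hypothesis EY1 : forall j k : 'I_n, (j < k)%N ->
  Ex P (fun w => qnorm (Y (j, k) w) ^+ 2) = 1.
Hypothesis EYM : forall j : 'I_n, Ex P (fun w => qnorm (Y (j, j) w) ^+ 2) <= M.

Let Z w : 'I_n * 'I_n -> quat R := fun p => Y p w.
Let t : R := (Num.sqrt n%:R)^-1.

Let nn0 : 0 < n%:R :> R. Proof. by rewrite ltr0n. Qed.

Let t0 : 0 < t. Proof. by rewrite invr_gt0 sqrtr_gt0. Qed.

Let t2 : t ^+ 2 = n%:R^-1.
Proof. by rewrite exprVn sqr_sqrtr// ler0n. Qed.

Lemma measurable_qnorm : measurable_fun setT (@qnorm R).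
Proof.
have m : measurable_fun setT (fun x : quat R => q0 x ^+ 2 + q1 x ^+ 2 + q2 x ^+ 2 + q3 x ^+ 2).
  by do ![apply: measurable_funD]; apply: measurable_funX;
    [exact: measurable_q0|exact: measurable_q1|exact: measurable_q2|exact: measurable_q3].
apply: (measurableT_comp _ m).
by apply: continuous_measurable_fun; exact: sqrt_continuous.
Qed.

Let mZ (p : 'I_n * 'I_n) : (p.1 <= p.2)%N -> measurable_fun setT (fun w => Z w p).
Proof. by move=> _; exact: mY. Qed.

Let mN p : measurable_fun setT (fun w => qnorm (Y p w)).
Proof. exact: (measurableT_comp measurable_qnorm (mY p)). Qed.

Lemma L1_qnorm p : p \in A -> L1 P (fun w => qnorm (Y p w)).
Proof.
move=> pA; apply: (@L1_le _ _ _ _ _ (fun w => 1 + qnorm (Y p w) ^+ 2)) => //.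
  move=> w; rewrite ger0_norm ?qnorm_ge0//.
  by have := sqr_ge0 (qnorm (Y p w) - 1); nra.
by apply: L1D; [exact: L1_cst|exact: L2Y].
Qed.

Lemma Ex_qnorm_le p K : p \in A -> Ex P (fun w => qnorm (Y p w) ^+ 2) <= K ->
  Ex P (fun w => qnorm (Y p w)) <= 1 + K.
Proof.
move=> pA hK; apply: (@le_trans _ _ (Ex P (fun w => 1 + qnorm (Y p w) ^+ 2))).
  apply: Ex_le; first exact: L1_qnorm.
    by apply: L1D; [exact: L1_cst|exact: L2Y].
  by move=> w; have := sqr_ge0 (qnorm (Y p w) - 1); nra.
rewrite ExD; [|exact: L1_cst|exact: L2Y].
by rewrite (Ex_cst P 1) lerD2l.
Qed.

Section pair.
Variables (j k : 'I_n) (eta : R).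
Hypotheses (jk : (j < k)%N) (eta0 : 0 < eta).
Let p := (j, k).

Let pA : p \in A. Proof. by rewrite inE /= ltnW. Qed.

Let BA : [set p]%SET \subset A. Proof. by rewrite finset.sub1set. Qed.
Let CA : (A :\ p)%SET \subset A. Proof. exact: finset.subD1set. Qed.
Let dBC : [disjoint [set p]%SET & (A :\ p)%SET]%B.
Proof. by rewrite finset.disjoints1 !inE eqxx. Qed.

Let mY' q : q \in A -> measurable_fun setT (Y q). Proof. by move=> _; exact: mY. Qed.
Let mB := measurable_process mY' BA.
Let mC := measurable_process mY' CA.
Let ind := indep_blocks mY' indepY dBC BA CA.

Lemma indep_entry (phi : quat R -> R) (ps : ('I_n * 'I_n -> quat R) -> R) K :
  measurable_fun setT phi -> measurable_fun setT (ps : box_space (quat R) (A :\ p)%SET -> R) ->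
  (forall e, `|ps e| <= K) -> L1 P (fun w => phi (Y p w)) ->
  Ex P (fun w => phi (Y p w) * ps (Z w)) = Ex P (fun w => phi (Y p w)) * Ex P (fun w => ps (Z w)).
Proof.
move=> mphi mps psK lphi.
have mphi' : measurable_fun setT (fun e : box_space (quat R) [set p]%SET => phi (e p)).
  by apply: (measurableT_comp mphi); apply: measurable_coord; rewrite inE.
exact: (Ex_indepM mB mC ind mphi' mps psK lphi).
Qed.

Lemma cindep_entry (phi : quat R -> R) (ps : ('I_n * 'I_n -> quat R) -> C) K :
  measurable_fun setT phi -> cmeas (ps : box_space (quat R) (A :\ p)%SET -> C) ->
  (forall e, nm (ps e) <= K) -> L1 P (fun w => phi (Y p w)) ->
  cEx P (fun w => (phi (Y p w))%:C * ps (Z w)) =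
  (Ex P (fun w => phi (Y p w)))%:C * cEx P (fun w => ps (Z w)).
Proof.
move=> mphi [m1 m2] psK lphi.
have h1 := @indep_entry phi (fun e => complex.Re (ps e)) K mphi m1.
have h2 := @indep_entry phi (fun e => complex.Im (ps e)) K mphi m2.
apply/eqP; rewrite eq_complex /= !mul0r subr0 addr0 -h1//; last first.
  by move=> e; apply: le_trans (psK e); exact: nm_Re.
rewrite -h2//; last by move=> e; apply: le_trans (psK e); exact: nm_Im.
apply/andP; split; apply/eqP; congr Ex; apply/funext => w.
  by rewrite cReM /= mul0r subr0.
by rewrite cImM /= mul0r addr0.
Qed.

Let mE (q : 'I_n * 'I_n) : (q.1 <= q.2)%N ->
  measurable_fun setT (fun e : box_space (quat R) (A :\ p)%SET => erase p e q).
Proof.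
move=> hq; rewrite /erase; case: (eqVneq q p) => qp; first exact: measurable_cst.
by apply: measurable_coord; rewrite !inE qp.
Qed.

Let mEZ (q : 'I_n * 'I_n) : (q.1 <= q.2)%N ->
  measurable_fun setT (fun w => erase p (Z w) q).
Proof.
move=> hq; rewrite /erase; case: (eqVneq q p) => qp; first exact: measurable_cst.
exact: mY.
Qed.

Definition lindeberg_term :=
  Ex P (fun w => qnorm (Y p w) ^+ 2 * (eta * Num.sqrt n%:R <= qnorm (Y p w))%R%:R).

Let g e := gam t u v e j * gam t u v e k.

Let gK e : nm (g e) <= v^-1 * v^-1.
Proof. by rewrite nmM; apply: ler_pM; rewrite ?nm_ge0//; exact: gam_le. Qed.

Let rho w := weight t (Z w) j k.

Let rhoE w : rho w = t * qnorm (Y p w).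
Proof. by rewrite /rho /weight ger0_norm// ltW. Qed.

Let lrho : L1 P rho.
Proof. by rewrite (funext rhoE); apply: L1Z; exact: L1_qnorm. Qed.

Let lrho2 : L1 P (fun w => rho w ^+ 2).
Proof.
have -> : (fun w => rho w ^+ 2) = fun w => n%:R^-1 * qnorm (Y p w) ^+ 2.
  by apply/funext => w; rewrite rhoE exprMn t2.
by apply: L1Z; exact: L2Y.
Qed.

Let Erho2 : Ex P (fun w => rho w ^+ 2) = n%:R^-1.
Proof.
have -> : (fun w => rho w ^+ 2) = fun w => n%:R^-1 * qnorm (Y p w) ^+ 2.
  by apply/funext => w; rewrite rhoE exprMn t2.
by rewrite ExZ; [rewrite EY1// mulr1|exact: L2Y].
Qed.

Let Erho : Ex P rho <= 2 * t.
Proof.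
rewrite (funext rhoE) ExZ; last exact: L1_qnorm.
rewrite mulrC ler_pM2r//; apply: Ex_qnorm_le => //.
by rewrite EY1.
Qed.

Let mg : cmeas (fun w => g (Z w)).
Proof. by apply: cmeasM; exact: cmeas_gam. Qed.

Let mg' : cmeas (fun w => g (erase p (Z w))).
Proof. by apply: cmeasM; exact: (cmeas_gam t u v0 mEZ). Qed.

Let lg : cL1 P (fun w => g (Z w)). Proof. exact: cL1_bounded mg (fun w => gK _). Qed.

Let lg' : cL1 P (fun w => g (erase p (Z w))). Proof. exact: cL1_bounded mg' (fun w => gK _). Qed.

Let lin w := \sum_i (t * qcoord i (Y p w))%:C * psi t u v (erase p (Z w)) j k i.

Let mqc i : measurable_fun setT (@qcoord R i).
Proof.
rewrite /qcoord; case: i => [[|[|[|[|//]]]] h] /=;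
  [exact: measurable_q0|exact: measurable_q1|exact: measurable_q2|exact: measurable_q3].
Qed.

Let lqc i : L1 P (fun w => qcoord i (Y p w)).
Proof.
apply: (L1_le _ _ (L1_qnorm pA)); first exact: (measurableT_comp (mqc i) (mY p)).
by move=> w; exact: qcoord_le.
Qed.

Let lterm i : cL1 P (fun w => (t * qcoord i (Y p w))%:C * psi t u v (erase p (Z w)) j k i).
Proof.
apply: (@cL1_le _ _ _ _ _ (fun w => t * qnorm (Y p w) * (8 / v))).
- apply: cmeasM; last exact: (cmeas_psi t u v0 mEZ).
  split => /=; last exact: measurable_cst.
  by apply: measurable_funM => //; exact: (measurableT_comp (mqc i) (mY p)).
- move=> w; rewrite nmM nm_real; apply: ler_pM; rewrite ?nm_ge0//; last exact: psi_le.
  by rewrite normrM gtr0_norm// ler_pM2l//; exact: qcoord_le.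
- under eq_fun do rewrite mulrC; apply: L1Z; apply: L1Z; exact: L1_qnorm.
Qed.

Let llin : cL1 P lin. Proof. by apply: cL1_sum => i _; exact: lterm. Qed.

Let Elin : cEx P lin = 0.
Proof.
rewrite cEx_sum; last by move=> i _; exact: lterm.
apply: big1 => i _.
have -> : cEx P (fun w => (t * qcoord i (Y p w))%:C * psi t u v (erase p (Z w)) j k i) =
    (Ex P (fun w => t * qcoord i (Y p w)))%:C * cEx P (fun w => psi t u v (erase p (Z w)) j k i).
  apply: (@cindep_entry (fun x => t * qcoord i x)
    (fun e => psi t u v (erase p e) j k i) (8 / v)).
  - by apply: measurable_funM.
  - exact: (cmeas_psi t u v0 mE).
  - by move=> e; exact: psi_le.
  - exact: L1Z (lqc i).
by rewrite (ExZ _ (lqc i)) EY0// mulr0 mul0r.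
Qed.

Let lquad : cL1 P (fun w => (4 * rho w ^+ 2)%:C * g (erase p (Z w))).
Proof.
apply: (@cL1_le _ _ _ _ _ (fun w => 4 * (v^-1 * v^-1) * rho w ^+ 2)).
- apply: cmeasM => //; split => /=; last exact: measurable_cst.
  by apply: measurable_funM => //; exact: (L1_measurable lrho2).
- move=> w; rewrite nmM nm_real ger0_norm; last by rewrite mulr_ge0// sqr_ge0.
  by rewrite [leRHS]mulrAC; apply: ler_wpM2l; [rewrite mulr_ge0// sqr_ge0|exact: gK].
- exact: L1Z.
Qed.

Let Equad : cEx P (fun w => (4 * rho w ^+ 2)%:C * g (erase p (Z w))) =
  (4 / n%:R)%:C * cEx P (fun w => g (erase p (Z w))).
Proof.
pose phi x := 4 * (t * qnorm x) ^+ 2.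
have e0 : (fun w => 4 * rho w ^+ 2) = fun w => phi (Y p w).
  by apply/funext => w; rewrite /phi rhoE.
have -> : (4 / n%:R)%:C = (Ex P (fun w => phi (Y p w)))%:C.
  by rewrite -e0 ExZ// Erho2.
have -> : (fun w => (4 * rho w ^+ 2)%:C * g (erase p (Z w))) =
    fun w => (phi (Y p w))%:C * g (erase p (Z w)).
  by apply/funext => w; rewrite /phi rhoE.
apply: (@cindep_entry phi (fun e => g (erase p e)) (v^-1 * v^-1)).
- apply: measurable_funM => //; apply: measurable_funX; apply: measurable_funM => //.
  exact: measurable_qnorm.
- by apply: cmeasM; exact: (cmeas_gam t u v0 mE).
- by move=> e; exact: gK.
- by rewrite -e0; exact: L1Z.
Qed.

Let F e := fro_pair t u v e j k.

Let F_bnd e : `|F e| <= 8 / v ^+ 2.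
Proof.
rewrite ger0_norm ?fro_pair_ge0// /F /fro_pair.
have h a b : fro2 (blk (green t u v e) a b) <= 4 / v ^+ 2.
  rewrite /fro2; have -> : 4 / v ^+ 2 = \sum_(c < 2) \sum_(l < 2) (v^-1) ^+ 2.
    by rewrite !big_ord2 -exprVn; lra.
  apply: ler_sum => c _; apply: ler_sum => l _.
  by rewrite lerXn2r ?nnegrE ?nm_ge0 ?invr_ge0 ?(ltW v0)//; exact: mxbnd_blk_green.
by have := lerD (h k j) (h j k); rewrite -mulrDl -natrD.
Qed.

Lemma L1_fro : L1 P (fun w => F (Z w)).
Proof.
apply: (@L1_bounded _ _ _ _ (8 / v ^+ 2)) => [|w]; last exact: F_bnd.
exact: measurable_fro_pair.
Qed.

Let L1_fro' : L1 P (fun w => F (erase p (Z w))).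
Proof.
apply: (@L1_bounded _ _ _ _ (8 / v ^+ 2)) => [|w]; last exact: F_bnd.
exact: (measurable_fro_pair t u v0 mEZ).
Qed.

Let lrho2F : L1 P (fun w => rho w ^+ 2 * F (erase p (Z w))).
Proof.
apply: (@L1M _ _ _ _ (8 / v ^+ 2)) => //.
exact: (measurable_fro_pair t u v0 mEZ).
Qed.

(** Independence separates rho^2, of mean 1 / n, from the blocks of the erased resolvent. Going back
    to the full resolvent costs a multiple of the mean of rho, which is at most 2 t. *)
Let Erho2F : Ex P (fun w => rho w ^+ 2 * F (erase p (Z w))) <=
  n%:R^-1 * (2 * Ex P (fun w => F (Z w)) + 512 * t / v ^+ 3).
Proof.
pose phi x := (t * qnorm x) ^+ 2.
have e0 : (fun w => rho w ^+ 2) = fun w => phi (Y p w).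
  by apply/funext => w; rewrite /phi rhoE.
have -> : (fun w => rho w ^+ 2 * F (erase p (Z w))) =
    fun w => phi (Y p w) * F (erase p (Z w)).
  by apply/funext => w; rewrite /phi rhoE.
have -> : Ex P (fun w => phi (Y p w) * F (erase p (Z w))) =
    Ex P (fun w => phi (Y p w)) * Ex P (fun w => F (erase p (Z w))).
  apply: (@indep_entry phi (fun e => F (erase p e)) (8 / v ^+ 2)).
  - by apply: measurable_funX; apply: measurable_funM => //; exact: measurable_qnorm.
  - exact: (measurable_fro_pair t u v0 mE).
  - by move=> e; exact: F_bnd.
  - by rewrite -e0.
rewrite -e0 Erho2 ler_pM2l ?invr_gt0//.
have c0 : 0 <= 256 / v ^+ 3 by rewrite divr_ge0 ?ler0n ?exprn_ge0 ?(ltW v0).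
apply: (@le_trans _ _ (Ex P (fun w => 2 * F (Z w) + 256 / v ^+ 3 * rho w))).
  apply: Ex_le; [exact: L1_fro'|by apply: L1D; apply: L1Z; [exact: L1_fro|exact: lrho]|].
  by move=> w; have := fro_pair_erase t u v0 (Z w) jk; rewrite mulrAC.
rewrite ExD; [|apply: L1Z; exact: L1_fro|apply: L1Z; exact: lrho].
rewrite (ExZ _ L1_fro) (ExZ _ lrho).
rewrite lerD2l; apply: le_trans (ler_wpM2l c0 Erho) _.
by have -> : 256 / v ^+ 3 * (2 * t) = 512 * t / v ^+ 3 by ring.
Qed.

Let mmin : measurable_fun setT (fun w => Num.min (2 / v) (8 * rho w / v ^+ 2)).
Proof.
apply: measurable_minr => //; apply: measurable_funM => //.
by apply: measurable_funM => //; exact: (L1_measurable lrho).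
Qed.

Let min_bnd w : `|Num.min (2 / v) (8 * rho w / v ^+ 2)| <= 2 / v.
Proof.
rewrite ger0_norm ?ge_min ?lexx// le_min divr_ge0 ?(ltW v0)//=.
by rewrite divr_ge0 ?exprn_ge0 ?(ltW v0)// mulr_ge0// rhoE mulr_ge0 ?qnorm_ge0// ltW.
Qed.

Let lrem : L1 P (fun w => rho w ^+ 2 * Num.min (2 / v) (8 * rho w / v ^+ 2)).
Proof. by apply: (@L1M _ _ _ _ (2 / v)). Qed.

Let llind : L1 P (fun w => qnorm (Y p w) ^+ 2 * (eta * Num.sqrt n%:R <= qnorm (Y p w))%R%:R).
Proof. exact: L1_cutoff (L2Y pA) (mN p). Qed.

(** Lindeberg's splitting at [qnorm] = eta sqrt n. Above the threshold the minimum is at most 2 / v,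
    which leaves the Lindeberg term; below it rho < eta, and the minimum is at most 8 eta / v^2. *)
Let Erem : Ex P (fun w => rho w ^+ 2 * Num.min (2 / v) (8 * rho w / v ^+ 2)) <=
  n%:R^-1 * (8 * eta / v ^+ 2 + 2 / v * lindeberg_term).
Proof.
apply: (@le_trans _ _ (Ex P (fun w => 8 * eta / v ^+ 2 * rho w ^+ 2 +
    2 / v * n%:R^-1 * (qnorm (Y p w) ^+ 2 * (eta * Num.sqrt n%:R <= qnorm (Y p w))%R%:R)))).
  apply: Ex_le; [exact: lrem|by apply: L1D; apply: L1Z; [exact: lrho2|exact: llind]|].
  move=> w; have r0 : 0 <= rho w by rewrite rhoE mulr_ge0 ?qnorm_ge0// ltW.
  have v2 : 0 < (v ^+ 2)^-1 by rewrite invr_gt0 exprn_gt0.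
  have [h|h] := leP (eta * Num.sqrt n%:R) (qnorm (Y p w)).
    have e : n%:R^-1 * (qnorm (Y p w) ^+ 2 * 1) = rho w ^+ 2.
      by rewrite mulr1 rhoE exprMn t2.
    rewrite -[2 / v * _ * _]mulrA e.
    apply: (@le_trans _ _ (2 / v * rho w ^+ 2)).
      by rewrite mulrC ler_wpM2r ?sqr_ge0// ge_min lexx.
    by rewrite lerDr mulr_ge0 ?sqr_ge0// divr_ge0 ?mulr_ge0 ?exprn_ge0 ?ler0n// ltW.
  rewrite !mulr0 addr0 [leRHS]mulrC; apply: ler_wpM2l; first exact: sqr_ge0.
  rewrite ge_min; apply/orP; right; apply: ler_wpM2r; first exact: ltW.
  apply: ler_wpM2l; first exact: ler0n.
  by rewrite rhoE mulrC /t ler_pdivrMr ?sqrtr_gt0//; exact: ltW.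
rewrite ExD; [|apply: L1Z; exact: lrho2|apply: L1Z; exact: llind].
rewrite (ExZ _ lrho2) (ExZ _ llind) Erho2 -/lindeberg_term.
have comb (a b c m : R) : a * m + b * m * c = m * (a + b * c) by ring.
by rewrite comb.
Qed.

Lemma pair_trace_expectation :
  cL1 P (fun w => pair_trace t u v (Z w) j k) /\
  nm (cEx P (fun w => pair_trace t u v (Z w) j k + 4 / n%:R * g (Z w))) <=
  n%:R^-1 * (16 * Ex P (fun w => F (Z w)) + 4352 * t / v ^+ 3 +
             1024 * eta / v ^+ 3 + 256 / v ^+ 2 * lindeberg_term).
Proof.
pose b w := 4 * (rho w ^+ 2 * F (erase p (Z w))) +
  64 / v * (rho w ^+ 2 * Num.min (2 / v) (8 * rho w / v ^+ 2)).
have lb : L1 P b by apply: L1D; apply: L1Z; [exact: lrho2F|exact: lrem].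
(* [a] is the quantity bounded by [pair_expansion]. Its linear part has mean zero, and its quadratic
   part has mean 4 / n times that of the erased product; in expectation only [a] and the effect [dg]
   of erasing remain. *)
pose a w := pair_trace t u v (Z w) j k - lin w + (4 * rho w ^+ 2)%:C * g (erase p (Z w)).
have ab w : nm (a w) <= b w.
  rewrite /b [4 * (_ * _)]mulrA; exact: (pair_expansion t u v0 (Z w) jk).
have ma : cmeas a.
  apply: cmeasD; last first.
    apply: cmeasM => //; split => /=; last exact: measurable_cst.
    by apply: measurable_funM => //; exact: (L1_measurable lrho2).
  apply: cmeasB; first exact: cmeas_pair_trace.
  apply: cmeas_sum => i; apply: cmeasM; last exact: (cmeas_psi t u v0 mEZ).
  split => /=; last exact: measurable_cst.
  by apply: measurable_funM => //; exact: (measurableT_comp (mqc i) (mY p)).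
have la : cL1 P a by exact: cL1_le ab lb.
have ptE w : pair_trace t u v (Z w) j k = a w + (lin w - (4 * rho w ^+ 2)%:C * g (erase p (Z w))).
  by rewrite /a; ring.
have lpt : cL1 P (fun w => pair_trace t u v (Z w) j k).
  by rewrite (funext ptE); apply: cL1D => //; exact: cL1B.
split => //.
pose dg w := g (erase p (Z w)) - g (Z w).
have ldg : cL1 P dg by exact: cL1B.
have e4 : (4 / n%:R)%:C = 4 / n%:R :> C by rewrite rmorphM fmorphV !rmorph_nat.
have -> : cEx P (fun w => pair_trace t u v (Z w) j k + 4 / n%:R * g (Z w)) =
    cEx P a - (4 / n%:R)%:C * cEx P dg.
  have h1 : cEx P (fun w => pair_trace t u v (Z w) j k + 4 / n%:R * g (Z w)) =
      cEx P (fun w => pair_trace t u v (Z w) j k) + 4 / n%:R * cEx P (fun w => g (Z w)).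
    by rewrite (cExD lpt (cL1Z _ lg)) (cExZ _ lg).
  have h2 : cEx P (fun w => pair_trace t u v (Z w) j k) = cEx P a +
      (cEx P lin - cEx P (fun w => (4 * rho w ^+ 2)%:C * g (erase p (Z w)))).
    by rewrite (funext ptE) (cExD la (cL1B llin lquad)) (cExB llin lquad).
  have h3 : cEx P dg = cEx P (fun w => g (erase p (Z w))) - cEx P (fun w => g (Z w)).
    exact: cExB lg' lg.
  rewrite h1 h2 h3 Elin Equad e4.
  have comb (x y y' c : C) : x + (0 - c * y') + c * y = x - c * (y' - y) by ring.
  exact: comb.
apply: le_trans (nmB _ _) _.
have Ea : nm (cEx P a) <= 2 * (4 * (n%:R^-1 * (2 * Ex P (fun w => F (Z w)) + 512 * t / v ^+ 3)) +
    64 / v * (n%:R^-1 * (8 * eta / v ^+ 2 + 2 / v * lindeberg_term))).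
  apply: le_trans (cEx_le la ab lb) _; rewrite ler_pM2l//.
  rewrite ExD; [|apply: L1Z; exact: lrho2F|apply: L1Z; exact: lrem].
  rewrite (ExZ _ lrho2F) (ExZ _ lrem).
  by apply: lerD; apply: ler_wpM2l; rewrite ?divr_ge0 ?ler0n ?(ltW v0).
have Edg : nm ((4 / n%:R)%:C * cEx P dg) <= 4 / n%:R * (2 * (16 / v ^+ 3 * (2 * t))).
  rewrite nmM nm_real ger0_norm ?divr_ge0 ?ler0n//.
  apply: ler_wpM2l; first by rewrite divr_ge0 ?ler0n.
  apply: (@le_trans _ _ (2 * Ex P (fun w => 16 / v ^+ 3 * rho w))).
    apply: cEx_le; [exact: ldg| |apply: L1Z; exact: lrho].
    by move=> w; have := gam_mul_erase t u v0 (Z w) jk; rewrite mulrAC.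
  apply: ler_wpM2l; first by rewrite ler0n.
  rewrite (ExZ _ lrho); apply: ler_wpM2l => //.
  by rewrite divr_ge0 ?ler0n ?exprn_ge0 ?(ltW v0).
(* The coefficient of s is 4352 = 2 * 4 * 512 + 4 * 2 * 16 * 2: the first part restores the
   Frobenius norms, the second the products of the [gam]. *)
have comb (m s q h f l : R) : 2 * (4 * (m * (2 * f + 512 * s * q ^+ 3)) +
    64 * q * (m * (8 * h * q ^+ 2 + 2 * q * l))) + 4 * m * (2 * (16 * q ^+ 3 * (2 * s))) =
  m * (16 * f + 4352 * s * q ^+ 3 + 1024 * h * q ^+ 3 + 256 * q ^+ 2 * l) by ring.
by apply: le_trans (lerD Ea Edg) _; rewrite -!exprVn comb.
Qed.

End pair.
End one_size.

(** * Deterministic bounds on the normalized trace *)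

Section stieltjes_bounds.
Variables (R : realType) (n : nat) (t u v : R).
Hypotheses (n0 : (0 < n)%N) (v0 : 0 < v).
Implicit Types (e : 'I_n * 'I_n -> quat R).
Local Notation N := (\sum_(i < n) 2)%N.

Let nn0 : 0 < n%:R :> R. Proof. by rewrite ltr0n. Qed.

Lemma sum_two : N%:R = 2 * n%:R :> R.
Proof. by rewrite sum_nat_const card_ord natrM mulrC. Qed.

Lemma stieltjes_le e : nm (stieltjes t u v e) <= v^-1.
Proof.
rewrite /stieltjes nmM nmV nm_nat mulrC ler_pdivrMr//.
apply: le_trans (nm_sum _ _ _) _; rewrite mulr_natr -[n in leRHS]card_ord -sumr_const.
by apply: ler_sum => j _; exact: gam_le.
Qed.

Lemma stieltjes_mxtrace e : stieltjes t u v e = (2 * n%:R)^-1 * \tr (green t u v e).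
Proof.
rewrite mxtrace_green// /stieltjes; field.
by rewrite pnatr_eq0 -lt0n.
Qed.

Lemma qherm_ext e e' : (forall p : 'I_n * 'I_n, (p.1 <= p.2)%N -> e p = e' p) -> qherm e = qherm e'.
Proof.
move=> ee'; apply/matrixP => j k; rewrite !mxE.
by case: ltngtP => jk; rewrite ee'//= ltnW.
Qed.

Lemma stieltjes_ext e e' : (forall p : 'I_n * 'I_n, (p.1 <= p.2)%N -> e p = e' p) ->
  stieltjes t u v e = stieltjes t u v e'.
Proof.
by move=> ee'; rewrite /stieltjes /gam /green /wig (qherm_ext ee').
Qed.

(** Entries with first index [r] occur only in row and column [r] of the matrix, so the change has
    complex rank at most 4. The trace moves by at most 4 * (2 / v), and dividing by 2n gives the
    constant. *)
Lemma stieltjes_row r e e' : (forall p : 'I_n * 'I_n, p.1 != r :> nat -> e p = e' p) ->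
  nm (stieltjes t u v e - stieltjes t u v e') <= 4 / v / n%:R.
Proof.
move=> ee'; have [rn|rn] := ltnP r n; last first.
  have -> : stieltjes t u v e = stieltjes t u v e'.
    apply: stieltjes_ext => p _; apply: ee'; apply/negP => /eqP pr.
    by have := ltn_ord p.1; rewrite pr ltnNge rn.
  by rewrite subrr Normc.normc0 !divr_ge0// ltW.
rewrite !stieltjes_mxtrace -mulrBr nmM nmV nmM !nm_nat.
have : nm (\tr (green t u v e) - \tr (green t u v e')) <= 4 * (2 / v).
  rewrite -nm_lec; apply: le_trans (mxtrace_resolvent_sub u v0 (wig_herm t e) (wig_herm t e')) _.
  rewrite lecR; apply: ler_wpM2r; first by rewrite divr_ge0// ltW.
  rewrite ler_nat; apply: (@rank_row_col _ _ _ (Ordinal rn)) => a b ar br.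
  rewrite blkB !blk_wig (_ : qherm e a b = qherm e' a b) ?subrr// !mxE.
  by case: ltngtP => ab; rewrite ee'//= -(inj_eq val_inj).
move: (nm _) => x xle; rewrite mulrC ler_pdivrMr ?mulr_gt0//.
apply: le_trans xle _; rewrite [leRHS]mulrCA mulrA divfK ?gt_eqF//.
by rewrite mulrCA mulrA.
Qed.

End stieltjes_bounds.

Section one_size.
Context d (T : measurableType d) (R : realType) (P : probability T R).
Local Notation C := R[i].
Variables (n : nat) (u v : R) (Y : 'I_n * 'I_n -> T -> quat R) (M : R).
Hypotheses (n0 : (0 < n)%N) (v0 : 0 < v).
Let A : {set 'I_n * 'I_n} := [set p : 'I_n * 'I_n | (p.1 <= p.2)%N]%SET.
Hypothesis mY : forall p, measurable_fun setT (Y p).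
Hypothesis indepY : mutually_independent P A Y.

Let Z w : 'I_n * 'I_n -> quat R := fun p => Y p w.
Let t : R := (Num.sqrt n%:R)^-1.
Let nn0 : 0 < n%:R :> R. Proof. by rewrite ltr0n. Qed.
Let z : C := u +i* v.

(** The constant of [fourth_moment_bounded_differences] for c = 4 / v, the oscillation given by
    [stieltjes_row]. *)
Definition kappa : R := 512 * expR ((4 / v) ^+ 2 * expR (4 / v)).

Definition mean_stieltjes : C := cEx P (fun w => stieltjes t u v (Z w)).

Let mZ (p : 'I_n * 'I_n) : (p.1 <= p.2)%N -> measurable_fun setT (fun w => Z w p).
Proof. by move=> _; exact: mY. Qed.

Let ms : cmeas (fun w => stieltjes t u v (Z w)).
Proof. exact: (cmeas_stieltjes t u v0 mZ). Qed.

Let ls : cL1 P (fun w => stieltjes t u v (Z w)).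
Proof. by apply: (@cL1_bounded _ _ _ _ v^-1); [exact: ms|move=> w; exact: stieltjes_le]. Qed.

Let msA : cmeas (fun e : box_space (quat R) A => stieltjes t u v e).
Proof.
by apply: (cmeas_stieltjes t u v0) => p hp; apply: measurable_coord; rewrite inE.
Qed.

Section part.
Variable part : C -> R.
Hypothesis part_le : forall x, `|part x| <= nm x.
Hypothesis partB : forall x y, part (x - y) = part x - part y.
Hypothesis mpart : measurable_fun setT (fun e : box_space (quat R) A => part (stieltjes t u v e)).

Lemma fourth_moment_part :
  Ex P (fun w => (part (stieltjes t u v (Z w)) -
    Ex P (fun w => part (stieltjes t u v (Z w)))) ^+ 4) <= kappa / n%:R ^+ 2.
Proof.
apply: (@fourth_moment_bounded_differences _ _ T (quat R) R P _ A Y _ indepY n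
  (fun p => p.1) v^-1 (4 / v) (fun e => part (stieltjes t u v e))).
- by move=> p _; exact: mY.
- exact: n0.
- by rewrite divr_ge0 ?ler0n ?(ltW v0).
- by move=> p _; exact: ltn_ord.
- exact: mpart.
- by move=> e; apply: le_trans (part_le _) _; exact: stieltjes_le.
- by move=> e e' ee'; rewrite (@stieltjes_ext _ _ _ _ _ e e')// => p hp; apply: ee'; rewrite inE.
- move=> r e e' ee'; rewrite -partB; apply: le_trans (part_le _) _.
  exact: (stieltjes_row t u n0 v0 ee').
Qed.

Let L1_part : L1 P (fun w => part (stieltjes t u v (Z w))).
Proof.
apply: (@L1_bounded _ _ _ _ v^-1).
  apply: (measurableT_comp mpart (measurable_process (A := A) (B := A) _ (subxx _))).
  by move=> p _; exact: mY.
by move=> w; apply: le_trans (part_le _) _; exact: stieltjes_le.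
Qed.

(** Derived from the fourth moment: x <= 1 / n + n x^2 for x >= 0, since n (x - 1 / n)^2 >= 0,
    applied to the squared deviation. *)
Lemma variance_part :
  Ex P (fun w => (part (stieltjes t u v (Z w)) -
    Ex P (fun w => part (stieltjes t u v (Z w)))) ^+ 2) <= (1 + kappa) / n%:R.
Proof.
set m := Ex P (fun w => part (stieltjes t u v (Z w))).
pose h w := part (stieltjes t u v (Z w)) - m.
have lh : L1 P h by apply: L1B; [exact: L1_part|exact: L1_cst].
have hK w : `|h w| <= v^-1 + v^-1.
  apply: le_trans (ler_normB _ _) _; apply: lerD.
    by apply: le_trans (part_le _) _; exact: stieltjes_le.
  apply: Ex_norm_le; first exact: L1_part.
  by move=> w'; apply: le_trans (part_le _) _; exact: stieltjes_le.
have lX i : L1 P (fun w => h w ^+ i).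
  apply: (@L1_bounded _ _ _ _ ((v^-1 + v^-1) ^+ i)).
    by apply: measurable_funX; exact: (L1_measurable lh).
  by move=> w; rewrite normrX lerXn2r// nnegrE// (le_trans _ (hK w)).
have h4 := fourth_moment_part; rewrite -/m in h4.
apply: (@le_trans _ _ (Ex P (fun w => n%:R^-1 + n%:R * h w ^+ 4))).
  apply: Ex_le; [exact: lX|by apply: L1D; [exact: L1_cst|exact: L1Z]|].
  move=> w; rewrite -/(h w); have -> : h w ^+ 4 = (h w ^+ 2) ^+ 2 by rewrite -exprM.
  move: (h w ^+ 2) (sqr_ge0 (h w)) => x x0.
  have e1 : n%:R * n%:R^-1 = 1 :> R by rewrite divff ?gt_eqF.
  have : 0 <= n%:R * (x - n%:R^-1) ^+ 2 by rewrite mulr_ge0 ?sqr_ge0 ?ltW.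
  have -> : n%:R * (x - n%:R^-1) ^+ 2 = n%:R * x ^+ 2 - 2 * (n%:R * n%:R^-1) * x +
      n%:R * n%:R^-1 * n%:R^-1 by ring.
  by rewrite e1 mulr1 mul1r => h0; lra.
rewrite ExD; [|exact: L1_cst|apply: L1Z; exact: lX].
rewrite (Ex_cst P n%:R^-1) ExZ; last exact: lX.
rewrite mulrDl mul1r lerD2l.
have -> : kappa / n%:R = n%:R * (kappa / n%:R ^+ 2) by field; rewrite gt_eqF.
by apply: ler_wpM2l; [exact: ltW|exact: h4].
Qed.

End part.

Lemma fourth_moment_Im :
  Ex P (fun w => (complex.Im (stieltjes t u v (Z w)) - complex.Im mean_stieltjes) ^+ 4) <=
  kappa / n%:R ^+ 2.
Proof.
have [_ m2] := msA; apply: (fourth_moment_part (part := @complex.Im R)) => //.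
- exact: nm_Im.
- by move=> x y; rewrite cImD cImN.
Qed.

(** The difference is the mean of the complex square (s - m)^2, bounded by twice the sum of the
    variances of the two parts. It turns the equation for the mean of s^2 into an equation for the
    mean of s. *)
Lemma mean_sqr_stieltjes :
  nm (cEx P (fun w => stieltjes t u v (Z w) ^+ 2) - mean_stieltjes ^+ 2) <=
  4 * (1 + kappa) / n%:R.
Proof.
have [m1 m2] := msA.
have vRe := variance_part (@nm_Re R) (fun x y => etrans (cReD _ _) (congr1 _ (cReN y))) m1.
have vIm := variance_part (@nm_Im R) (fun x y => etrans (cImD _ _) (congr1 _ (cImN y))) m2.
set m := mean_stieltjes.
have lm : cL1 P (fun w => stieltjes t u v (Z w) - m) by apply: cL1B; [exact: ls|exact: cL1_cst].
have bnd w : nm (stieltjes t u v (Z w) - m) <= v^-1 + nm m.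
  by apply: le_trans (nmB _ _) _; rewrite lerD2r; exact: stieltjes_le.
have ls2 : cL1 P (fun w => stieltjes t u v (Z w) ^+ 2).
  apply: (@cL1_bounded _ _ _ _ (v^-1 * v^-1)); first by apply: cmeasM; exact: ms.
  by move=> w; rewrite expr2 nmM; apply: ler_pM; rewrite ?nm_ge0//; exact: stieltjes_le.
have mm : cmeas (fun w => stieltjes t u v (Z w) - m) by apply: cmeasB; [exact: ms|exact: cmeas_cst].
have lm2 : cL1 P (fun w => (stieltjes t u v (Z w) - m) ^+ 2).
  apply: (@cL1_bounded _ _ _ _ ((v^-1 + nm m) * (v^-1 + nm m))).
    by apply: cmeasM; exact: mm.
  by move=> w; rewrite expr2 nmM; apply: ler_pM; rewrite ?nm_ge0//; exact: bnd.
have -> : cEx P (fun w => stieltjes t u v (Z w) ^+ 2) - m ^+ 2 =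
    cEx P (fun w => (stieltjes t u v (Z w) - m) ^+ 2).
  have -> : (fun w => stieltjes t u v (Z w) ^+ 2) =
      (fun w => (stieltjes t u v (Z w) - m) ^+ 2 + (2 * m * stieltjes t u v (Z w) - m ^+ 2)).
    by apply/funext => w; ring.
  rewrite (cExD lm2 (cL1B (cL1Z _ ls) (cL1_cst P (m ^+ 2)))).
  rewrite (cExB (cL1Z _ ls) (cL1_cst P (m ^+ 2))) (cExZ _ ls) (cEx_cst P (m ^+ 2)).
  rewrite -/mean_stieltjes -/m.
  have comb (x y : C) : x + (2 * y * y - y ^+ 2) - y ^+ 2 = x by ring.
  exact: comb.
have lq : L1 P (fun w => nm (stieltjes t u v (Z w) - m) ^+ 2).
  apply: (@L1_bounded _ _ _ _ ((v^-1 + nm m) ^+ 2)); first exact: measurable_nm_sqr.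
  move=> w; rewrite ger0_norm ?sqr_ge0// lerXn2r ?nnegrE ?nm_ge0//.
  by rewrite (le_trans (nm_ge0 _) (bnd w)).
apply: (@le_trans _ _ (2 * Ex P (fun w => nm (stieltjes t u v (Z w) - m) ^+ 2))).
  by apply: cEx_le; [exact: lm2| |exact: lq] => w; rewrite expr2 nmM.
have e w : nm (stieltjes t u v (Z w) - m) ^+ 2 =
    (complex.Re (stieltjes t u v (Z w)) - complex.Re m) ^+ 2 +
    (complex.Im (stieltjes t u v (Z w)) - complex.Im m) ^+ 2.
  by rewrite nm_sqr cReD cReN cImD cImN.
have [lmR lmI] := lm.
have lR : L1 P (fun w => (complex.Re (stieltjes t u v (Z w)) - complex.Re m) ^+ 2).
  apply: L1_le lq.
    apply: measurable_funX; apply: measurable_funB => //; first by have [] := ms.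
  by move=> w; rewrite ger0_norm ?sqr_ge0// e lerDl sqr_ge0.
have lI : L1 P (fun w => (complex.Im (stieltjes t u v (Z w)) - complex.Im m) ^+ 2).
  apply: L1_le lq.
    apply: measurable_funX; apply: measurable_funB => //; first by have [] := ms.
  by move=> w; rewrite ger0_norm ?sqr_ge0// e lerDr sqr_ge0.
rewrite (funext e) (ExD lR lI).
have -> : 4 * (1 + kappa) / n%:R = 2 * ((1 + kappa) / n%:R + (1 + kappa) / n%:R).
  by move: (kappa) n%:R^-1 => a b; ring.
by apply: ler_wpM2l; [exact: ler0n|apply: lerD; [exact: vRe|exact: vIm]].
Qed.

Hypothesis L2Y : forall p, p \in A -> L1 P (fun w => qnorm (Y p w) ^+ 2).
Hypothesis EY0 : forall j k : 'I_n, (j < k)%N -> forall i,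
  Ex P (fun w => qcoord i (Y (j, k) w)) = 0.
Hypothesis EY1 : forall j k : 'I_n, (j < k)%N ->
  Ex P (fun w => qnorm (Y (j, k) w) ^+ 2) = 1.
Hypothesis EYM : forall j : 'I_n, Ex P (fun w => qnorm (Y (j, j) w) ^+ 2) <= M.

Definition lindeberg_sum (eta : R) : R :=
  \sum_(j < n) \sum_(k < n | (j < k)%N) lindeberg_term P Y j k eta.

Let dterm (e : 'I_n * 'I_n -> quat R) j : C := diag_trace t u v e j + 2 / n%:R * gam t u v e j ^+ 2.

(** Each diagonal term has size O(1 / sqrt n), since the mean norm of a diagonal entry is at most 1
    + M. There are n of them, and the sum is divided by 2n. *)
Let ldterm j : cL1 P (fun w => dterm (Z w) j) /\
  nm (cEx P (fun w => dterm (Z w) j)) <= 8 / v * t * (1 + M) + 4 / v ^+ 2 / n%:R.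
Proof.
have t0 : 0 <= t by rewrite invr_ge0 sqrtr_ge0.
have jjA : (j, j) \in A by rewrite inE /=.
have lq := L1_qnorm mY L2Y jjA.
pose b w := 4 / v * (t * qnorm (Y (j, j) w)) + 2 / v ^+ 2 / n%:R.
have lb : L1 P b by apply: L1D; [do 2![apply: L1Z]; exact: lq|exact: L1_cst].
have db w : nm (dterm (Z w) j) <= b w.
  apply: le_trans (nmD _ _) _; apply: lerD.
    apply: le_trans (diag_trace_le _ _ _ _ _) _ => //.
    by rewrite /weight ger0_norm.
  have -> : 2 / v ^+ 2 / n%:R = 2 / n%:R * (v^-1 * v^-1).
    by rewrite -exprVn; move: v^-1 n%:R^-1 => a c; ring.
  rewrite nmM [X in X * _ <= _]nmM nmV !nm_nat expr2 nmM.
  apply: ler_wpM2l; first by rewrite divr_ge0 ?ler0n.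
  by apply: ler_pM; rewrite ?nm_ge0//; exact: gam_le.
have mdt : cmeas (fun w => dterm (Z w) j).
  apply: cmeasD; first exact: (cmeas_diag_trace t u v0 mZ).
  apply: cmeasM; first exact: cmeas_cst.
  by apply: cmeasM; exact: (cmeas_gam t u v0 mZ).
have ld : cL1 P (fun w => dterm (Z w) j) by exact: cL1_le mdt db lb.
split => //; apply: le_trans (cEx_le ld db lb) _.
rewrite ExD; [|do 2![apply: L1Z]; exact: lq|exact: L1_cst].
rewrite (Ex_cst P (2 / v ^+ 2 / n%:R)) (ExZ _ (L1Z t lq)) (ExZ _ lq).
have hM := Ex_qnorm_le mY L2Y jjA (EYM j).
apply: (@le_trans _ _ (2 * (4 / v * (t * (1 + M)) + 2 / v ^+ 2 / n%:R))).
  apply: ler_wpM2l; first exact: ler0n.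
  by rewrite lerD2r; apply: ler_wpM2l; [rewrite divr_ge0 ?ler0n ?(ltW v0)|exact: ler_wpM2l].
have comb (a p c m : R) : 2 * (4 * a * (t * m) + 2 * p * c) = 8 * a * t * m + 4 * p * c by ring.
by rewrite comb.
Qed.

Let pterm (e : 'I_n * 'I_n -> quat R) j k : C := pair_trace t u v e j k + 4 / n%:R * (gam t u v e j * gam t u v e k).

Let lpterm (j k : 'I_n) : (j < k)%N -> cL1 P (fun w => pterm (Z w) j k).
Proof.
move=> jk; have [lp _] := pair_trace_expectation u n0 v0 mY indepY L2Y EY0 EY1 jk ltr01.
apply: cL1D => //; apply: cL1Z; apply: (@cL1_bounded _ _ _ _ (v^-1 * v^-1)).
  by apply: cmeasM; exact: (cmeas_gam t u v0 mZ).
by move=> w; rewrite nmM; apply: ler_pM; rewrite ?nm_ge0//; exact: gam_le.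
Qed.

(** Pointwise, the sum is part of the squared Frobenius norm of the whole resolvent: about n^2 pairs
    share a total of order n. *)
Let sum_Ex_fro :
  \sum_(j < n) \sum_(k < n | (j < k)%N) Ex P (fun w => fro_pair t u v (Z w) j k) <=
  2 * n%:R / v ^+ 2.
Proof.
have lf j k : L1 P (fun w => fro_pair t u v (Z w) j k) by exact: L1_fro.
under eq_bigr do rewrite -Ex_sum//.
rewrite -Ex_sum; last by move=> j _; exact: L1_sum.
rewrite -(Ex_cst P (2 * n%:R / v ^+ 2)); apply: Ex_le; [|exact: L1_cst|].
  by apply: L1_sum => j _; exact: L1_sum.
move=> w; rewrite -(sum_two R n); apply: le_trans (sum_fro_pair t u v0 (Z w)).
rewrite [leRHS](sum_sum_split (fun j k => fro2 (blk (green t u v (Z w)) j k))).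
rewrite -[leLHS]add0r; apply: lerD.
  by apply: sumr_ge0 => j _; exact: fro2_ge0.
apply: ler_sum => j _; apply: ler_sum => k _.
by rewrite /fro_pair addrC.
Qed.

Let sum_pairs_le (B : R) : 0 <= B ->
  \sum_(j < n) \sum_(k < n | (j < k)%N) B <= n%:R ^+ 2 * B.
Proof.
move=> B0; apply: (@le_trans _ _ (\sum_(j < n) \sum_(k < n) B)).
  by apply: ler_sum => j _; rewrite [leRHS](bigID (fun k : 'I_n => (j < k)%N))/= lerDl sumr_ge0.
by rewrite !sumr_const card_ord -mulrnA -[leLHS]mulr_natl natrM expr2.
Qed.

(** For fixed [eta] all terms but 512 / v^3 eta vanish as n grows, the last by Lindeberg's
    condition; [eta] is chosen small beforehand. The 18 is 2 from the diagonal plus 16 from the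
    off-diagonal blocks. *)
Lemma expectation_equation (eta : R) : 0 < eta ->
  nm (z * mean_stieltjes + 1 + cEx P (fun w => stieltjes t u v (Z w) ^+ 2)) <=
  18 / v ^+ 2 / n%:R + 4 / v * t * (1 + M) + 2176 / v ^+ 3 * t + 512 / v ^+ 3 * eta +
  128 / v ^+ 2 * ((n%:R ^+ 2)^-1 * lindeberg_sum eta).
Proof.
move=> eta0.
have t0 : 0 <= t by rewrite invr_ge0 sqrtr_ge0.
have ls2 : cL1 P (fun w => stieltjes t u v (Z w) ^+ 2).
  apply: (@cL1_bounded _ _ _ _ (v^-1 * v^-1)); first by apply: cmeasM; exact: ms.
  by move=> w; rewrite expr2 nmM; apply: ler_pM; rewrite ?nm_ge0//; exact: stieltjes_le.
have lsumd : cL1 P (fun w => \sum_j dterm (Z w) j).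
  by apply: cL1_sum => j _; have [] := ldterm j.
have lsump1 (j : 'I_n) : cL1 P (fun w => \sum_(k < n | (j < k)%N) pterm (Z w) j k).
  by apply: cL1_sum => k; exact: lpterm.
have lsump : cL1 P (fun w => \sum_(j < n) \sum_(k < n | (j < k)%N) pterm (Z w) j k).
  by apply: cL1_sum => j _; exact: lsump1.
have -> : z * mean_stieltjes + 1 + cEx P (fun w => stieltjes t u v (Z w) ^+ 2) =
    (2 * n%:R)^-1 * (\sum_j cEx P (fun w => dterm (Z w) j) +
      \sum_(j < n) \sum_(k < n | (j < k)%N) cEx P (fun w => pterm (Z w) j k)).
  transitivity (cEx P (fun w => (2 * n%:R)^-1 * (\sum_j dterm (Z w) j +
      \sum_(j < n) \sum_(k < n | (j < k)%N) pterm (Z w) j k))).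
    transitivity (cEx P (fun w => z * stieltjes t u v (Z w) + 1 + stieltjes t u v (Z w) ^+ 2)).
      rewrite (cExD (cL1D (cL1Z z ls) (cL1_cst P 1)) ls2) (cExD (cL1Z z ls) (cL1_cst P 1)).
      by rewrite (cExZ _ ls) (cEx_cst P 1).
    congr cEx; apply/funext => w; exact: (stieltjes_equation t u v0 (Z w) n0).
  rewrite (cExZ _ (cL1D lsumd lsump)) (cExD lsumd lsump); congr (_ * (_ + _)).
    by apply: cEx_sum => j _; have [] := ldterm j.
  transitivity (\sum_(j < n) cEx P (fun w => \sum_(k < n | (j < k)%N) pterm (Z w) j k)).
    by apply: cEx_sum => j _; exact: lsump1.
  by apply: eq_bigr => j _; apply: cEx_sum => k; exact: lpterm.
rewrite nmM nmV nmM !nm_nat.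
set Bd := 8 / v * t * (1 + M) + 4 / v ^+ 2 / n%:R.
have [B BE] : {B : R | B = 4352 * t / v ^+ 3 + 1024 * eta / v ^+ 3} by eexists.
have v30 : 0 <= v ^+ 3 by rewrite exprn_ge0// ltW.
have B0 : 0 <= B.
  rewrite BE; apply: addr_ge0; (apply: divr_ge0; [apply: mulr_ge0|exact: v30]); try exact: ler0n.
    exact: t0.
  exact: ltW.
have hd : nm (\sum_j cEx P (fun w => dterm (Z w) j)) <= n%:R * Bd.
  apply: le_trans (nm_sum _ _ _) _; rewrite mulr_natl -[n in leRHS]card_ord -sumr_const.
  by apply: ler_sum => j _; have [] := ldterm j.
have hp : nm (\sum_(j < n) \sum_(k < n | (j < k)%N) cEx P (fun w => pterm (Z w) j k)) <=
    n%:R^-1 * (16 * (2 * n%:R / v ^+ 2) + n%:R ^+ 2 * B + 256 / v ^+ 2 * lindeberg_sum eta).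
  apply: le_trans (nm_sum _ _ _) _.
  apply: (@le_trans _ _ (\sum_(j < n) \sum_(k < n | (j < k)%N) n%:R^-1 *
      (16 * Ex P (fun w => fro_pair t u v (Z w) j k) + B +
       256 / v ^+ 2 * lindeberg_term P Y j k eta))).
    apply: ler_sum => j _; apply: le_trans (nm_sum _ _ _) _; apply: ler_sum => k jk.
    have [_] := pair_trace_expectation u n0 v0 mY indepY L2Y EY0 EY1 jk eta0.
    by rewrite BE addrA.
  under eq_bigr do rewrite -mulr_sumr !big_split/= -!mulr_sumr.
  rewrite -mulr_sumr !big_split/= -!mulr_sumr; apply: ler_wpM2l; first by rewrite invr_ge0.
  rewrite lerD2r; apply: lerD; last exact: sum_pairs_le.
  by apply: ler_wpM2l; [exact: ler0n|exact: sum_Ex_fro].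
have n20 : 0 <= (2 * n%:R)^-1 :> R by rewrite invr_ge0 mulr_ge0 ?ler0n.
apply: le_trans (ler_wpM2l n20 (le_trans (nmD _ _) (lerD hd hp))) _.
rewrite /Bd BE -!exprVn invfM; move: (lindeberg_sum eta) => l.
have e1 : n%:R * n%:R^-1 = 1 :> R by rewrite divff ?gt_eqF.
have comb (a b c m : R) : a * b = 1 -> 2^-1 * b * (a * (8 * c * t * (1 + m) + 4 * c ^+ 2 * b) +
   b * (16 * (2 * a * c ^+ 2) + a ^+ 2 * (4352 * t * c ^+ 3 + 1024 * eta * c ^+ 3) +
     256 * c ^+ 2 * l)) = 18 * c ^+ 2 * b + 4 * c * t * (1 + m) + 2176 * c ^+ 3 * t +
   512 * c ^+ 3 * eta + 128 * c ^+ 2 * (b ^+ 2 * l).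
  move=> ab; have -> : 2^-1 * b * (a * (8 * c * t * (1 + m) + 4 * c ^+ 2 * b) +
   b * (16 * (2 * a * c ^+ 2) + a ^+ 2 * (4352 * t * c ^+ 3 + 1024 * eta * c ^+ 3) +
     256 * c ^+ 2 * l)) = (a * b) * (4 * c * t * (1 + m) + 2 * c ^+ 2 * b) +
     (a * b) * (16 * c ^+ 2 * b) + (a * b) * ((a * b) * (2176 * t * c ^+ 3 + 512 * eta * c ^+ 3)) +
     128 * c ^+ 2 * (b ^+ 2 * l) by field.
  rewrite ab; ring.
by rewrite (comb _ _ _ _ e1).
Qed.

End one_size.

(** * The semicircle law *)

Section semicircle.
Variable R : realType.
Implicit Types x : R.
Local Notation mu := (@lebesgue_measure R).

(** [Num.sqrt] is zero on negative numbers, which makes the case distinction automatic. *)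
Lemma semicircle_pdfE x : semicircle_pdf x = (2 * pi)^-1 * Num.sqrt (4 - x ^+ 2).
Proof.
rewrite /semicircle_pdf; case: ifPn => // h.
rewrite ler0_sqrtr ?mulr0//; move: h; rewrite negb_and -!ltNge => /orP[h|h]; nra.
Qed.

Lemma continuous_semicircle_pdf : continuous (@semicircle_pdf R).
Proof.
rewrite (funext semicircle_pdfE) => x; apply: cvgM; first exact: cvg_cst.
apply: (continuous_comp (f := fun y : R => 4 - y ^+ 2) (g := Num.sqrt)).
  by apply: cvgB; [exact: cvg_cst|exact: exprn_continuous].
exact: sqrt_continuous.
Qed.

Lemma semicircle_pdf0 x : 2 <= `|x| -> semicircle_pdf x = 0.
Proof.
move=> h; rewrite semicircle_pdfE ler0_sqrtr ?mulr0// subr_le0.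
rewrite -(@real_normK _ x) ?num_real//.
have : 2 ^+ 2 <= `|x| ^+ 2 by rewrite lerXn2r// nnegrE.
by lra.
Qed.

Lemma integrable_semicircle_pdf : mu.-integrable setT (EFin \o @semicircle_pdf R).
Proof.
have -> : EFin \o @semicircle_pdf R = (EFin \o @semicircle_pdf R) \_ `[- 2, 2].
  apply/funext => x; rewrite patchE; case: ifPn => //.
  rewrite notin_setE /= in_itv/= => /negP h; rewrite semicircle_pdf0//.
  by rewrite leNgt ltr_norml; apply: contra h => /andP[/ltW-> /ltW->].
apply/(integrable_mkcond _ _).1 => //.
apply: continuous_compact_integrable; first exact: segment_compact.
by apply: continuous_subspaceT => x; exact: continuous_semicircle_pdf.
Qed.

Lemma is_derive_semicircle_cdf x : is_derive x 1 (@semicircle_cdf R) (semicircle_pdf x).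
Proof.
have xx : x < x + 1 by rewrite ltrDl.
have iu : mu.-integrable [set` Interval -oo%O (BRight (x + 1))] (EFin \o @semicircle_pdf R).
  by apply: integrableS integrable_semicircle_pdf.
have nx : (-oo%O < BRight x)%E by rewrite ltNyr.
have [h1 h2] := continuous_FTC1 xx iu nx (@continuous_semicircle_pdf x).
by apply: DeriveDef; [exact: h1|rewrite -derive1E; exact: h2].
Qed.

Lemma continuous_semicircle_cdf : continuous (@semicircle_cdf R).
Proof.
move=> x; have [d _] := is_derive_semicircle_cdf x.
exact/differentiable_continuous/derivable1_diffP.
Qed.

Lemma semicircle_cdf_MVT x y : x < y -> exists2 c, c \in `]x, y[ &
  semicircle_cdf y - semicircle_cdf x = semicircle_pdf c * (y - x).
Proof.
move=> xy; apply: MVT => // [z _|]; first exact: is_derive_semicircle_cdf.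
by apply: continuous_subspaceT => z; exact: continuous_semicircle_cdf.
Qed.

Lemma semicircle_cdf_le0 x : x <= - 2 -> semicircle_cdf x = 0.
Proof.
move=> x2; rewrite /semicircle_cdf (@eq_Rintegral _ _ _ _ _ (cst 0)); last first.
  move=> y; rewrite inE /= in_itv/= => yx; apply: semicircle_pdf0.
  by rewrite ler0_norm; lra.
by rewrite /Rintegral integral0.
Qed.

(** With x = 2 sin a, the argument of [atan] is tan (a / 2), so 4 atan (...) is the usual 2 arcsin
    (x / 2). In this form the denominator never vanishes, and the function is continuous on the
    whole line, endpoints included. *)
Definition semicircle_primitive x : R :=
  (2 * pi)^-1 * (x * Num.sqrt (4 - x ^+ 2) / 2 + 4 * atan (x / (2 + Num.sqrt (4 - x ^+ 2)))).

Lemma continuous_semicircle_primitive : continuous semicircle_primitive.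
Proof.
have cS : continuous (fun x : R => Num.sqrt (4 - x ^+ 2)).
  move=> x; apply: (continuous_comp (f := fun y : R => 4 - y ^+ 2) (g := Num.sqrt)).
    by apply: cvgB; [exact: cvg_cst|exact: exprn_continuous].
  exact: sqrt_continuous.
move=> x; apply: cvgM; first exact: cvg_cst.
apply: cvgD.
  by apply: cvgM; [apply: cvgM; [exact: cvg_id|exact: cS]|exact: cvg_cst].
apply: cvgM; first exact: cvg_cst.
apply: (continuous_comp (f := fun x : R => x / (2 + Num.sqrt (4 - x ^+ 2))) (g := atan)).
  apply: cvgM; first exact: cvg_id.
  apply: cvgV; last by apply: cvgD; [exact: cvg_cst|exact: cS].
  by rewrite gt_eqF// ltr_pwDl// sqrtr_ge0.
exact: continuous_atan.
Qed.

Lemma is_derive_semicircle_primitive x : - 2 < x < 2 ->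
  is_derive x 1 semicircle_primitive (semicircle_pdf x).
Proof.
move=> /andP[x1 x2].
have p0 : 0 < 4 - x ^+ 2 by nra.
pose S y : R := Num.sqrt (4 - y ^+ 2).
have S0 : 0 < S x by rewrite sqrtr_gt0.
have SS : S x ^+ 2 = 4 - x ^+ 2 by rewrite sqr_sqrtr// ltW.
have dS : is_derive x 1 S (- x / S x).
  have d1 : is_derive x 1 (fun y : R => 4 - y ^+ 2) (- (2 * x)).
    by apply: is_derive_eq; rewrite /= /GRing.scale/=; lra.
  have d2 := is_derive1_sqrt p0.
  have := is_derive1_comp (f := Num.sqrt) (g := fun y : R => 4 - y ^+ 2) d2 d1.
  rewrite -/(S x) => d3; apply: is_derive_eq.
  by rewrite /GRing.scale/= invfM; field; rewrite gt_eqF.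
have n0 : 2 + S x != 0 by rewrite gt_eqF// addr_gt0.
have dV : is_derive x 1 (fun y => (2 + S y)^-1) (x / S x / (2 + S x) ^+ 2).
  have d1 : is_derive x 1 (fun y : R => 2 + S y) (- x / S x).
    by apply: is_derive_eq; rewrite add0r mul1r.
  have -> : x / S x / (2 + S x) ^+ 2 = - (2 + S x) ^- 2 *: (- x / S x).
    by rewrite /GRing.scale/=; field; rewrite n0 gt_eqF.
  exact: (is_deriveV (f := fun y => 2 + S y) n0 d1).
have dY : is_derive x 1 (fun y => y / (2 + S y)) (2 / (S x * (2 + S x))).
  have -> : 2 / (S x * (2 + S x)) = x *: (x / S x / (2 + S x) ^+ 2) + (2 + S x)^-1 *: 1.
    rewrite /GRing.scale/= (_ : x * (x / S x / (2 + S x) ^+ 2) = x ^+ 2 / (S x * (2 + S x) ^+ 2)).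
      have -> : x ^+ 2 = 4 - S x ^+ 2 by rewrite SS; lra.
      by field; rewrite n0 gt_eqF.
    by field; rewrite n0 gt_eqF.
  exact: (is_deriveM (is_derive_id x 1) dV).
have dA : is_derive x 1 (fun y => atan (y / (2 + S y))) ((2 * S x)^-1).
  have -> : (2 * S x)^-1 = (1 + (x / (2 + S x)) ^+ 2)^-1 * (2 / (S x * (2 + S x))).
    have -> : (x / (2 + S x)) ^+ 2 = (4 - S x ^+ 2) / (2 + S x) ^+ 2.
      by rewrite expr_div_n SS; congr (_ / _); lra.
    have -> : 1 + (4 - S x ^+ 2) / (2 + S x) ^+ 2 = 4 / (2 + S x) by field.
    by field; rewrite n0 gt_eqF.
  exact: (is_derive1_comp (f := atan) (g := fun y => y / (2 + S y)) (is_derive1_atan _) dY).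
have dX : is_derive x 1 (fun y => y * S y) (x * (- x / S x) + S x).
  have -> : x * (- x / S x) + S x = x *: (- x / S x) + S x *: 1.
    by rewrite /GRing.scale/= mulr1.
  exact: (is_deriveM (is_derive_id x 1) dS).
have -> : semicircle_primitive = (2 * pi)^-1 \*: (2^-1 \*: (fun y => y * S y) +
    4 \*: (fun y => atan (y / (2 + S y)))).
  apply/funext => y; rewrite /semicircle_primitive -/(S y).
  by rewrite /GRing.scale/=; congr (_ * (_ + _)); rewrite mulrC.
have -> : semicircle_pdf x = (2 * pi)^-1 *: (2^-1 *: (x * (- x / S x) + S x) + 4 *: (2 * S x)^-1).
  rewrite semicircle_pdfE -/(S x) /GRing.scale/=; congr (_ * _).
  have -> : x * (- x / S x) = - (x ^+ 2) / S x by field; rewrite gt_eqF.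
  have -> : x ^+ 2 = 4 - S x ^+ 2 by rewrite SS; lra.
  by field; rewrite gt_eqF.
exact: (is_deriveZ _ (is_deriveD (is_deriveZ _ dX) (is_deriveZ _ dA))).
Qed.

(** The distribution function and the explicit primitive have the same derivative inside ]-2, 2[ and
    are continuous up to the endpoints; the primitive goes from -1/2 to 1/2 because atan 1 = pi /
    4. *)
Lemma semicircle_cdf_ge1 x : 2 <= x -> semicircle_cdf x = 1.
Proof.
have pn0 : (pi : R) != 0 by rewrite gt_eqF// pi_gt0.
have cdf2 : semicircle_cdf (2 : R) = 1.
  have [c _] : exists2 c : R, c \in `](- 2), 2[ &
      (semicircle_cdf 2 - semicircle_primitive 2) -
      (semicircle_cdf (- 2) - semicircle_primitive (- 2)) = 0 * (2 - (- 2)).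
    apply: (@MVT _ (fun x => semicircle_cdf x - semicircle_primitive x) (fun=> 0)).
    - by lra.
    - move=> y; rewrite in_itv/= => hy.
      have d1 := is_derive_semicircle_cdf y.
      have d2 := is_derive_semicircle_primitive hy.
      by apply: is_derive_eq; rewrite subrr.
    - apply: continuous_subspaceT => y; apply: cvgB.
        exact: continuous_semicircle_cdf.
      exact: continuous_semicircle_primitive.
  rewrite mul0r (@semicircle_cdf_le0 (- 2))//.
  have -> : semicircle_primitive 2 = 1 / 2.
    rewrite /semicircle_primitive (_ : 4 - 2 ^+ 2 = 0); last by lra.
    rewrite sqrtr0 addr0 divff// atan1 mulr0 mul0r add0r.
    by move: (pi : R) pn0 => p p0; field.
  have -> : semicircle_primitive (- 2) = - (1 / 2).
    rewrite /semicircle_primitive (_ : 4 - (- 2) ^+ 2 = 0); last by lra.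
    rewrite sqrtr0 addr0 !mulNr divff// atanN atan1 mulr0 mul0r oppr0 add0r.
    by move: (pi : R) pn0 => p p0; field.
  by lra.
rewrite le_eqVlt => /predU1P[<-//|x2].
have [c] := semicircle_cdf_MVT x2; rewrite in_itv/= => /andP[c2 _].
rewrite semicircle_pdf0 ?mul0r ?cdf2; last by rewrite (le_trans (ltW c2))// ler_norm.
by move/eqP; rewrite subr_eq0 => /eqP.
Qed.

Lemma semicircle_cdf_lipschitz x y : x <= y ->
  0 <= semicircle_cdf y - semicircle_cdf x <= y - x.
Proof.
rewrite le_eqVlt => /predU1P[->|xy]; first by rewrite !subrr lexx.
have [c _ ->] := semicircle_cdf_MVT xy.
have p1 : 1 <= (pi : R) by have := @pi_ge2 R; lra.
have yx : 0 <= y - x by rewrite subr_ge0 ltW.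
have h0 : 0 <= semicircle_pdf c.
  by rewrite semicircle_pdfE mulr_ge0 ?sqrtr_ge0// invr_ge0 mulr_ge0// (le_trans _ p1).
have h1 : semicircle_pdf c <= 1.
  rewrite semicircle_pdfE -ler_pdivlMl ?invr_gt0 ?mulr_gt0 ?(lt_le_trans _ p1)//.
  rewrite invrK mulr1 -[2 * pi]ger0_norm ?mulr_ge0 ?(le_trans _ p1)//.
  by rewrite -sqrtr_sqr ler_wsqrtr// exprMn; have := sqr_ge0 c; nra.
by rewrite mulr_ge0//= ler_piMl.
Qed.

End semicircle.

(** * The quadratic equation, its stability, and its root near the real axis *)

Section semicircle_equation.
Variable R : realType.
Local Notation C := R[i].
Implicit Types (u v : R) (m s z : C).

(** The left side at m factors as (m - s) (m + z + s), and the second factor has imaginary part,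
    hence modulus, at least v. *)
Lemma semicircle_equation_stable u v m s : 0 < v ->
  s ^+ 2 + (u +i* v) * s + 1 = 0 -> 0 < complex.Im s -> 0 <= complex.Im m ->
  nm (m - s) <= nm (m ^+ 2 + (u +i* v) * m + 1) / v.
Proof.
move=> v0; set z := u +i* v => es s0 m0.
have -> : m ^+ 2 + z * m + 1 = (m - s) * (m + z + s).
  have -> : m ^+ 2 + z * m + 1 =
    (m - s) * (m + z + s) + (s ^+ 2 + z * s + 1) by ring.
  by rewrite es addr0.
rewrite nmM ler_pdivlMr//; apply: ler_wpM2l; first exact: nm_ge0.
apply: le_trans (nm_Im _); rewrite !cImD /= ger0_norm; lra.
Qed.

(** The term v / 2 is Im (z / 2). Under the square root stands a bound on |z^2 / 4 - u^2 / 4|, the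
    effect of moving from the real axis to height v. *)
Definition error_bound u v : R := v / 2 + Num.sqrt (`|u| * v / 2 + v ^+ 2 / 4).

Lemma dist_sqr_le (x y : R) : 0 <= x -> 0 <= y -> (x - y) ^+ 2 <= `|x ^+ 2 - y ^+ 2|.
Proof.
move=> x0 y0; rewrite subr_sqr normrM -(@real_normK _ (x - y)) ?num_real// expr2.
apply: ler_wpM2l => //; rewrite ler_norml; apply/andP; split.
  by have := ler_norm (x + y); lra.
by apply: le_trans (ler_norm _); lra.
Qed.

(** s = tau - z / 2, where tau is the square root of z^2 / 4 - 1 in the closed upper half plane. For
    v = 0 its imaginary part would be sqrt (4 - u^2) / 2 on [-2, 2], that is, pi times the
    density. *)
Lemma semicircle_equation_root u v : 0 < v -> exists s : C,
  [/\ s ^+ 2 + (u +i* v) * s + 1 = 0, 0 < complex.Im s &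
      `|complex.Im s - Num.sqrt (4 - u ^+ 2) / 2| <= error_bound u v].
Proof.
move=> v0; set z := u +i* v.
have [tau [tau2 tau0]] : exists tau : C, tau ^+ 2 = z ^+ 2 / 4 - 1 /\ 0 <= complex.Im tau.
  have h := sqr_sqrtc (z ^+ 2 / 4 - 1).
  have [i0|i0] := leP 0 (complex.Im (sqrtc (z ^+ 2 / 4 - 1))).
    by exists (sqrtc (z ^+ 2 / 4 - 1)).
  exists (- sqrtc (z ^+ 2 / 4 - 1)); rewrite sqrrN h; split => //.
  by rewrite cImN; lra.
pose s := tau - z / 2.
have z2 : complex.Im (z / 2) = v / 2.
  have -> : z / 2 = (u / 2) +i* (v / 2).
    have -> : (u / 2) +i* (v / 2) = z * (2^-1)%:C.
      by apply/eqP; rewrite eq_complex /= !mulr0 subr0 add0r !eqxx.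
    by rewrite fmorphV rmorph_nat.
  by [].
have ims : complex.Im s = complex.Im tau - v / 2 by rewrite /s cImD cImN z2.
have es : s ^+ 2 + z * s + 1 = 0.
  have -> : s ^+ 2 + z * s + 1 = tau ^+ 2 - (z ^+ 2 / 4 - 1) by rewrite /s; field.
  by rewrite tau2 subrr.
(* The roots s and - z - s have product 1, so their imaginary parts have opposite signs, and that of
   - z - s is - v / 2 - Im tau < 0. *)
have s0 : 0 < complex.Im s.
  have e : s * (- z - s) = 1.
    have -> : s * (- z - s) = 1 - (s ^+ 2 + z * s + 1) by ring.
    by rewrite es subr0.
  have sn0 : s != 0 by apply: contra_eq_neq e => ->; rewrite mul0r eq_sym oner_eq0.
  have es' : - z - s = s^-1 by rewrite -[LHS]mul1r -(mulVf sn0) -mulrA e mulr1.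
  have : complex.Im (- z - s) < 0 by rewrite cImD !cImN ims /=; lra.
  rewrite es' cImV oppr_lt0.
  have n0 : 0 < (complex.Re s ^+ 2 + complex.Im s ^+ 2)^-1.
    rewrite invr_gt0 -nm_sqr exprn_gt0// lt_neqAle nm_ge0 andbT eq_sym.
    by apply: contra sn0 => /eqP/Normc.eq0_normc ->.
  by rewrite pmulr_lgt0.
exists s; split => //.
(* (Im tau)^2 = (|q| - Re q) / 2, and r^2 is the same expression at the real point q0. It is
   Lipschitz in q, and taking square roots gives the root in [error_bound]. *)
pose q := tau ^+ 2; pose q0 : R := u ^+ 2 / 4 - 1; pose r := Num.sqrt (4 - u ^+ 2) / 2.
have b2 : complex.Im tau ^+ 2 = (nm q - complex.Re q) / 2.
  by rewrite /q [tau ^+ 2]expr2 nmM -expr2 nm_sqr cReM; lra.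
have r2 : r ^+ 2 = (`|q0| - q0) / 2.
  rewrite /r expr_div_n /q0; have [h|h] := leP 0 (4 - u ^+ 2).
    by rewrite sqr_sqrtr// ler0_norm; lra.
  by rewrite ler0_sqrtr ?ltW// expr0n mul0r ger0_norm; lra.
have qq0 : nm (q - q0%:C) <= `|u| * v / 2 + v ^+ 2 / 4.
  have -> : q - q0%:C = (- (v ^+ 2 / 4)) +i* (u * v / 2).
    rewrite /q tau2.
    have -> : (4 : C)^-1 = (4^-1 : R)%:C by rewrite fmorphV rmorph_nat.
    apply/eqP; rewrite /q0 /z eq_complex /= !(mulr0, subr0, addr0, oppr0).
    by apply/andP; split; apply/eqP; lra.
  apply: le_trans (nm_le_ReIm _) _ => /=.
  rewrite normrN addrC (@ger0_norm _ (v ^+ 2 / 4)) ?divr_ge0 ?sqr_ge0// lerD2r.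
  by rewrite !normrM (gtr0_norm v0) (@ger0_norm _ 2^-1)// invr_ge0.
have key : `|complex.Im tau ^+ 2 - r ^+ 2| <= `|u| * v / 2 + v ^+ 2 / 4.
  apply: le_trans qq0; rewrite b2 r2.
  have -> : (nm q - complex.Re q) / 2 - (`|q0| - q0) / 2 =
    ((nm q - nm q0%:C) - complex.Re (q - q0%:C)) / 2 by rewrite cReD cReN nm_real /=; lra.
  rewrite normrM (@ger0_norm _ 2^-1) ?invr_ge0// ler_pdivrMr//.
  apply: le_trans (ler_normB _ _) _; rewrite mulr_natr mulr2n; apply: lerD; last exact: nm_Re.
  rewrite ler_norml; have h1 := nmD (q - q0%:C) q0%:C; have h2 := nmB q (q - q0%:C).
  rewrite subrK in h1; rewrite subKr in h2; lra.
have r0 : 0 <= r by rewrite divr_ge0// sqrtr_ge0.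
have : `|complex.Im tau - r| <= Num.sqrt (`|u| * v / 2 + v ^+ 2 / 4).
  rewrite -sqrtr_sqr ler_wsqrtr//; apply: le_trans key; exact: dist_sqr_le.
rewrite ims /error_bound -/r !ler_norml; lra.
Qed.

End semicircle_equation.

(** * Stieltjes inversion *)

Section poisson.
Variable R : realType.
Implicit Types v s x a b t : R.

(** pi times the Poisson kernel of the half plane; at s = u - d it is the imaginary part of 1 / (d -
    u - i v). *)
Definition poisson v s : R := v / (s ^+ 2 + v ^+ 2).

Lemma poisson_lipschitz v s t : 0 < v ->
  `|poisson v s - poisson v t| <= `|s - t| / v ^+ 2.
Proof.
move=> v0; rewrite /poisson; have v2 : 0 < v ^+ 2 by rewrite exprn_gt0.
set A := s ^+ 2 + v ^+ 2; set B := t ^+ 2 + v ^+ 2.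
have A0 : 0 < A by rewrite ltr_wpDl// sqr_ge0.
have B0 : 0 < B by rewrite ltr_wpDl// sqr_ge0.
have -> : v / A - v / B = (t - s) * (v * (s + t) / (A * B)).
  rewrite /A /B; field; apply/andP; split; apply: lt0r_neq0.
    exact: B0.
  exact: A0.
rewrite normrM distrC; apply: ler_wpM2l => //.
have AB0 : 0 < A * B by rewrite mulr_gt0.
rewrite normrM normfV (gtr0_norm AB0) ler_pdivrMr//.
rewrite [leRHS]mulrC ler_pdivlMr// normrM (gtr0_norm v0).
have h1 : v * `|s + t| <= (A + B) / 2.
  apply: (@le_trans _ _ (v * (`|s| + `|t|))).
    by apply: ler_wpM2l; [exact: ltW|exact: ler_normD].
  have := (sqr_ge0 (`|s| - v), sqr_ge0 (`|t| - v)); case.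
  rewrite !sqrrB !real_normK ?num_real// /A /B; lra.
have h2 : (A + B) / 2 * v ^+ 2 <= A * B.
  have sA : v ^+ 2 <= A by rewrite lerDr sqr_ge0.
  have sB : v ^+ 2 <= B by rewrite lerDr sqr_ge0.
  nra.
by apply: le_trans h2; apply: ler_wpM2r; [exact: ltW|exact: h1].
Qed.

Lemma is_derive_atan_scaled v x t : 0 < v ->
  is_derive x 1 (fun y => atan ((y - t) / v)) (poisson v (x - t)).
Proof.
move=> v0.
have d1 : is_derive x 1 (fun y : R => v^-1 * (y - t)) v^-1.
  have d0 : is_derive x 1 (v^-1 \*: (id - cst t)) (v^-1 *: (1 - 0)) by exact: is_deriveZ.
  by rewrite subr0 [_ *: _]mulr1 in d0.
have d2 := is_derive1_comp (f := atan) (g := fun y => v^-1 * (y - t)) (is_derive1_atan _) d1.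
have -> : (fun y => atan ((y - t) / v)) = atan \o (fun y => v^-1 * (y - t)).
  by apply/funext => y /=; rewrite mulrC.
have -> : poisson v (x - t) = (1 + (v^-1 * (x - t)) ^+ 2)^-1 * v^-1; last exact: d2.
have n1 : (x - t) ^+ 2 + v ^+ 2 != 0 by rewrite gt_eqF// ltr_wpDl ?sqr_ge0// exprn_gt0.
have n2 : 1 + (v^-1 * (x - t)) ^+ 2 != 0 by rewrite gt_eqF// ltr_pwDl// sqr_ge0.
apply: (mulIf n2); rewrite [RHS]mulrAC mulVf// mul1r.
rewrite /poisson exprMn exprVn; field.
by rewrite (gt_eqF v0) n1.
Qed.

Lemma sqrt_sub_le x y : `|Num.sqrt x - Num.sqrt y| <= Num.sqrt `|x - y|.
Proof.
wlog xy : x y / x <= y.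
  by move=> h; have [/h//|/ltW/h] := leP x y; rewrite distrC [X in _ <= Num.sqrt X -> _]distrC.
have [x0|x0] := leP x 0.
  rewrite (ler0_sqrtr x0) sub0r normrN ger0_norm ?sqrtr_ge0// ler_wsqrtr// distrC.
  by rewrite (le_trans _ (ler_norm _))//; lra.
have y0 : 0 <= y by lra.
rewrite -[X in X <= _]ger0_norm// -sqrtr_sqr ler_wsqrtr// real_normK ?num_real//.
apply: le_trans (dist_sqr_le (sqrtr_ge0 _) (sqrtr_ge0 _)) _.
by rewrite !sqr_sqrtr// ltW.
Qed.

Section counting.
Variables (N : nat) (d : 'I_N -> R).

Definition poisson_mean v u : R := N%:R^-1 * \sum_i poisson v (u - d i).
Definition atan_mean v x : R := N%:R^-1 * \sum_i (atan ((x - d i) / v) / pi).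
Definition counting_cdf x : R := N%:R^-1 * \sum_i (d i <= x)%R%:R.

Lemma poisson_mean_lipschitz v s t : 0 < v ->
  `|poisson_mean v s - poisson_mean v t| <= `|s - t| / v ^+ 2.
Proof.
move=> v0; have B0 : 0 <= `|s - t| / v ^+ 2 by rewrite divr_ge0// exprn_ge0// ltW.
rewrite /poisson_mean -mulrBr -sumrB normrM normfV normr_nat.
have [N0|N0] := posnP N; first by rewrite (_ : N%:R = 0) ?invr0 ?mul0r// N0.
rewrite mulrC ler_pdivrMr ?ltr0n//.
apply: le_trans (ler_norm_sum _ _ _) _.
rewrite mulr_natr -[N in leRHS]card_ord -sumr_const; apply: ler_sum => i _.
by apply: le_trans (poisson_lipschitz _ _ v0) _; rewrite opprB addrA subrK.
Qed.

Lemma is_derive_atan_mean v x : 0 < v ->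
  is_derive x 1 (atan_mean v) (poisson_mean v x / pi).
Proof.
move=> v0.
have d1 i : is_derive x 1 (pi^-1 \*: (fun y => atan ((y - d i) / v)))
    (pi^-1 *: poisson v (x - d i)).
  by apply: is_deriveZ; exact: is_derive_atan_scaled.
have d2 := is_derive_sum (h := fun i => pi^-1 \*: (fun y => atan ((y - d i) / v))) d1.
have -> : atan_mean v = N%:R^-1 \*: (\sum_(i < N) (pi^-1 \*: (fun y => atan ((y - d i) / v)))).
  apply/funext => y; rewrite /atan_mean /GRing.scale/= fct_sumE; congr (_ * _).
  by apply: eq_bigr => i _; rewrite /GRing.scale/= mulrC.
have -> : poisson_mean v x / pi = N%:R^-1 *: (\sum_(i < N) pi^-1 *: poisson v (x - d i)).
  rewrite /poisson_mean /GRing.scale/= -mulrA; congr (_ * _).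
  by rewrite mulr_suml; apply: eq_bigr => i _; rewrite mulrC.
exact: is_deriveZ.
Qed.

Lemma counting_cdf_ge0 x : 0 <= counting_cdf x.
Proof. by rewrite mulr_ge0 ?invr_ge0 ?ler0n// sumr_ge0. Qed.

Lemma counting_cdf_le1 x : counting_cdf x <= 1.
Proof.
rewrite /counting_cdf; have [N0|N0] := posnP N; first by rewrite (_ : N%:R = 0) ?invr0 ?mul0r// N0.
rewrite mulrC ler_pdivrMr ?ltr0n// mul1r -[N in leRHS]card_ord -sumr_const.
by apply: ler_sum => i _; case: (d i <= x); rewrite ?lexx ?ler01.
Qed.

(* The smoothed indicator of [a + delta, b - delta] is below that of ]a, b],
   up to [eps]: one inequality suffices since the limit has total mass 1. *)
Lemma counting_cdf_lower v a b delta eps : 0 < v -> 0 < delta -> a < b -> 0 <= eps ->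
  pi / 2 - pi * eps <= atan (delta / v) ->
  atan_mean v (b - delta) - atan_mean v (a + delta) - eps <=
  counting_cdf b - counting_cdf a.
Proof.
move=> v0 d0 ab e0 hat.
rewrite /atan_mean /counting_cdf -!mulrBr -!sumrB.
have [N0|N0] := posnP N; first by have e : N%:R = 0 :> R; [by rewrite N0|rewrite e]; rewrite invr0 !mul0r; lra.
have -> : eps = N%:R^-1 * (N%:R * eps) by rewrite mulKf// gt_eqF// ltr0n.
rewrite -mulrBr; apply: ler_wpM2l; first by rewrite invr_ge0 ler0n.
rewrite lerBlDr mulr_natl -[N in eps *+ N]card_ord -sumr_const -big_split/=.
apply: ler_sum => i _; set t := d i.
have p0 : 0 < (pi : R) := pi_gt0 R.
have at1 (y : R) : atan y < pi / 2 := atan_ltpi2 y.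
have at2 (y : R) : - (pi / 2) < atan y := atan_gtNpi2 y.
rewrite -mulrBl ler_pdivrMr//.
set X := atan _; set Y := atan _.
have X1 : X < pi / 2 := at1 _.
have Y2 : - (pi / 2) < Y := at2 _.
have [ta|ta] := leP t a.
  rewrite (le_trans ta (ltW ab)) subrr add0r.
  have : atan (delta / v) <= Y.
    by apply: le_atan; rewrite ler_pM2r ?invr_gt0//; lra.
  lra.
have [tb|tb] := leP t b; first by rewrite subr0 mulrDl mul1r; have := mulr_ge0 e0 (ltW p0); lra.
rewrite subrr add0r.
have : X <= atan (- (delta / v)).
  by apply: le_atan; rewrite -mulNr ler_pM2r ?invr_gt0//; lra.
rewrite atanN; lra.
Qed.

End counting.
End poisson.

Section inversion.
Variable R : realType.
Variables (N : nat -> nat) (d : forall n, 'I_(N n) -> R).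
Arguments d : clear implicits.
Local Notation F := (@semicircle_cdf R).

Hypothesis poisson_cvg : forall (p : nat) (q : rat), exists l : R,
  poisson_mean (d n) p.+1%:R^-1 (ratr q) @[n --> \oo] --> l /\
  `|l - Num.sqrt (4 - (ratr q) ^+ 2) / 2| <= error_bound (ratr q) p.+1%:R^-1.

Lemma error_bound_small (L e : R) : 0 <= L -> 0 < e ->
  \forall p \near \oo, forall u : R, `|u| <= L -> error_bound u p.+1%:R^-1 <= e.
Proof.
move=> L0 e0.
pose g (v : R) := v / 2 + Num.sqrt (L * v / 2 + v ^+ 2 / 4).
have g0 : g p.+1%:R^-1 @[p --> \oo] --> (0 : R).
  have h : (fun p : nat => p.+1%:R^-1 : R) @ \oo --> (0 : R) by exact: cvg_harmonic.
  have -> : (0 : R) = 0 / 2 + Num.sqrt (L * 0 / 2 + 0 * 0 / 4).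
    by rewrite !(mulr0, mul0r, addr0) sqrtr0 addr0.
  apply: cvgD; first by apply: cvgM => //; exact: cvg_cst.
  apply: (@cvg_comp _ _ _ _ Num.sqrt); last exact: sqrt_continuous.
  apply: cvgD.
    by apply: cvgM; [apply: cvgM => //; exact: cvg_cst|exact: cvg_cst].
  apply: cvgM; last exact: cvg_cst.
  by under eq_fun do rewrite expr2; exact: cvgM.
move/cvgrPdist_le : g0 => /(_ e e0); apply: filterS => p.
rewrite sub0r normrN => hp u uL; apply: le_trans (le_trans (ler_norm _) hp).
rewrite /error_bound /g lerD2l ler_wsqrtr// lerD2r.
by rewrite ler_pM2r ?invr_gt0// ler_wpM2r.
Qed.

(** Convergence on a finite rational grid extends to [a, b] by equicontinuity. The 4 e are: e for
    the Lipschitz bound of the Poisson mean, 2 e at the grid point (convergence and [error_bound]),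
    and e for the square root. *)
Lemma poisson_mean_uniform (a b e : R) (p : nat) : 0 < e ->
  (forall u : R, `|u| <= `|a| + `|b| + 1 -> error_bound u p.+1%:R^-1 <= e) ->
  \forall n \near \oo, forall c, a <= c <= b ->
    `|poisson_mean (d n) p.+1%:R^-1 c - Num.sqrt (4 - c ^+ 2) / 2| <= 4 * e.
Proof.
move=> e0 hp; set v : R := p.+1%:R^-1.
have v0 : 0 < v by rewrite invr_gt0.
(* The extra 1 leaves room for the grid point next to c, which may lie outside [a, b]. *)
set L := `|a| + `|b| + 1.
have L0 : 0 < L by rewrite ltr_wpDl// addr_ge0.
have [K [K1 K2]] : exists K : nat, K.+1%:R^-1 / v ^+ 2 <= e /\
    Num.sqrt (2 * L * K.+1%:R^-1) / 2 <= e.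
  have h : (fun p : nat => p.+1%:R^-1 : R) @ \oo --> (0 : R) by exact: cvg_harmonic.
  have h1 : K.+1%:R^-1 / v ^+ 2 @[K --> \oo] --> (0 : R).
    by rewrite -(mul0r (v ^+ 2)^-1); apply: cvgM => //; exact: cvg_cst.
  have h2 : Num.sqrt (2 * L * K.+1%:R^-1) / 2 @[K --> \oo] --> (0 : R).
    have -> : (0 : R) = Num.sqrt (2 * L * 0) / 2 by rewrite mulr0 sqrtr0 mul0r.
    apply: cvgM; last exact: cvg_cst.
    apply: (@cvg_comp _ _ _ _ Num.sqrt); last exact: sqrt_continuous.
    by apply: cvgM => //; exact: cvg_cst.
  move/cvgrPdist_le : h1 => /(_ e e0) h1; move/cvgrPdist_le : h2 => /(_ e e0) h2.
  have [K _ hK] := filterI h1 h2; exists K; have [k1 k2] := hK K (leqnn K).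
  rewrite !sub0r !normrN in k1 k2.
  by split; [exact: le_trans (ler_norm _) k1|exact: le_trans (ler_norm _) k2].
have Kp : 0 < K.+1%:R :> R by rewrite ltr0n.
(* Translating by [D] makes c + D nonnegative on [a, b], so grid points can be numbered by natural
   numbers. *)
pose D := (Num.truncn `|a|).+1.
have Da : - D%:R <= a.
  have /andP[_ /ltW h] := truncn_itv (normr_ge0 a).
  by have := ler_norm (- a); rewrite normrN /D; lra.
pose q (k : nat) : rat := k%:R / K.+1%:R - D%:R.
have qE k : ratr (q k) = k%:R / K.+1%:R - D%:R :> R.
  by rewrite /q rmorphB/= rmorphM/= fmorphV/= !ratr_nat.
pose kmax := (Num.truncn ((b + D%:R) * K.+1%:R)).+1.
have near_grid : \forall n \near \oo, forall k : 'I_kmax.+1, `|ratr (q k)| <= L ->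
    `|poisson_mean (d n) v (ratr (q k)) - Num.sqrt (4 - (ratr (q k)) ^+ 2) / 2| <= 2 * e.
  apply: filter_forall => k.
  have [l [hl1 hl2]] := poisson_cvg p (q k).
  move/cvgrPdist_le : hl1 => /(_ e e0); apply: filterS => n hn kL.
  have -> : poisson_mean (d n) v (ratr (q k)) - Num.sqrt (4 - (ratr (q k)) ^+ 2) / 2 =
    (poisson_mean (d n) v (ratr (q k)) - l) + (l - Num.sqrt (4 - (ratr (q k)) ^+ 2) / 2).
    by rewrite addrA subrK.
  apply: le_trans (ler_normD _ _) _; rewrite mulr_natl mulr2n; apply: lerD.
    by rewrite distrC.
  by apply: le_trans hl2 _; exact: hp.
apply: filterS near_grid => n hn c /andP[ac cb].
have cD : 0 <= (c + D%:R) * K.+1%:R by rewrite mulr_ge0//; lra.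
pose k := Num.truncn ((c + D%:R) * K.+1%:R).
have /andP[k1 k2] := truncn_itv cD; rewrite -/k in k1 k2.
have kk : (k < kmax.+1)%N.
  rewrite /kmax ltnS ltnW// ltnS; apply: le_truncn.
  by rewrite ler_pM2r// lerD2r.
set u : R := ratr (q k).
have cu : `|c - u| <= K.+1%:R^-1.
  have Kn : 0 <= K.+1%:R^-1 :> R by rewrite invr_ge0 ler0n.
  have u1 : k%:R / K.+1%:R <= c + D%:R by rewrite ler_pdivrMr.
  have u2 : c + D%:R <= k%:R / K.+1%:R + K.+1%:R^-1.
    have -> : k%:R / K.+1%:R + K.+1%:R^-1 = k.+1%:R / K.+1%:R :> R.
      by rewrite -[k.+1]addn1 natrD mulrDl mul1r.
    by rewrite ler_pdivlMr// ltW.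
  have comb (x y e' t : R) : 0 <= y -> x <= t + e' -> t + e' <= x + y ->
      - y <= t - (x - e') <= y.
    by move=> *; apply/andP; split; lra.
  by rewrite /u qE ler_norml; exact: comb.
have cL : `|c| <= `|a| + `|b|.
  by rewrite ler_norml; have := (ler_norm (- a), ler_norm b); rewrite normrN => -[h1 h2];
    have := (normr_ge0 a, normr_ge0 b) => -[h3 h4]; apply/andP; split; lra.
have uL : `|u| <= L.
  have K1' : K.+1%:R^-1 <= 1 :> R by rewrite invf_le1// ler1n.
  have : `|u| <= `|c| + `|c - u| by rewrite -[X in `|X| <= _](subKr c u); exact: ler_normB.
  by move/le_trans; apply; apply: lerD => //; exact: le_trans cu K1'.
have := hn (Ordinal kk) uL; rewrite /= -/u => h2.
have h1 : `|poisson_mean (d n) v c - poisson_mean (d n) v u| <= e.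
  apply: le_trans (poisson_mean_lipschitz _ _ _ v0) _.
  apply: le_trans K1; apply: ler_wpM2r => //.
  by rewrite invr_ge0 exprn_ge0// ltW.
have h3 : `|Num.sqrt (4 - u ^+ 2) / 2 - Num.sqrt (4 - c ^+ 2) / 2| <= e.
  rewrite -mulrBl normrM (@ger0_norm _ 2^-1) ?invr_ge0//.
  apply: le_trans K2; rewrite ler_pM2r ?invr_gt0//.
  apply: le_trans (sqrt_sub_le _ _) _; apply: ler_wsqrtr.
  have -> : 4 - u ^+ 2 - (4 - c ^+ 2) = (c + u) * (c - u) by ring.
  rewrite normrM; apply: ler_pM => //.
  by apply: le_trans (ler_normD _ _) _; rewrite /L in uL *; lra.
have -> : poisson_mean (d n) v c - Num.sqrt (4 - c ^+ 2) / 2 =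
  (poisson_mean (d n) v c - poisson_mean (d n) v u) +
  (poisson_mean (d n) v u - Num.sqrt (4 - u ^+ 2) / 2) +
  (Num.sqrt (4 - u ^+ 2) / 2 - Num.sqrt (4 - c ^+ 2) / 2) by ring.
apply: le_trans (ler_normD _ _) _.
have := ler_normD (poisson_mean (d n) v c - poisson_mean (d n) v u)
  (poisson_mean (d n) v u - Num.sqrt (4 - u ^+ 2) / 2).
lra.
Qed.

(** The height v = 1 / (p + 1) is fixed first, small enough for both the tails of the kernel and
    [error_bound]; only then does n grow. The mean value theorem compares [atan_mean] with the limit
    through their derivatives. *)
Lemma counting_cdf_liminf (a b eps : R) : a < b -> 0 < eps ->
  \forall n \near \oo, F b - F a - eps <= counting_cdf (d n) b - counting_cdf (d n) a.
Proof.
move=> ab eps0.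
have p0 : 0 < (pi : R) := pi_gt0 R.
have p1 : 1 <= (pi : R) by have := @pi_ge2 R; lra.
have ba : 0 < b - a by rewrite subr_gt0.
pose delta := Num.min (eps / 8) ((b - a) / 4).
have d0 : 0 < delta by rewrite lt_min !divr_gt0.
have d1 : delta <= eps / 8 by rewrite ge_min lexx.
have d2 : delta <= (b - a) / 4 by rewrite ge_min lexx orbT.
pose a' := a + delta; pose b' := b - delta.
have a'b' : a' < b' by rewrite /a' /b'; lra.
(* Then 4 e (b - a) = eps / 8. Together with eps / 4 for the kernel tails and 2 delta <= eps / 4 for
   shrinking the interval, the total stays below [eps]. *)
pose e := eps / (32 * (b - a)).
have e0 : 0 < e by rewrite divr_gt0// mulr_gt0.
have L0 : 0 <= `|a'| + `|b'| + 1 by rewrite !addr_ge0.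
have h1 := error_bound_small L0 e0.
have h2 : \forall p \near \oo, pi / 2 - pi * (eps / 4) <= atan (delta / p.+1%:R^-1).
  have : atan (delta * p.+1%:R) @[p --> \oo] --> (pi / 2 : R).
    apply: (@cvg_comp _ _ _ (fun p => delta * p.+1%:R) atan _ (pinfty_nbhs R)); last exact: cvgy_atan.
    apply/cvgryPge => A; exists (Num.truncn (A / delta)) => // k /= hk.
    rewrite mulrC -ler_pdivrMr// ltW// (lt_le_trans (truncnS_gt _))// ler_nat ltnS.
    exact: hk.
  move/cvgrPdist_le => /(_ (pi * (eps / 4))) h.
  have pe : 0 < pi * (eps / 4) by rewrite mulr_gt0// divr_gt0.
  have {h} := h pe; apply: filterS => p hp; rewrite invrK.
  by have := le_trans (ler_norm _) hp; lra.
have [p _ hp] := filterI h1 h2; have [{}h1 {}h2] := hp p (leqnn p).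
set v : R := p.+1%:R^-1 in h1 h2.
have v0 : 0 < v by rewrite invr_gt0 ltr0n.
apply: filterS (poisson_mean_uniform e0 h1) => n hn.
have e4 : 0 <= eps / 4 by rewrite divr_ge0// ltW.
apply: le_trans (counting_cdf_lower (d n) v0 d0 ab e4 h2).
have [c cab] : exists2 c, c \in `]a', b'[ &
    (atan_mean (d n) v b' - F b') - (atan_mean (d n) v a' - F a') =
    (poisson_mean (d n) v c / pi - semicircle_pdf c) * (b' - a').
  apply: (@MVT _ (fun x => atan_mean (d n) v x - F x)
    (fun x => poisson_mean (d n) v x / pi - semicircle_pdf x)) => //.
    move=> x _; exact: (is_deriveB (is_derive_atan_mean (d n) x v0) (is_derive_semicircle_cdf x)).
  apply: continuous_subspaceT => x.
  have [dd _] := is_deriveB (is_derive_atan_mean (d n) x v0) (is_derive_semicircle_cdf x).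
  exact/differentiable_continuous/derivable1_diffP.
move=> mvt.
have cab' : a' <= c <= b' by move: cab; rewrite in_itv/= => /andP[/ltW-> /ltW->].
have hc := hn c cab'.
have hb : `|(poisson_mean (d n) v c / pi - semicircle_pdf c) * (b' - a')| <= eps / 8.
  have -> : poisson_mean (d n) v c / pi - semicircle_pdf c =
      (poisson_mean (d n) v c - Num.sqrt (4 - c ^+ 2) / 2) / pi.
    by rewrite semicircle_pdfE invfM; move: pi^-1 => x; ring.
  have b'a' : 0 <= b' - a' by rewrite subr_ge0 ltW.
  rewrite !normrM normfV (gtr0_norm p0) (ger0_norm b'a').
  have -> : eps / 8 = 4 * e * (b - a) by rewrite /e; field; rewrite gt_eqF.
  apply: ler_pM => //; first by rewrite divr_ge0// ltW.
    rewrite ler_pdivrMr//; apply: le_trans hc _; rewrite ler_peMr// mulr_ge0// ltW//.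
  by rewrite /a' /b'; lra.
have F1 : F b - F b' <= delta.
  have /semicircle_cdf_lipschitz/andP[_] : b' <= b by rewrite /b'; lra.
  by rewrite /b'; lra.
have F2 : F a' - F a <= delta.
  have /semicircle_cdf_lipschitz/andP[_] : a <= a' by rewrite /a'; lra.
  by rewrite /a'; lra.
move: hb; rewrite -mvt ler_norml => /andP[hb _].
rewrite -/a' -/b'; lra.
Qed.

Theorem counting_cdf_cvg (x : R) : counting_cdf (d n) x @[n --> \oo] --> F x.
Proof.
apply/cvgrPdist_le => eps eps0.
(* The limit is 0 at [a] and 1 at [b]. The mass of ]a, x] bounds the value at x from below, and the
   mass of ]x, b] bounds it from above. *)
pose a := Num.min x (- 2) - 1; pose b := Num.max x 2 + 1.
have ax : a < x by have : Num.min x (- 2) <= x; [rewrite ge_min lexx|rewrite /a; lra].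
have a2 : a <= - 2 by have : Num.min x (- 2) <= - 2; [rewrite ge_min lexx orbT|rewrite /a; lra].
have xb : x < b by have : x <= Num.max x 2; [rewrite le_max lexx|rewrite /b; lra].
have b2 : 2 <= b by have : 2 <= Num.max x 2; [rewrite le_max lexx orbT|rewrite /b; lra].
have h1 := counting_cdf_liminf ax eps0; have h2 := counting_cdf_liminf xb eps0.
apply: filterS (filterI h1 h2) => n [{}h1 {}h2].
rewrite (semicircle_cdf_le0 a2) in h1; rewrite (semicircle_cdf_ge1 b2) in h2.
have := counting_cdf_ge0 (d n) a; have := counting_cdf_le1 (d n) b.
by rewrite ler_norml => *; apply/andP; split; lra.
Qed.

End inversion.

(** * Eigenvalues *)

Section sorted_counting.
Variable R : realType.
Implicit Types (s : seq R) (x : R).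

Lemma sorted_nth_le s x k : sorted <=%R s -> (k < size s)%N ->
  (nth 0 s k <= x) = (k < count (fun y => y <= x)%R s)%N.
Proof.
elim: s k => [|a s ih] k //= sorts ks.
have [ax|xa] := leP a x.
  case: k ks => [|k] ks /=; first by rewrite ax.
  by rewrite add1n ltnS; apply: ih => //; exact: path_sorted sorts.
have xs y : y \in a :: s -> (y <= x) = false.
  rewrite inE => /predU1P[->|ys]; first by rewrite leNgt xa.
  have /allP/(_ y ys) ay : all (fun y => a <= y) s by exact: (order_path_min le_trans).
  by rewrite leNgt (lt_le_trans xa ay).
rewrite (xs (nth 0 (a :: s) k)) ?mem_nth// add0n (@eq_in_count _ _ pred0) ?count_pred0//.
by move=> y ys; rewrite /= xs// inE ys orbT.
Qed.

Lemma sum_double_lt n c : (c <= 2 * n)%N -> (\sum_(i < n) (2 * i < c))%N = uphalf c.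
Proof.
elim: n c => [|n ih] c cn; first by rewrite big_ord0; case: c cn.
rewrite big_ord_recr /=; have [cn'|cn'] := leqP c (2 * n); first by rewrite ih// addn0.
have -> : (\sum_(i < n) (2 * i < c))%N = n.
  rewrite -[RHS]card_ord -sum1_card; apply: eq_bigr => i _.
  by have := ltn_ord i; case: ltnP; lia.
lia.
Qed.
End sorted_counting.

Section eigenvalues.
Variable R : realType.
Local Notation C := R[i].

Lemma char_poly_hermitian N (A : 'M[C]_N) : A^t* = A ->
  char_poly A = \prod_(i < N) ('X - ((spectrum A i)%:C)%:P).
Proof.
move=> hA; set Q := spectralmx A.
pose D : 'M[C]_N := diag_mx (\row_i (spectrum A i)%:C).
pose q := map_mx (@polyC C) (Q^t* ); pose q' := map_mx (@polyC C) Q.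
have qq : q *m q' = 1%:M by rewrite -map_mxM (mulQtQ A) map_mx1.
have -> : char_poly A = char_poly D.
  rewrite /char_poly; have -> : char_poly_mx A = q *m char_poly_mx D *m q'.
    rewrite /char_poly_mx mulmxBr mulmxBl -!map_mxM -(spectral_decomposition hA).
    by rewrite -mulmxA mul_scalar_mx -scalemxAr qq scalemx1.
  by rewrite !det_mulmx mulrAC -det_mulmx qq det1 mul1r.
rewrite char_poly_trig; last by apply/is_trig_mxP => i j ij; rewrite !mxE; case: eqP ij => // ->; rewrite ltnn.
by apply: eq_bigr => i _; rewrite !mxE eqxx mulr1n.
Qed.

Lemma complex_eigenvalues_hermitian N (A : 'M[C]_N) : A^t* = A ->
  perm_eq (complex_eigenvalues A) [seq (spectrum A i)%:C | i <- enum 'I_N].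
Proof.
move=> hA; rewrite /complex_eigenvalues.
case: closed_field_poly_normal => r /= er.
apply: prod_XsubC_eq; rewrite big_map big_enum/= -char_poly_hermitian//.
by rewrite er (monicP (char_poly_monic A)) scale1r.
Qed.

(** If c of the 2n sorted eigenvalues are at most x, then [uphalf c] of the even positions are among
    them, which is within 1 / 2 of c / 2. *)
Lemma esd_counting_cdf n (W : 'M[quat R]_n) x : (0 < n)%N ->
  (complex_rep W)^t* = complex_rep W ->
  `|esd W x - counting_cdf (spectrum (complex_rep W)) x| <= n%:R^-1.
Proof.
move=> n0 hW; set A := complex_rep W in hW *.
set N := (\sum_(i < n) 2)%N in A hW *; have N2 : N = (2 * n)%N by rewrite /N sum_nat_const card_ord mulnC.
pose e := sort <=%R (map (@complex.Re R) (complex_eigenvalues A)).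
have pe : perm_eq e [seq spectrum A i | i <- enum 'I_N].
  rewrite perm_sort; have := perm_map (@complex.Re R) (complex_eigenvalues_hermitian hW).
  by rewrite -map_comp.
have se : size e = N by rewrite (perm_size pe) size_map size_enum_ord.
pose c := count (fun y => y <= x) e.
have cN : (c <= 2 * n)%N by rewrite -N2 -se count_size.
have e1 : counting_cdf (spectrum A) x = (2 * n%:R)^-1 * c%:R.
  rewrite /counting_cdf; congr (_^-1 * _); first by rewrite N2 natrM.
  rewrite /c (permP pe) count_map -sum1_count big_enum_cond/= natr_sum [RHS]big_mkcond/=.
  by apply: eq_bigr => i _; case: (spectrum A i <= x).
have e2 : esd W x = n%:R^-1 * (uphalf c)%:R.
  rewrite /esd; congr (_ * _); rewrite -(sum_double_lt cN) natr_sum.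
  apply: eq_bigr => i _; rewrite /qeigenvalue -/A -/e sorted_nth_le ?sort_le_sorted//.
  by rewrite se N2 ltn_pmul2l.
have nn0 : 0 < n%:R :> R by rewrite ltr0n.
have -> : esd W x - counting_cdf (spectrum A) x = n%:R^-1 * ((uphalf c)%:R - c%:R / 2).
  by rewrite e1 e2; field; rewrite gt_eqF.
rewrite normrM ger0_norm ?invr_ge0 ?ler0n// ler_piMr ?invr_ge0 ?ler0n//.
have : ((uphalf c)%:R * 2 = c%:R + (odd c)%:R :> R)%R.
  by rewrite -natrM -natrD; congr _%:R; lia.
move: ((uphalf c)%:R) (c%:R) => y y' h.
have o1 : (odd c)%:R <= 1 :> R by case: odd; rewrite ?lexx ?ler01.
have o2 : 0 <= (odd c)%:R :> R by rewrite ler0n.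
by rewrite ler_norml; apply/andP; split; lra.
Qed.

End eigenvalues.

(** * Almost sure convergence *)

Section fourth_moment_ae.
Context d (T : measurableType d) (R : realType) (P : probability T R).

(** The bound 2 alone is not inductive; the subtracted 2 / (N + 1) leaves room for the next term. *)
Lemma sum_inv_sqr_le (N : nat) :
  \sum_(0 <= k < N) (k.+1%:R ^+ 2)^-1 <= 2 - 2 / N.+1%:R :> R.
Proof.
elim: N => [|N ih]; first by rewrite big_nil divr1 subrr.
rewrite big_nat_recr//=; apply: le_trans (lerD ih (lexx _)) _.
have N0 : 0 <= N%:R :> R by rewrite ler0n.
rewrite -[N.+2]addn2 -[N.+1]addn1 !natrD; move: (N%:R) N0 => x x0.
rewrite -subr_ge0.
have -> : 2 - 2 / (x + 2) - (2 - 2 / (x + 1) + ((x + 1) ^+ 2)^-1) =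
  x / ((x + 1) ^+ 2 * (x + 2)) :> R.
  by field; apply/andP; split; apply: lt0r_neq0; lra.
by rewrite divr_ge0// mulr_ge0// ?exprn_ge0//; lra.
Qed.

(* Markov plus Borel-Cantelli in integrated form: the series of fourth powers
   has finite expectation. *)
Lemma fourth_moment_ae (f : nat -> T -> R) (K : R) :
  (forall n, L1 P (fun w => f n w ^+ 4)) ->
  (forall n, measurable_fun setT (f n)) ->
  (forall n, Ex P (fun w => f n w ^+ 4) <= K / n.+1%:R ^+ 2) ->
  {ae P, forall w, f n w @[n --> \oo] --> (0 : R)}.
Proof.
move=> lf mf fK.
pose g n w : \bar R := (f n w ^+ 4)%:E.
have g0 n w : (0 <= g n w)%E by rewrite lee_fin exprn_even_ge0.
have mg n : measurable_fun setT (g n).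
  by apply/measurable_EFinP; exact: measurable_funX.
have Ig : P.-integrable setT (fun w => \sum_(0 <= n <oo) g n w)%E.
  apply/integrableP; split.
    by apply: ge0_emeasurable_sum => // n; exact: g0.
  under eq_integral do rewrite gee0_abs ?nneseries_ge0//.
  rewrite integral_nneseries//.
  apply: (@le_lt_trans _ _ (`|K| * 2)%:E); last exact: ltry.
  apply: lime_le; first by apply: is_cvg_nneseries => n _ _; exact: integral_ge0.
  apply: nearW => N.
  under eq_bigr do rewrite (L1_EFin (lf _)).
  rewrite sumEFin lee_fin.
  apply: (@le_trans _ _ (\sum_(0 <= k < N) `|K| * (k.+1%:R ^+ 2)^-1)).
    apply: ler_sum => k _; apply: le_trans (fK k) _.
    by apply: ler_wpM2r; [rewrite invr_ge0 exprn_ge0|exact: ler_norm].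
  rewrite -mulr_sumr; apply: ler_wpM2l => //.
  by apply: le_trans (sum_inv_sqr_le N) _; rewrite gerBl divr_ge0.
have := integrable_ae measurableT Ig.
apply: filterS => w /(_ I) fin.
pose u n := f n w ^+ 4.
have u0 n : 0 <= u n by rewrite exprn_even_ge0.
have : u n @[n --> \oo] --> (0 : R).
  apply: cvg_series_cvg_0; apply: nondecreasing_is_cvgn.
    by apply/nondecreasing_seqP => n; rewrite -subr_ge0 seriesSB.
  exists (fine (\sum_(0 <= n <oo) g n w)%E) => _ [n _ <-].
  rewrite -lee_fin fineK// /series/= -sumEFin.
  by apply: nneseries_lim_ge => k _ _; exact: g0.
move=> /cvgrPdist_lt uc; apply/cvgrPdist_lt => e e0.
have e4 : 0 < e ^+ 4 by rewrite exprn_gt0.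
apply: filterS (uc _ e4) => n; rewrite !sub0r !normrN ger0_norm// /u => h.
rewrite -(@ltr_pXn2r _ 4)// ?nnegrE ?(ltW e0)//.
by rewrite -normrX (ger0_norm (u0 n)).
Qed.

End fourth_moment_ae.

Lemma cvg_invn (R : realType) : (n%:R^-1 : R) @[n --> \oo] --> (0 : R).
Proof. by rewrite -cvg_shiftS; exact: cvg_harmonic. Qed.

Lemma cvg_invsqrtn (R : realType) : ((Num.sqrt n%:R)^-1 : R) @[n --> \oo] --> (0 : R).
Proof.
under eq_fun do rewrite -sqrtrV//.
rewrite -(sqrtr0 R).
by apply: (@cvg_comp _ _ _ _ Num.sqrt); [exact: cvg_invn|exact: sqrt_continuous].
Qed.

Section Im_stieltjes.
Variables (R : realType) (n : nat) (t u v : R).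
Hypothesis v0 : 0 < v.
Implicit Types e : 'I_n * 'I_n -> quat R.

Lemma Im_stieltjes e : (0 < n)%N ->
  complex.Im (stieltjes t u v e) = poisson_mean (spectrum (wig t e)) v u.
Proof.
move=> n0; rewrite stieltjes_mxtrace// /green mxtrace_resolvent ?wig_herm//.
rewrite /poisson_mean -[(_ * n%:R)^-1](_ : ((\sum_(i < n) 2)%N%:R^-1)%:C = _); last first.
  by rewrite fmorphV rmorph_nat sum_nat_const card_ord natrM mulrC.
rewrite cImM /= mul0r addr0; congr (_ * _).
rewrite (big_morph _ (@cImD R) (_ : complex.Im 0 = 0))//; apply: eq_bigr => i _.
rewrite cImV cReD cImD cReN cImN /= /poisson sub0r sqrrN mulNr opprK.
by rewrite -[(_ - u) ^+ 2]sqrrN opprB.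
Qed.

Lemma Im_stieltjes_ge0 e : 0 <= complex.Im (stieltjes t u v e).
Proof.
have [n0|n0] := posnP n.
  by rewrite /stieltjes big1 ?mulr0// => -[i hi]; exfalso; rewrite n0 in hi.
rewrite Im_stieltjes// mulr_ge0 ?invr_ge0 ?ler0n// sumr_ge0// => i _.
by rewrite divr_ge0 ?addr_ge0 ?sqr_ge0// ltW.
Qed.

End Im_stieltjes.

(** * Limits at one fixed z along the sequence of matrices *)

Section wigner_sequence.
Context d (T : measurableType d) (R : realType) (P : probability T R).
Local Notation C := R[i].
Variables (Y : forall n, 'I_n * 'I_n -> T -> quat R) (M : R).
Arguments Y : clear implicits.
Hypothesis mY : forall n p, measurable_fun setT (Y n p).
Hypothesis indepY : forall n,
  mutually_independent P [set p : 'I_n * 'I_n | (p.1 <= p.2)%N]%SET (Y n).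
Hypothesis L2Y : forall n (p : 'I_n * 'I_n), p \in [set p : 'I_n * 'I_n | (p.1 <= p.2)%N]%SET ->
  L1 P (fun w => qnorm (Y n p w) ^+ 2).
Hypothesis EY0 : forall n (j k : 'I_n), (j < k)%N -> forall i,
  Ex P (fun w => qcoord i (Y n (j, k) w)) = 0.
Hypothesis EY1 : forall n (j k : 'I_n), (j < k)%N ->
  Ex P (fun w => qnorm (Y n (j, k) w) ^+ 2) = 1.
Hypothesis EYM : forall n (j : 'I_n), Ex P (fun w => qnorm (Y n (j, j) w) ^+ 2) <= M.
Hypothesis lindeberg : forall eta : R, 0 < eta ->
  (n%:R ^+ 2)^-1 * lindeberg_sum P (Y n) eta @[n --> \oo] --> (0 : R).

Variables u v : R.
Hypothesis v0 : 0 < v.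
Local Notation t n := ((Num.sqrt n%:R)^-1 : R).
Local Notation m n := (mean_stieltjes P u v (Y n)).
Local Notation s n w := (stieltjes (t n) u v (fun p => Y n p w)).

Lemma mean_equation_cvg :
  nm (m n ^+ 2 + (u +i* v) * m n + 1) @[n --> \oo] --> (0 : R).
Proof.
apply/cvgrPdist_le => e e0.
pose a := 18 / v ^+ 2 + 4 * (1 + kappa v).
pose b := 4 / v * (1 + M) + 2176 / v ^+ 3.
pose c := 128 / v ^+ 2.
(* Chosen so that 512 / v^3 eta, the term of [expectation_equation] that does not decay with n,
   equals e / 2. *)
pose eta := e / 2 / (512 / v ^+ 3).
have p3 : 0 < 512 / v ^+ 3 by apply: divr_gt0; [rewrite ltr0n|exact: exprn_gt0].
have eta0 : 0 < eta by apply: divr_gt0 => //; apply: divr_gt0.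
have hc : (a * n%:R^-1 + b * t n + c * ((n%:R ^+ 2)^-1 * lindeberg_sum P (Y n) eta))
    @[n --> \oo] --> (0 : R).
  have -> : (0 : R) = a * 0 + b * 0 + c * 0 by rewrite !mulr0 !addr0.
  apply: cvgD; last by apply: cvgM; [exact: cvg_cst|exact: lindeberg].
  apply: cvgD; first by apply: cvgM; [exact: cvg_cst|exact: cvg_invn].
  by apply: cvgM; [exact: cvg_cst|exact: cvg_invsqrtn].
move/cvgrPdist_le : hc => /(_ (e / 2)); rewrite divr_gt0// => /(_ isT) hc.
apply: filterS (filterI (nbhs_infty_gt 0) hc) => n [n0].
rewrite !sub0r !normrN => /(le_trans (ler_norm _)) {}hc.
rewrite ger0_norm ?nm_ge0//.
have h1 := expectation_equation u n0 v0 (@mY n) (@indepY n) (@L2Y n) (@EY0 n) (@EY1 n) (@EYM n) eta0.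
have h2 := mean_sqr_stieltjes u n0 v0 (@mY n) (@indepY n).
set E := cEx P (fun w => s n w ^+ 2) in h1 h2.
have -> : m n ^+ 2 + (u +i* v) * m n + 1 = ((u +i* v) * m n + 1 + E) - (E - m n ^+ 2) by ring.
apply: le_trans (nmB _ _) _; apply: le_trans (lerD h1 h2) _.
have he : 512 / v ^+ 3 * eta = e / 2 by rewrite /eta [LHS]mulrC (divfK (lt0r_neq0 p3)).
have comb (A1 A2 A3 A4 A5 x y l k q : R) :
    A1 * x + A2 * y * q + A3 * y + k + A4 * l + A5 * x =
    (A1 + A5) * x + (A2 * q + A3) * y + A4 * l + k by ring.
rewrite comb he [leRHS](splitr e) lerD2r; exact: hc.
Qed.

Lemma mean_stieltjes_Im_ge0 n : 0 <= complex.Im (m n).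
Proof. by apply: Ex_ge0 => w; exact: Im_stieltjes_ge0. Qed.

Lemma Im_mean_stieltjes_cvg (r : C) : r ^+ 2 + (u +i* v) * r + 1 = 0 -> 0 < complex.Im r ->
  complex.Im (m n) @[n --> \oo] --> complex.Im r.
Proof.
move=> er r0; apply/cvgrPdist_le => e e0.
have ev : 0 < e * v by rewrite mulr_gt0.
move/cvgrPdist_le : mean_equation_cvg => /(_ _ ev); apply: filterS => n.
rewrite sub0r normrN ger0_norm ?nm_ge0// => h.
have := semicircle_equation_stable v0 er r0 (mean_stieltjes_Im_ge0 n).
move=> /le_trans /(_ (_ : _ <= e)) h2; rewrite distrC -cImN -cImD.
by apply: le_trans (nm_Im _) (h2 _); rewrite ler_pdivrMr.
Qed.

Lemma Im_stieltjes_ae : {ae P, forall w,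
  complex.Im (s n w) - complex.Im (m n) @[n --> \oo] --> (0 : R)}.
Proof.
have ms n : measurable_fun setT (fun w => complex.Im (s n w)).
  have [] // : cmeas (fun w => s n w).
  by apply: (cmeas_stieltjes _ u v0) => p _; exact: mY.
(* The moment bound is for positive sizes, so the index is shifted by one and shifted back at the
   end. *)
have := @fourth_moment_ae _ T R P (fun n w => complex.Im (s n.+1 w) - complex.Im (m n.+1)) (kappa v).
move=> /(_ _ _ _) h; have : {ae P, forall w,
  complex.Im (s n.+1 w) - complex.Im (m n.+1) @[n --> \oo] --> (0 : R)}.
  apply: h => n.
  - apply: (@L1_bounded _ _ _ _ ((v^-1 + `|complex.Im (m n.+1)|) ^+ 4)).
      apply: measurable_funX; apply: measurable_funB => //; exact: measurable_cst.
    move=> w; rewrite normrX lerXn2r ?nnegrE ?addr_ge0 ?invr_ge0 ?normr_ge0 ?(ltW v0)//.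
    apply: le_trans (ler_normB _ _) _; rewrite lerD2r.
    by apply: le_trans (nm_Im _) _; exact: stieltjes_le.
  - by apply: measurable_funB => //; exact: measurable_cst.
  - exact: (fourth_moment_Im u (ltn0Sn n) v0 (@mY n.+1) (@indepY n.+1)).
by apply: filterS => w; rewrite -(cvg_shiftS (fun n => complex.Im (s n w) - complex.Im (m n))).
Qed.

Lemma poisson_mean_ae : exists l : R,
  `|l - Num.sqrt (4 - u ^+ 2) / 2| <= error_bound u v /\
  {ae P, forall w, poisson_mean (spectrum (wig (t n) (fun p => Y n p w))) v u
     @[n --> \oo] --> l}.
Proof.
have [r [er r0 hr]] := semicircle_equation_root u v0.
exists (complex.Im r); split => //.
apply: filterS Im_stieltjes_ae => w h.
have {}h : complex.Im (s n w) - complex.Im (m n) + complex.Im (m n)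
    @[n --> \oo] --> complex.Im r.
  by rewrite -[complex.Im r]add0r; exact: cvgD h (Im_mean_stieltjes_cvg er r0).
apply: cvg_trans h; apply: near_eq_cvg.
apply: filterS (nbhs_infty_gt 0) => n n0.
by rewrite /= subrK Im_stieltjes.
Qed.

End wigner_sequence.

Section expectation_Ex.
Context d (T : measurableType d) (R : realType) (P : probability T R).

Lemma expectation_L1 (f : T -> R) : L1 P f -> 'E_P[f]%E = (Ex P f)%:E.
Proof. by move=> lf; rewrite unlock L1_EFin. Qed.

Lemma L1_expectation_lty (f : T -> R) : measurable_fun setT f ->
  (forall w, 0 <= f w) -> ('E_P[f] < +oo)%E -> L1 P f.
Proof.
move=> mf f0; rewrite unlock => lf; apply/integrableP; split; first exact/measurable_EFinP.
by under eq_integral do rewrite /= ger0_norm//.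
Qed.

End expectation_Ex.

Section self_dual.
Variables (R : realType) (n : nat).

(** Identifies the given matrix with the one rebuilt from its upper triangle; on the diagonal,
    self-duality makes the three imaginary components equal to their opposites. *)
Lemma qherm_self_dual (X : 'M[quat R]_n) : self_dual_hermitian X ->
  qherm (fun p => X p.1 p.2) = X.
Proof.
move=> hX; apply/matrixP => j k; rewrite mxE /=.
have [//|kj|/val_inj <-] := ltngtP j k; first by rewrite -hX.
have := hX j j; case: (X j j) => [[[a b] c] e]; rewrite /qconj /q0 /q1 /q2 /q3 /=.
by case=> hb hc he; congr (_, _, _, _); lra.
Qed.

End self_dual.

Close Scope complex_scope.
Close Scope sesquilinear_scope.

Theorem theorem1p2 (d : measure_display) (T : measurableType d) (R : realType)
  (P : probability T R) (X : forall n : nat, T -> 'M[quat R]_n)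
  (X_meas : forall n (j k : 'I_n),
    [/\ measurable_fun setT (fun w => q0 (X n w j k)),
        measurable_fun setT (fun w => q1 (X n w j k)),
        measurable_fun setT (fun w => q2 (X n w j k)) &
        measurable_fun setT (fun w => q3 (X n w j k))])
  (X_selfdual : forall n w, self_dual_hermitian (X n w))
  (X_indep : forall n,
    mutually_independent P [set p : 'I_n * 'I_n | (p.1 <= p.2)%N]%SET
      (fun (p : 'I_n * 'I_n) w => X n w p.1 p.2))
  (X_mean : forall n (j k : 'I_n), (j <= k)%N ->
    [/\ 'E_P[fun w => q0 (X n w j k)] = 0,
        'E_P[fun w => q1 (X n w j k)] = 0,
        'E_P[fun w => q2 (X n w j k)] = 0 &
        'E_P[fun w => q3 (X n w j k)] = 0]%E)
  (X_diag : exists M : R, forall n (j : 'I_n),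
    ('E_P[fun w => (qnorm (X n w j j) ^+ 2)%R] < M%:E)%E)
  (X_offdiag : forall n (j k : 'I_n), (j < k)%N ->
    ('E_P[fun w => (qnorm (X n w j k) ^+ 2)%R] = 1)%E)
  (X_lindeberg : forall eta : R, 0 < eta ->
    (((n%:R ^+ 2)^-1)%R%:E * \sum_(j < n) \sum_(k < n)
       'E_P[fun w => (qnorm (X n w j k) ^+ 2 *
                      (eta * Num.sqrt n%:R <= qnorm (X n w j k))%R%:R)%R])%E
      @[n --> \oo] --> 0%E) :
  {ae P, forall w,
    weak_cvg (fun n => esd (map_mx (qscale (Num.sqrt n%:R)^-1) (X n w)))
             (@semicircle_cdf R)}.
Proof.
have [M XM] := X_diag.
pose Y n (p : 'I_n * 'I_n) w := X n w p.1 p.2.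
have mY n (p : 'I_n * 'I_n) : measurable_fun setT (Y n p).
  have [m0 m1 m2 m3] := X_meas n p.1 p.2.
  have -> : Y n p = (fun w => (q0 (X n w p.1 p.2), q1 (X n w p.1 p.2),
      q2 (X n w p.1 p.2), q3 (X n w p.1 p.2))).
    by apply/funext => w; rewrite /Y; case: (X n w p.1 p.2) => [[[]]].
  by do 3![apply: measurable_fun_pair => //].
have mq n (p : 'I_n * 'I_n) : measurable_fun setT (fun w => qnorm (Y n p w)).
  exact: measurableT_comp (@measurable_qnorm R) (mY n p).
have L2Y n (p : 'I_n * 'I_n) : p \in [set p : 'I_n * 'I_n | (p.1 <= p.2)%N]%SET ->
    L1 P (fun w => qnorm (Y n p w) ^+ 2).
  rewrite inE leq_eqVlt => hp; apply: L1_expectation_lty.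
  - exact: measurable_funX.
  - by move=> w; exact: sqr_ge0.
  - case/predU1P : hp => [/val_inj hp|hp]; last by rewrite /Y X_offdiag// ltry.
    by rewrite /Y hp; apply: lt_trans (XM _ _) _; rewrite ltry.
have EY1 n (j k : 'I_n) : (j < k)%N -> Ex P (fun w => qnorm (Y n (j, k) w) ^+ 2) = 1.
  move=> jk; have := X_offdiag _ _ _ jk; rewrite expectation_L1; first by case.
  by apply: (@L2Y n (j, k)); rewrite inE/= ltnW.
have EYM n (j : 'I_n) : Ex P (fun w => qnorm (Y n (j, j) w) ^+ 2) <= M.
  have := XM _ j; rewrite expectation_L1 ?lte_fin; first exact: ltW.
  by apply: (@L2Y n (j, j)); rewrite inE/=.
have EY0 n (j k : 'I_n) : (j < k)%N -> forall i, Ex P (fun w => qcoord i (Y n (j, k) w)) = 0.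
  move=> jk i; have [e0 e1 e2 e3] := X_mean _ _ _ (ltnW jk).
  have h (f : T -> R) : 'E_P[f]%E = 0%E -> Ex P f = 0.
    by rewrite unlock /Ex /Rintegral => ->.
  by case: i => [[|[|[|[|//]]]] hi]; apply: h; rewrite /qcoord /Y /=.
have lind (eta : R) : 0 < eta ->
    (n%:R ^+ 2)^-1 * lindeberg_sum P (Y n) eta @[n --> \oo] --> (0 : R).
  move=> eta0; have lt n (j k : 'I_n) : (j < k)%N ->
      ('E_P[fun w => (qnorm (X n w j k) ^+ 2 *
         (eta * Num.sqrt n%:R <= qnorm (X n w j k))%R%:R)%R])%E =
      (lindeberg_term P (Y n) j k eta)%:E.
    move=> jk; rewrite expectation_L1//.
    have jkA : (j, k) \in [set p : 'I_n * 'I_n | (p.1 <= p.2)%N]%SET by rewrite inE/= ltnW.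
    exact: L1_cutoff (L2Y _ _ jkA) (mq n (j, k)).
  (* The expansion uses pairs j < k only; the other terms of the full double sum are nonnegative, so
     a squeeze suffices. *)
  have le n : ((((n%:R ^+ 2)^-1 * lindeberg_sum P (Y n) eta)%:E <=
      ((n%:R ^+ 2)^-1)%:E * \sum_(j < n) \sum_(k < n)
       'E_P[fun w => (qnorm (X n w j k) ^+ 2 *
                      (eta * Num.sqrt n%:R <= qnorm (X n w j k))%R%:R)%R]))%E.
    rewrite EFinM; apply: lee_wpmul2l; first by rewrite lee_fin invr_ge0 exprn_ge0.
    rewrite /lindeberg_sum -sumEFin; apply: lee_sum => j _.
    rewrite -sumEFin big_mkcond; apply: lee_sum => k _.
    case: ifPn => jk; first by rewrite lt.
    by apply: expectation_ge0 => w; rewrite mulr_ge0 ?sqr_ge0.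
  have ge n : (0 <= ((n%:R ^+ 2)^-1 * lindeberg_sum P (Y n) eta)%:E)%E.
    rewrite lee_fin mulr_ge0 ?invr_ge0 ?exprn_ge0// sumr_ge0// => j _.
    rewrite sumr_ge0// => k _; apply: Ex_ge0 => w.
    by rewrite mulr_ge0 ?sqr_ge0.
  have /fine_cvgP[_ //] : ((n%:R ^+ 2)^-1 * lindeberg_sum P (Y n) eta)%:E
      @[n --> \oo] --> 0%:E.
  apply: squeeze_cvge (X_lindeberg _ eta0); last exact: cvg_cst.
  by apply: nearW => n; rewrite ge le.
pose D n w := spectrum (complex_rep (map_mx (qscale (Num.sqrt n%:R)^-1) (X n w))).
have wigE n w : wig (Num.sqrt n%:R)^-1 (fun p => Y n p w) =
    complex_rep (map_mx (qscale (Num.sqrt n%:R)^-1) (X n w)).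
  by rewrite /wig qherm_self_dual.
have pq (p : nat) (q : rat) : exists l : R,
    `|l - Num.sqrt (4 - (ratr q) ^+ 2) / 2| <= error_bound (ratr q) p.+1%:R^-1 /\
    {ae P, forall w, poisson_mean (D n w) p.+1%:R^-1 (ratr q) @[n --> \oo] --> l}.
  have v0 : 0 < p.+1%:R^-1 :> R by rewrite invr_gt0 ltr0n.
  have [l [hl1 hl2]] := poisson_mean_ae mY X_indep L2Y EY0 EY1 EYM lind (ratr q) v0.
  exists l; split; first exact: hl1.
  apply: filterS hl2 => w.
  by under eq_fun do rewrite wigE.
have ae_pq : {ae P, forall w, forall (p : nat) (q : rat), exists l : R,
    poisson_mean (D n w) p.+1%:R^-1 (ratr q) @[n --> \oo] --> l /\
    `|l - Num.sqrt (4 - (ratr q) ^+ 2) / 2| <= error_bound (ratr q) p.+1%:R^-1}.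
  (* Rationals are enumerated through [unpickle], so that almost sure statements are intersected
     over natural numbers. *)
  have : {ae P, forall w, forall (k p : nat), forall q, unpickle k = Some q ->
      exists l : R, poisson_mean (D n w) p.+1%:R^-1 (ratr q) @[n --> \oo] --> l /\
      `|l - Num.sqrt (4 - (ratr q) ^+ 2) / 2| <= error_bound (ratr q) p.+1%:R^-1}.
    apply: ae_foralln => k; apply: ae_foralln => p.
    case: (unpickle k) => [q|]; last exact: nearW.
    have [l [hl1 hl2]] := pq p q.
    by apply: filterS hl2 => w hw _ [<-]; exists l.
  by apply: filterS => w h p q; apply: (h (pickle q)); rewrite pickleK.
apply: filterS ae_pq => w hw x _.
have cw : counting_cdf (D n w) x @[n --> \oo] --> semicircle_cdf x.
  exact: (@counting_cdf_cvg R (fun n => \sum_(i < n) 2)%N (D ^~ w) hw x).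
have dw : esd (map_mx (qscale (Num.sqrt n%:R)^-1) (X n w)) x - counting_cdf (D n w) x
    @[n --> \oo] --> (0 : R).
  have /cvgrPdist_le c0 := @cvg_invn R.
  apply/cvgrPdist_le => e e0; apply: filterS (filterI (nbhs_infty_gt 0) (c0 _ e0)) => n [n0].
  rewrite !sub0r !normrN => hn; apply: le_trans (le_trans (ler_norm _) hn).
  by apply: esd_counting_cdf => //; rewrite -wigE wig_herm.
have h : esd (map_mx (qscale (Num.sqrt n%:R)^-1) (X n w)) x - counting_cdf (D n w) x +
    counting_cdf (D n w) x @[n --> \oo] --> semicircle_cdf x.
  by rewrite -[semicircle_cdf x]add0r; exact: cvgD dw cw.
apply: cvg_trans h; apply: near_eq_cvg; apply: nearW => n.
by rewrite /= subrK.
Qed.
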